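(* Let $I\ge 1$ and let $p_i\ge 1$, $i=1,\dots,I$, be integers. Assume that $(l_{i1},l_{i2},l_{i3})\neq(l_{i'1},l_{i'2},l_{i'3})$ whenever $i\ne i'$, where $(l_{i1},l_{i2},l_{i3})$, $i=1,\dots,I$, are admissible triples with $l_{i1}\le l_{i2}\le l_{i3}$ for every $i$. There exists an absolute constant $K_{p_1\dots p_I}$ (depending only on $p_1,\dots,p_I$) such that, always, $$\left| E\left\{\prod_{i=1}^{I} I_{l_{i1}l_{i2}l_{i3}}^{2p_i}\right\}-\prod_{i=1}^{I}\left\{(2p_i-1)!!\,\Delta_{l_{i1}l_{i2}l_{i3}}^{p_i}\right\}\right|\le \frac{K_{p_1\dots p_I}}{2l_{11}+1}.$$
   Context: $T(\theta,\varphi)$ is a zero-mean, finite-variance, mean-square continuous, isotropic, real Gaussian random field on the unit sphere $S^2$ with spectral representation $T=\sum_{l\ge1}\sum_{m=-l}^{l}a_{lm}Y_{lm}$, where $Y_{lm}$ are the standard orthonormal spherical harmonics ($Y_{l,-m}=(-1)^m\overline{Y_{lm}}$) and $a_{lm}=\int_{S^2}T\,\overline{Y_{lm}}$. Thus the $a_{lm}$ are zero-mean, complex Gaussian, independent over $l\ge1$ and $0\le m\le l$ ($a_{l0}$ is real $N(0,C_l)$; for $m>0$ the real and imaginary parts of $a_{lm}$ are independent $N(0,C_l/2)$), $a_{l,-m}=(-1)^m\overline{a_{lm}}$, and $E|a_{lm}|^2=C_l$. The angular power spectrum satisfies $C_l>0$ for all $l$. Wigner's $3j$ symbols: $\begin{pmatrix}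 l_1&l_2&l_3\\ m_1&m_2&m_3\end{pmatrix}$ is the standard symbol, equal to $0$ unless $m_1+m_2+m_3=0$, $|m_i|\le l_i$ and $|l_1-l_2|\le l_3\le l_1+l_2$, and otherwise equal to $$(-1)^{l_1-l_2-m_3}\left[\frac{(l_1+l_2-l_3)!(l_1-l_2+l_3)!(-l_1+l_2+l_3)!}{(l_1+l_2+l_3+1)!}\right]^{1/2}\left[\prod_{i=1}^3(l_i+m_i)!(l_i-m_i)!\right]^{1/2}\sum_t\frac{(-1)^t}{t!(l_3-l_2+t+m_1)!(l_3-l_1+t-m_2)!(l_1+l_2-l_3-t)!(l_1-t-m_1)!(l_2-t+m_2)!},$$ the sum being over integers $t$ for which all factorial arguments are nonnegative. A triple $(l_1,l_2,l_3)$ of positive integers is admissible if $l_i\le l_j+l_k$ for all choices of $\{i,j,k\}=\{1,2,3\}$ and $l_1+l_2+l_3$ is even. The sample angle averaged bispectrum is $$\widehat B_{l_1l_2l_3}=\sum_{m_1=-l_1}^{l_1}\sum_{m_2=-l_2}^{l_2}\sum_{m_3=-l_3}^{l_3}\begin{pmatrix} l_1&l_2&l_3\\ m_1&m_2&m_3\end{pmatrix}a_{l_1m_1}a_{l_2m_2}a_{l_3m_3},$$ and the normalized bispectrum is $I_{l_1l_2l_3}=(-1)^{(l_1+l_2+l_3)/2}\,\widehat B_{l_1l_2l_3}/\sqrt{C_{l_1}C_{l_2}C_{l_3}}$. For $l_1\le l_2\le l_3$, $\Delta_{l_1l_2l_3}=1+\delta_{l_1}^{l_2}+\delta_{l_2}^{l_3}+3\delta_{l_1}^{l_3}$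 (with $\delta$ Kronecker's delta), i.e. $1$ if $l_1<l_2<l_3$, $2$ if exactly two of the indices coincide, $6$ if $l_1=l_2=l_3$. Also $(2p-1)!!=(2p-1)(2p-3)\cdots1$.
   Formalization: The triples are assumed numbered so that l_11 is the smallest of all the l_{i1}; without this the bound fails, e.g. for I=2, p=(1,2), triples (L,L,L) with L even and large and (1,1,2), where the left side is a nonzero constant in L. *)

(* Defs.v *)
From HB Require Import structures.
From mathcomp Require Import all_boot all_order all_algebra.
From mathcomp Require Import all_classical all_reals all_analysis.
From mathcomp Require Import complex.

Set Implicit Arguments.
Unset Strict Implicit.
Unset Printing Implicit Defensive.

Import Order.TTheory GRing.Theory Num.Theory.
Import numFieldNormedType.Exports.

Local Open Scope classical_set_scope.
Local Open Scope ring_scope.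
Local Open Scope complex_scope.

(** * Spherical harmonics *)

(* Rodrigues' formula. *)
Definition legendre (R : realType) (l : nat) : {poly R} :=
  ((2 ^ l * l`!)%N%:R)^-1 *: (('X^2 - 1) ^+ l)^`(l).

(* P_{lm}(cos theta) for 0 <= m <= l, with the Condon-Shortley phase (-1)^m;
   since 0 <= theta <= pi, sin theta stands for (1 - cos^2 theta)^(1/2). *)
Definition assoc_legendre_cos (R : realType) (l m : nat) (theta : R) : R :=
  (-1) ^+ m * sin theta ^+ m * ((legendre R l)^`(m)).[cos theta].

Definition sph_harm_nat (R : realType) (l m : nat) (theta phi : R) : R[i] :=
  (Num.sqrt ((l.*2.+1)%:R / (4 * pi) * ((l - m)`!)%:R / ((l + m)`!)%:R)
     * assoc_legendre_cos l m theta)%:C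
  * (cos (m%:R * phi) +i* sin (m%:R * phi)).

Definition sph_harm (R : realType) (l : nat) (m : int) (theta phi : R) : R[i] :=
  match m with
  | Posz k => sph_harm_nat l k theta phi
  | Negz k => (-1) ^+ k.+1 * conjc (sph_harm_nat l k.+1 theta phi)
  end.

(* The i-th element of the range -l, ..., l of the order m. *)
Definition order_of (l : nat) (i : 'I_(l.*2.+1)) : int := (i : nat)%:Z - l%:Z.

(** * Probabilistic vocabulary *)

Section Probability.
Context {d : measure_display} {Omega : measurableType d} {R : realType}.
Variable P : probability Omega R.

(* X has law N(m, s^2); the case s = 0 is the point mass at m, which is not
   what the library's [normal_prob] gives there. *)
Definition has_normal_law (X : Omega -> R) (m s : R) : Prop :=
  measurable_fun setT X /\
  forall B : set R, measurable B ->
    P (X @^-1` B) = if s == 0 then \d_m B else normal_prob m s B.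

Definition independent_family {d' : measure_display} {E : measurableType d'}
    (J : choiceType) (D : set J) (X : J -> Omega -> E) : Prop :=
  forall (s : seq J) (B : J -> set E),
    uniq s -> {in s, forall j, D j} -> (forall j, measurable (B j)) ->
    P (\bigcap_(j in [set` s]) (X j @^-1` B j))
      = (\prod_(j <- s) P (X j @^-1` B j))%E.

Definition independent2 (X Y : Omega -> R) : Prop :=
  forall A B : set R, measurable A -> measurable B ->
    P (X @^-1` A `&` Y @^-1` B) = (P (X @^-1` A) * P (Y @^-1` B))%E.

(** * Gaussian isotropic fields on the sphere *)

Definition sphere : set 'rV[R]_3 := [set x | \sum_(j < 3) x 0 j ^+ 2 = 1].

Definition sph_point (theta phi : R) : 'rV[R]_3 :=
  \row_(j < 3) tnth [tuple sin theta * cos phi; sin theta * sin phi; cos theta] j.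

Definition is_rotation (A : 'M[R]_3) : Prop := A *m A^T = 1%:M /\ \det A = 1.

(* Only the values of T on the sphere are relevant.  Joint measurability is
   what gives a meaning to the integrals defining the harmonic coefficients;
   every mean-square continuous field has a version satisfying it. *)
Record gaussian_isotropic_field (T : 'rV[R]_3 -> Omega -> R) : Prop := {
  field_gaussian : forall (n : nat) (x : 'I_n -> 'rV[R]_3) (c : 'I_n -> R),
    (forall i, sphere (x i)) ->
    exists m s : R, has_normal_law (fun w => \sum_(i < n) c i * T (x i) w) m s;
  field_zero_mean : forall x, sphere x -> ('E_P[T x] = 0)%E;
  field_finite_variance : forall x, sphere x ->
    ('E_P[fun w => (T x w ^+ 2)%R] < +oo)%E;
  field_ms_continuous : forall x, sphere x ->
    ('E_P[fun w => ((T y w - T x w) ^+ 2)%R])%E @[y --> within sphere (nbhs x)]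
      --> (0 : \bar R)%E;
  field_jointly_measurable :
    measurable_fun setT
      (fun z : (R * R) * Omega => T (sph_point z.1.1 z.1.2) z.2);
  field_isotropic : forall (A : 'M[R]_3) (n : nat)
      (x : 'I_n -> 'rV[R]_3) (B : 'I_n -> set R),
    is_rotation A -> (forall i, sphere (x i)) -> (forall i, measurable (B i)) ->
    P (\bigcap_(i in [set: 'I_n]) (T (x i *m A) @^-1` B i))
      = P (\bigcap_(i in [set: 'I_n]) (T (x i) @^-1` B i))
}.

Definition sphere_integral (f : R -> R -> R) : R :=
  \int[((@lebesgue_measure R) \x (@lebesgue_measure R))%E]_(z in
      `[0, pi]%classic `*` `[0, 2 * pi]%classic) (f z.1 z.2 * sin z.1).

Definition harmonic_coef (T : 'rV[R]_3 -> Omega -> R) (l : nat) (m : int)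
    (w : Omega) : R[i] :=
  let Ybar theta phi := conjc (sph_harm l m theta phi) in
  sphere_integral (fun theta phi =>
      T (sph_point theta phi) w * complex.Re (Ybar theta phi))
  +i* sphere_integral (fun theta phi =>
      T (sph_point theta phi) w * complex.Im (Ybar theta phi)).

(* T = sum_(l >= 1) sum_m a_lm Y_lm in L^2(P), at every point of the sphere. *)
Definition spectral_representation (T : 'rV[R]_3 -> Omega -> R)
    (a : nat -> int -> Omega -> R[i]) : Prop :=
  forall theta phi : R, 0 <= theta <= pi -> 0 <= phi <= 2 * pi ->
    ('E_P[fun w =>
       (complex.Re (`|(T (sph_point theta phi) w)%:C
          - \sum_(1 <= l < L.+1) \sum_(i < l.*2.+1)
              a l (order_of i) w * sph_harm l (order_of i) theta phi| ^+ 2))%R])%E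
      @[L --> \oo] --> (0 : \bar R)%E.

(* The law of the harmonic coefficients of a field with angular power
   spectrum C. *)
Record gaussian_coefficients (C : nat -> R)
    (a : nat -> int -> Omega -> R[i]) : Prop := {
  coef_conj : forall (l m : nat) w, (0 < l)%N -> (m <= l)%N ->
    a l (- m%:Z) w = (-1) ^+ m * conjc (a l m%:Z w);
  coef0_real : forall (l : nat) w, (0 < l)%N -> complex.Im (a l 0 w) = 0;
  coef0_law : forall l : nat, (0 < l)%N ->
    has_normal_law (fun w => complex.Re (a l 0 w)) 0 (Num.sqrt (C l));
  coef_Re_law : forall l m : nat, (0 < m <= l)%N ->
    has_normal_law (fun w => complex.Re (a l m%:Z w)) 0 (Num.sqrt (C l / 2));
  coef_Im_law : forall l m : nat, (0 < m <= l)%N ->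
    has_normal_law (fun w => complex.Im (a l m%:Z w)) 0 (Num.sqrt (C l / 2));
  coef_Re_Im_independent : forall l m : nat, (0 < m <= l)%N ->
    independent2 (fun w => complex.Re (a l m%:Z w))
                 (fun w => complex.Im (a l m%:Z w));
  coef_independent :
    independent_family [set lm : nat * nat | (0 < lm.1)%N /\ (lm.2 <= lm.1)%N]
      (fun lm w => (complex.Re (a lm.1 lm.2%:Z w), complex.Im (a lm.1 lm.2%:Z w)))
}.

End Probability.

(** * Wigner's 3j symbols and the bispectrum *)

(* Only used at nonnegative arguments. *)
Definition zfact (z : int) : nat := (`|z|%N)`!.

(* In the sum, t <= l1 + l2 - l3 is forced, so t ranges over 0, ..., l1 + l2. *)
Definition wigner3j (R : realType) (l1 l2 l3 : nat) (m1 m2 m3 : int) : R :=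
  let L1 := l1%:Z in let L2 := l2%:Z in let L3 := l3%:Z in
  if [&& m1 + m2 + m3 == 0, `|m1| <= L1, `|m2| <= L2, `|m3| <= L3,
         `|L1 - L2| <= L3 & L3 <= L1 + L2] then
    (-1) ^ (L1 - L2 - m3)
    * Num.sqrt ((zfact (L1 + L2 - L3) * zfact (L1 - L2 + L3)
                 * zfact (- L1 + L2 + L3))%N%:R
                / (zfact (L1 + L2 + L3 + 1))%:R)
    * Num.sqrt ((zfact (L1 + m1) * zfact (L1 - m1)
                 * (zfact (L2 + m2) * zfact (L2 - m2))
                 * (zfact (L3 + m3) * zfact (L3 - m3)))%N%:R)
    * \sum_(t < (l1 + l2).+1 |
          [&& 0 <= L3 - L2 + t%:Z + m1, 0 <= L3 - L1 + t%:Z - m2,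
              0 <= L1 + L2 - L3 - t%:Z, 0 <= L1 - t%:Z - m1
            & 0 <= L2 - t%:Z + m2])
        (-1) ^+ t
        / (t`! * zfact (L3 - L2 + t%:Z + m1) * zfact (L3 - L1 + t%:Z - m2)
           * zfact (L1 + L2 - L3 - t%:Z) * zfact (L1 - t%:Z - m1)
           * zfact (L2 - t%:Z + m2))%N%:R
  else 0.

Definition admissible (l1 l2 l3 : nat) : bool :=
  [&& (0 < l1)%N, (0 < l2)%N, (0 < l3)%N,
      (l1 <= l2 + l3)%N, (l2 <= l1 + l3)%N, (l3 <= l1 + l2)%N
    & ~~ odd (l1 + l2 + l3)].

Section Bispectrum.
Context {Omega : Type} {R : realType}.
Variable a : nat -> int -> Omega -> R[i].

Definition bispectrum (l1 l2 l3 : nat) (w : Omega) : R[i] :=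
  \sum_(i1 < l1.*2.+1) \sum_(i2 < l2.*2.+1) \sum_(i3 < l3.*2.+1)
    (wigner3j R l1 l2 l3 (order_of i1) (order_of i2) (order_of i3))%:C
    * a l1 (order_of i1) w * a l2 (order_of i2) w * a l3 (order_of i3) w.

(* For l1 + l2 + l3 even, the bispectrum is real: the 3j symbol is invariant
   under (m1, m2, m3) -> (-m1, -m2, -m3) and a_{l,-m} = (-1)^m conj(a_{lm}).
   Taking its real part only changes its type. *)
Definition normalized_bispectrum (C : nat -> R) (l1 l2 l3 : nat) (w : Omega) : R :=
  (-1) ^+ (l1 + l2 + l3)./2 * complex.Re (bispectrum l1 l2 l3 w)
  / Num.sqrt (C l1 * C l2 * C l3).

End Bispectrum.

Definition bisp_Delta (l1 l2 l3 : nat) : nat :=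
  (1 + (l1 == l2) + (l2 == l3) + 3 * (l1 == l3))%N.

Definition odd_double_fact (p : nat) : nat := (\prod_(k < p) (2 * k + 1))%N.

(* Main.v *)
Require Import Defs.
From HB Require Import structures.
From mathcomp Require Import all_boot all_order all_algebra.
From mathcomp Require Import all_classical all_reals all_analysis.
From mathcomp Require Import complex.
From mathcomp Require Import measurable_realfun.
From mathcomp Require Import ring lra zify.
From mathcomp Require Import -(notations) mpoly.

Import Order.TTheory GRing.Theory Num.Theory.
Import numFieldNormedType.Exports.

Local Open Scope ring_scope.

Set Implicit Arguments.
Unset Strict Implicit.

(** In terms of standard real Gaussian coordinates g_j of the field, where j
    runs over the pairs of a degree l and of an order n, the normalized
    bispectrum of the triple v is, up to a sign, a cubic form
    B_v = sum_(i, j, k) S_v(i, j, k) g_i g_j g_k with a symmetric real tensor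
    S_v ([normalized_bispectrum_sum]).  The sign disappears in even powers.
    The theorem rests on three properties of S_v, all consequences of the
    rotation invariance of the 3j symbols.
    - S_v is traceless: the contraction of two of its legs would be an
      invariant vector in a representation of positive degree.
    - 6 <S_v, S_u> is Delta_v if u = v and 0 otherwise, for distinct triples
      (orthogonality of the degrees and normalization of the symbol).
    - Contracting S_v with a tensor t along one leg, or along two, divides the
      squared norm of t by at least 2 l + 1, l being the least degree of v: the
      Gram matrix of the symbol along one leg is the identity divided by its
      dimension.  This is the hypothesis called gain below, with the bound
      eps = 1 / (2 l_11 + 1) common to all the triples.

    Let Pi be a product of such forms.  Gaussian integration by parts gives
    E(B_v Pi) = sum S_v(i, j, k) E(D_i D_j D_k Pi), without lower order terms
    because S_v is traceless.  By Leibniz' rule the three derivatives are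
    distributed over the factors of Pi.  If all of them act on the same factor
    B_u, the result is 6 <S_v, S_u> times the expectation of the remaining
    product; alone, these terms satisfy the recurrence of the moments of
    independent centred normal variables of variances Delta_u, whose even
    moments are (2 p - 1)!! Delta^p.  In every other term v is tied to at least
    two factors: contracting S_v with the first of them yields a tensor of
    squared norm at most eps, and contracting the latter with another one a
    tensor of squared norm at most eps^2 ([remainder21], [remainder111]).  What
    is left is a pairing with expectations of derivatives of a product of
    cubic forms, whose sums of squares are bounded independently of the
    degrees; the Cauchy-Schwarz inequality gives an error of order eps
    ([chaos_product_bound]).

    Invariance of the 3j symbols is not part of their definition by Racah's
    formula.  It is expressed by the relations with the raising and lowering
    operators; the first is a telescoping sum, the second follows from it by
    the symmetry of the symbol under change of sign of the orders.  All the
    other properties are then obtained by descending along the ladder from the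
    highest order, where the formula reduces to a single term. *)

(** * Sums over finite index sets *)

Section FiniteSums.
Variable R : realFieldType.

Lemma sum_single (M : nmodType) (K : finType) (f : K -> M) i :
  (forall j, j != i -> f j = 0) -> \sum_j f j = f i.
Proof. by move=> h; rewrite (bigD1 i)//= big1 ?addr0. Qed.

Lemma sum_unit (M : nmodType) (f : unit -> M) : \sum_a f a = f tt.
Proof. by apply: sum_single => -[]. Qed.

Lemma sumsq_ge0 (K : finType) (f : K -> R) : 0 <= \sum_s f s ^+ 2.
Proof. by apply: sumr_ge0 => s _; rewrite sqr_ge0. Qed.

Lemma cauchy_schwarz_sum (K : finType) (f g : K -> R) :
  (\sum_s f s * g s) ^+ 2 <= (\sum_s f s ^+ 2) * (\sum_s g s ^+ 2).
Proof.
set a := \sum_s f s ^+ 2; set b := \sum_s g s ^+ 2; set c := \sum_s f s * g s.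
have b0 : 0 <= b by exact: sumsq_ge0.
have key : 0 <= b * (a * b - c ^+ 2).
  have -> : b * (a * b - c ^+ 2) = \sum_s (b * f s - c * g s) ^+ 2.
    transitivity (\sum_s (b ^+ 2 * (f s ^+ 2) - 2 * b * c * (f s * g s)
                          + c ^+ 2 * (g s ^+ 2))).
      rewrite !big_split /= sumrN -!mulr_sumr -/a -/b -/c; ring.
    by apply: eq_bigr => s _; ring.
  exact: sumsq_ge0.
have [b_eq0|b_neq0] := eqVneq b 0.
  have g0 s : g s = 0.
    have := b_eq0; rewrite /b => /eqP.
    rewrite psumr_eq0; last by move=> *; exact: sqr_ge0.
    by move=> /allP /(_ s (mem_index_enum _)); rewrite /= sqrf_eq0 => /eqP.
  have -> : c = 0 by rewrite /c big1// => s _; rewrite g0 mulr0.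
  by rewrite b_eq0 mulr0 expr0n.
by move: key; rewrite pmulr_rge0 ?subr_ge0// lt_def b_neq0.
Qed.

Lemma cauchy_schwarz_sum2 (K L : finType) (f g : K -> L -> R) :
  (\sum_s \sum_t f s t * g s t) ^+ 2
    <= (\sum_s \sum_t f s t ^+ 2) * (\sum_s \sum_t g s t ^+ 2).
Proof. by rewrite !pair_bigA; exact: (@cauchy_schwarz_sum (K * L)%type). Qed.

Lemma cauchy_schwarz_sum3 (K L M : finType) (f g : K -> L -> M -> R) :
  (\sum_s \sum_t \sum_u f s t u * g s t u) ^+ 2
    <= (\sum_s \sum_t \sum_u f s t u ^+ 2) * (\sum_s \sum_t \sum_u g s t u ^+ 2).
Proof.
by rewrite !pair_bigA; exact: cauchy_schwarz_sum.
Qed.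

Lemma cauchy_schwarz_sum5 (K L M N P : finType) (f g : K -> L -> M -> N -> P -> R) :
  (\sum_s \sum_t \sum_u \sum_v \sum_w f s t u v w * g s t u v w) ^+ 2
    <= (\sum_s \sum_t \sum_u \sum_v \sum_w f s t u v w ^+ 2)
       * (\sum_s \sum_t \sum_u \sum_v \sum_w g s t u v w ^+ 2).
Proof.
by rewrite !pair_bigA; exact: cauchy_schwarz_sum.
Qed.

Lemma contract_norm_le (K L M : finType) (f : L -> M -> R) (g : K -> M -> R) :
  \sum_s \sum_a (\sum_y f a y * g s y) ^+ 2
    <= (\sum_a \sum_y f a y ^+ 2) * (\sum_s \sum_y g s y ^+ 2).
Proof.
rewrite mulr_sumr; apply: ler_sum => s _; rewrite mulr_suml.
by apply: ler_sum => a _; exact: cauchy_schwarz_sum.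
Qed.

(** The reorganizations of sums in the expansions below are all of this
    kind: a tensor f is contracted with g, which was itself paired with h. *)
Lemma contract_sum (K L M : finType) (f : K -> L -> R) (g : L -> M -> R)
    (h : K -> M -> R) c :
  \sum_a \sum_b f a b * (c * \sum_d g b d * h a d)
    = c * \sum_a \sum_d (\sum_b f a b * g b d) * h a d.
Proof.
rewrite mulr_sumr; apply: eq_bigr => a _.
under eq_bigr do rewrite mulrCA mulr_sumr.
rewrite -mulr_sumr exchange_big /=; congr (_ * _); apply: eq_bigr => d _.
by rewrite mulr_suml; apply: eq_bigr => b _; rewrite mulrA.
Qed.

Lemma contract_sum11 (L M : finType) (f : L -> R) (g : L -> M -> R)
    (h : M -> R) c :
  \sum_b f b * (c * \sum_d g b d * h d) = c * \sum_d (\sum_b f b * g b d) * h d.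
Proof.
have := contract_sum (fun _ : unit => f) g (fun _ => h) c.
by rewrite !sum_unit.
Qed.

Lemma contract_sum12 (L M N : finType) (f : L -> R) (g : L -> M -> N -> R)
    (h : M -> N -> R) c :
  \sum_b f b * (c * \sum_d \sum_e g b d e * h d e)
    = c * \sum_d \sum_e (\sum_b f b * g b d e) * h d e.
Proof.
under eq_bigr do rewrite pair_bigA.
rewrite (contract_sum11 f (fun b p => g b p.1 p.2) (fun p => h p.1 p.2)).
by rewrite pair_bigA.
Qed.

Lemma contract_sum21 (K L M : finType) (f : K -> L -> R) (g : K -> L -> M -> R)
    (h : M -> R) c :
  \sum_a \sum_b f a b * (c * \sum_d g a b d * h d)
    = c * \sum_d (\sum_a \sum_b f a b * g a b d) * h d.
Proof.
rewrite pair_bigA (contract_sum11 (fun p => f p.1 p.2) (fun p => g p.1 p.2)) /=.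
by congr (_ * _); apply: eq_bigr => d _; rewrite pair_bigA.
Qed.

Lemma exchange_sum3 (K L M : finType) (f : K -> L -> M -> R) :
  \sum_i \sum_j \sum_k f i j k = \sum_k \sum_j \sum_i f i j k.
Proof.
under eq_bigr do rewrite exchange_big.
by rewrite exchange_big; apply: eq_bigr => k _; rewrite exchange_big.
Qed.

Lemma sqr_addr_le (x y : R) : (x + y) ^+ 2 <= 2 * (x ^+ 2 + y ^+ 2).
Proof. by have := sqr_ge0 (x - y); nra. Qed.

(** The shift from c to c + 1 spares a square root in the constants. *)
Lemma norm_le_of_sqr (x c e : R) : 0 <= c -> 0 <= e ->
  x ^+ 2 <= e ^+ 2 * c -> `|x| <= (c + 1) * e.
Proof.
move=> c0 e0 h.
rewrite -(@ler_pXn2r _ 2)// ?nnegrE ?mulr_ge0 ?addr_ge0//.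
rewrite real_normK ?num_real// (le_trans h)// exprMn mulrC.
by rewrite ler_wpM2r ?sqr_ge0//; nra.
Qed.
End FiniteSums.

(** * Integration by parts for products of cubic forms *)

Section Chaos.

(** The algebra A stands for polynomials in Gaussian coordinates X_j, with the
    partial derivatives D_j and the expectation E; integration by parts is only
    available for the indices of genuine Gaussian variables. *)
Variables (R : realFieldType) (J : finType) (A : comAlgType R).
Variables (X : J -> A) (D : J -> A -> A) (E : A -> R) (valid : pred J).
Hypothesis D_lin : forall j (a : R) p q, D j (a *: p + q) = a *: D j p + D j q.
Hypothesis D_mul : forall j p q, D j (p * q) = D j p * q + p * D j q.
Hypothesis D_X : forall i j, D j (X i) = (i == j)%:R.
Hypothesis E_lin : forall (a : R) p q, E (a *: p + q) = a * E p + E q.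
Hypothesis E_1 : E 1 = 1.
Hypothesis stein : forall i p, valid i -> E (X i * p) = E (D i p).

Lemma D_0 j : D j 0 = 0.
Proof. by have := D_lin j (-1) 0 0; rewrite !scaleN1r !addNr. Qed.
Lemma D_add j p q : D j (p + q) = D j p + D j q.
Proof. by have := D_lin j 1 p q; rewrite !scale1r. Qed.
Lemma D_scale j a p : D j (a *: p) = a *: D j p.
Proof. by have := D_lin j a p 0; rewrite D_0 !addr0. Qed.
Lemma D_sum j (I : Type) (r : seq I) (F : I -> A) :
  D j (\sum_(i <- r) F i) = \sum_(i <- r) D j (F i).
Proof. by elim/big_rec2: _ => [|i y x _ <-]; rewrite ?D_0 ?D_add. Qed.
Lemma D_1 j : D j 1 = 0.
Proof.
have := D_mul j 1 1; rewrite !mulr1 mul1r => /eqP.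
by rewrite -subr_eq0 opprD addNKr oppr_eq0 => /eqP.
Qed.
Lemma E_0 : E 0 = 0.
Proof. by have := E_lin (-1) 0 0; rewrite scaleN1r mulN1r !addNr. Qed.
Lemma E_add p q : E (p + q) = E p + E q.
Proof. by have := E_lin 1 p q; rewrite scale1r mul1r. Qed.
Lemma E_scale a p : E (a *: p) = a * E p.
Proof. by have := E_lin a p 0; rewrite E_0 !addr0. Qed.
Lemma E_sum (I : Type) (r : seq I) (F : I -> A) :
  E (\sum_(i <- r) F i) = \sum_(i <- r) E (F i).
Proof. by elim/big_rec2: _ => [|i y x _ <-]; rewrite ?E_0 ?E_add. Qed.

(** The sum, over an indexed family F and over all the derivations of order n,
    of the squares of the expectations of the derivatives. Since the order is
    recorded by enlarging the index set, products can be treated one derivative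
    at a time. *)
Fixpoint dsum n (K : finType) (F : K -> A) : R :=
  if n is n'.+1 then dsum n' (fun q : (K * J)%type => D q.2 (F q.1))
  else \sum_s E (F s) ^+ 2.

Definition dbounded (K : finType) (F : K -> A) (c : nat -> R) :=
  forall n, dsum n F <= c n.

Lemma eq_dsum n (K : finType) (F G : K -> A) : F =1 G -> dsum n F = dsum n G.
Proof.
elim: n K F G => [|n IH] K F G h /=; first by apply: eq_bigr => s _; rewrite h.
by apply: IH => q; rewrite h.
Qed.

Lemma dsum_ge0 n (K : finType) (F : K -> A) : 0 <= dsum n F.
Proof. by elim: n K F => [|n IH] K F /=; [exact: sumsq_ge0|exact: IH]. Qed.

Lemma dsum_reindex n (K L : finType) (h : L -> K) (F : K -> A) :
  bijective h -> dsum n (F \o h) = dsum n F.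
Proof.
elim: n K L h F => [|n IH] K L h F bh /=.
  by rewrite [RHS](reindex h)//; exact: onW_bij.
rewrite -(@IH _ _ (fun q : L * J => (h q.1, q.2)))//.
case: bh => g gK hK.
by exists (fun q : K * J => (g q.1, q.2)) => -[a b] /=; rewrite ?gK ?hK.
Qed.

Lemma dsum_add n (K : finType) (F G : K -> A) :
  dsum n (fun s => F s + G s) <= 2 * (dsum n F + dsum n G).
Proof.
elim: n K F G => [|n IH] K F G /=.
  rewrite -big_split /= mulr_sumr; apply: ler_sum => s _.
  by rewrite E_add sqr_addr_le.
by under eq_dsum do rewrite D_add; exact: IH.
Qed.

Lemma dsum_zero n (K : finType) (F : K -> A) : (forall s, F s = 0) -> dsum n F = 0.
Proof.
elim: n K F => [|n IH] K F h /=.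
  by rewrite big1// => s _; rewrite h E_0 expr0n.
by apply: IH => q; rewrite h D_0.
Qed.

Lemma dbounded_one : dbounded (fun _ : unit => 1) (fun _ => 1).
Proof.
case=> [|n] /=; first by rewrite (sum_single (i := tt)) ?E_1 ?expr1n// => -[].
by rewrite dsum_zero// => q; rewrite D_1.
Qed.

(** The constant produced by Leibniz' rule for a product G F: c0 bounds the
    sums without derivative and c' the sums in which one derivative acted on G,
    as functions of the bounds c for F. *)
Fixpoint leib_const (c0 : (nat -> R) -> R) (c' : (nat -> R) -> nat -> R)
    (n : nat) (c : nat -> R) : R :=
  if n is n'.+1 then 2 * (c' c n' + leib_const c0 c' n' (fun m => c m.+1))
  else c0 c.

(** Induction on the number of derivatives: the first of them acts either
    on G, which is the hypothesis on its derivative, or on F, which only shifts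
    the sequence of bounds of F. *)
Lemma dbounded_leibniz (K1 : finType) (G : K1 -> A) c0 c' :
  (forall (K : finType) (F : K -> A) c, dbounded F c ->
     \sum_s \sum_a E (G a * F s) ^+ 2 <= c0 c) ->
  (forall (K : finType) (F : K -> A) c, dbounded F c ->
     dbounded (fun q : K * (K1 * J) => D q.2.2 (G q.2.1) * F q.1) (c' c)) ->
  forall (K : finType) (F : K -> A) c, dbounded F c ->
     dbounded (fun q : K * K1 => G q.2 * F q.1) (fun n => leib_const c0 c' n c).
Proof.
move=> h0 h1 K F c bF n; elim: n K F c bF => [|n IH] K F c bF /=.
  by rewrite -(pair_bigA _ (fun s a => E (G a * F s) ^+ 2)); exact: h0.
under eq_dsum do rewrite D_mul.
apply: le_trans (dsum_add _ _ _) _; rewrite ler_pM2l//; apply: lerD.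
  rewrite -[leLHS](@dsum_reindex _ _ _
    (fun q : K * (K1 * J) => ((q.1, q.2.1), q.2.2))); first exact: h1.
  by exists (fun q => (q.1.1, (q.1.2, q.2))) => [[a [b d]]|[[a b] d]].
rewrite -[leLHS](@dsum_reindex _ _ _
    (fun q : (K * J) * K1 => ((q.1.1, q.2), q.1.2))).
  by apply: (IH _ (fun q : K * J => D q.2 (F q.1))) => m; exact: (bF m.+1).
by exists (fun q => ((q.1.1, q.2), q.1.2)) => [[[a b] d]|[[a b] d]].
Qed.

Lemma stein_linear (f : J -> R) P : (forall k, f k != 0 -> valid k) ->
  E ((\sum_k f k *: X k) * P) = \sum_k f k * E (D k P).
Proof.
move=> vf; rewrite mulr_suml E_sum; apply: eq_bigr => k _.
rewrite -scalerAl E_scale; have [->|fk] := eqVneq (f k) 0; first by rewrite !mul0r.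
by rewrite stein ?vf.
Qed.

(** The derivative of one variable along the other produces the trace of f,
    which vanishes. *)
Lemma stein_quadratic (f : J -> J -> R) P :
  (forall j k, f j k != 0 -> valid j /\ valid k) -> \sum_j f j j = 0 ->
  E ((\sum_j \sum_k f j k *: (X j * X k)) * P)
    = \sum_j \sum_k f j k * E (D k (D j P)).
Proof.
move=> vf tr.
transitivity (\sum_j \sum_k (f j k * (k == j)%:R * E P + f j k * E (D k (D j P)))).
  rewrite mulr_suml E_sum; apply: eq_bigr => j _.
  rewrite mulr_suml E_sum; apply: eq_bigr => k _.
  rewrite -scalerAl E_scale -[X in E X]mulrA.
  have [->|fjk] := eqVneq (f j k) 0; first by rewrite !mul0r addr0.
  have [vj vk] := vf _ _ fjk.
  rewrite stein// D_mul D_X E_add mulrDr stein//; congr (_ + _).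
  by case: eqP => _; rewrite ?mulr1 ?mul1r// !(mul0r, mulr0) E_0 mulr0.
under eq_bigr do rewrite big_split /=.
rewrite big_split /= -[RHS]add0r; congr (_ + _).
transitivity ((\sum_j f j j) * E P); last by rewrite tr mul0r.
rewrite mulr_suml; apply: eq_bigr => j _.
rewrite (sum_single (i := j)) ?eqxx ?mulr1// => k /negPf ->.
by rewrite mulr0 mul0r.
Qed.

(** The terms in which two of the variables meet are partial traces of f,
    so that only the term with three derivatives on P survives. *)
Lemma stein_cubic (f : J -> J -> J -> R) P :
  (forall i j k, f i j k != 0 -> [/\ valid i, valid j & valid k]) ->
  (forall k, \sum_i f i i k = 0) -> (forall j, \sum_i f i j i = 0) ->
  (forall i, \sum_j f i j j = 0) ->
  E ((\sum_i \sum_j \sum_k f i j k *: (X i * (X j * X k))) * P)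
    = \sum_i \sum_j \sum_k f i j k * E (D k (D j (D i P))).
Proof.
move=> vf tr12 tr13 tr23.
transitivity (\sum_i \sum_j \sum_k
   (f i j k * (j == i)%:R * E (X k * P) + f i j k * (k == i)%:R * E (X j * P)
     + f i j k * E (X j * X k * D i P))).
  rewrite mulr_suml E_sum; apply: eq_bigr => i _.
  rewrite mulr_suml E_sum; apply: eq_bigr => j _.
  rewrite mulr_suml E_sum; apply: eq_bigr => k _.
  rewrite -scalerAl E_scale.
  have [->|fijk] := eqVneq (f i j k) 0; first by rewrite !mul0r !addr0.
  have [vi vj vk] := vf _ _ _ fijk.
  have -> : X i * (X j * X k) * P = X i * (X j * X k * P) by rewrite -mulrA.
  rewrite (stein (X j * X k * P) vi) 2!D_mul !D_X mulrDl !E_add !mulrDr.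
  congr (_ + _ + _).
    by case: eqP => _; rewrite ?mulr1 ?mul1r// !(mul0r, mulr0) E_0 mulr0.
  by case: eqP => _; rewrite ?mulr1 ?mul1r// !(mul0r, mulr0) E_0 mulr0.
under eq_bigr do under eq_bigr do rewrite !big_split /=.
under eq_bigr do rewrite !big_split /=.
rewrite !big_split /= -[RHS]add0r; congr (_ + _); last first.
  apply: eq_bigr => i _.
  rewrite -(@stein_quadratic (f i))//; last by move=> j k /vf[].
  rewrite mulr_suml E_sum; apply: eq_bigr => j _.
  rewrite mulr_suml E_sum; apply: eq_bigr => k _.
  by rewrite -scalerAl E_scale.
rewrite -[RHS]addr0; congr (_ + _).
  under eq_bigr do rewrite exchange_big /=.
  rewrite exchange_big /= big1// => k _.
  transitivity ((\sum_i f i i k) * E (X k * P)); last by rewrite tr12 mul0r.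
  rewrite mulr_suml; apply: eq_bigr => i _.
  rewrite (sum_single (i := i)) ?eqxx ?mulr1// => j /negPf ->.
  by rewrite mulr0 mul0r.
rewrite exchange_big /= big1// => j _.
transitivity ((\sum_i f i j i) * E (X j * P)); last by rewrite tr13 mul0r.
rewrite mulr_suml; apply: eq_bigr => i _.
rewrite (sum_single (i := i)) ?eqxx ?mulr1// => k /negPf ->.
by rewrite mulr0 mul0r.
Qed.

(** S_gain is the property that makes the bispectra asymptotically Gaussian and
    independent; S_cross their orthogonality. *)
Variables (V : finType) (S : V -> J -> J -> J -> R) (eps : R) (Delta : V -> R).
Hypothesis S_symm12 : forall v i j k, S v i j k = S v j i k.
Hypothesis S_symm23 : forall v i j k, S v i j k = S v i k j.
Hypothesis S_valid : forall v i j k, S v i j k != 0 -> valid i.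
Hypothesis S_trace : forall v k, \sum_i S v i i k = 0.
Hypothesis S_norm : forall v, \sum_i \sum_j \sum_k S v i j k ^+ 2 <= 1.
Hypothesis eps_ge0 : 0 <= eps.
Hypothesis S_gain : forall v (t : J -> R),
  \sum_j \sum_k (\sum_i t i * S v i j k) ^+ 2 <= eps * \sum_i t i ^+ 2.
Hypothesis S_cross : forall v u,
  6 * \sum_i \sum_j \sum_k S v i j k * S u i j k = (v == u)%:R * Delta v.

Definition cube v := \sum_i \sum_j \sum_k S v i j k *: (X i * (X j * X k)).
(** The derivative of the cubic form, and below its second derivative. *)
Definition quad v i := 3 *: (\sum_j \sum_k S v i j k *: (X j * X k)).
Definition lin v i j := 6 *: (\sum_k S v i j k *: X k).

Lemma S_symm13 v i j k : S v i j k = S v k j i.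
Proof. by rewrite S_symm12 S_symm23 S_symm12. Qed.

Lemma S_valid3 v i j k : S v i j k != 0 -> [/\ valid i, valid j & valid k].
Proof.
move=> h; split; first exact: S_valid h.
  by apply: (@S_valid v j i k); rewrite -S_symm12.
by apply: (@S_valid v k j i); rewrite -S_symm13.
Qed.

Lemma deriv_lin v i j k : D k (lin v i j) = (6 * S v i j k)%:A.
Proof.
rewrite /lin D_scale D_sum (sum_single (i := k)) => [|l /negPf lk].
  by rewrite D_scale D_X eqxx -scalerA.
by rewrite D_scale D_X lk scaler0.
Qed.

Lemma deriv_quad v i j : D j (quad v i) = lin v i j.
Proof.
rewrite /quad /lin D_scale (_ : 6 = 3 * 2 :> R); last by rewrite -natrM.
rewrite -scalerA; congr (_ *: _); rewrite D_sum.
transitivity (\sum_a \sum_b (S v i a b *: ((a == j)%:R * X b)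
                             + S v i a b *: (X a * (b == j)%:R))).
  apply: eq_bigr => a _; rewrite D_sum; apply: eq_bigr => b _.
  by rewrite D_scale D_mul !D_X scalerDr.
under eq_bigr do rewrite big_split /=.
rewrite big_split /= scaler_nat mulr2n; congr (_ + _).
  rewrite (sum_single (i := j)) => [|a /negPf aj].
    by apply: eq_bigr => b _; rewrite eqxx mul1r.
  by rewrite big1// => b _; rewrite aj mul0r scaler0.
apply: eq_bigr => a _; rewrite (sum_single (i := j)) => [|b /negPf bj].
  by rewrite eqxx mulr1 S_symm23.
by rewrite bj mulr0 scaler0.
Qed.

Lemma deriv_cube v i : D i (cube v) = quad v i.
Proof.
rewrite /quad /cube D_sum.
transitivity (\sum_a \sum_b \sum_c (S v a b c *: ((a == i)%:R * (X b * X c))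
                             + S v a b c *: ((b == i)%:R * (X a * X c))
                             + S v a b c *: ((c == i)%:R * (X a * X b)))).
  apply: eq_bigr => a _; rewrite D_sum; apply: eq_bigr => b _.
  rewrite D_sum; apply: eq_bigr => c _.
  rewrite D_scale !D_mul !D_X -!scalerDr; congr (_ *: _).
  by rewrite -addrA; congr (_ + _); rewrite mulrDr; congr (_ + _); ring.
under eq_bigr do under eq_bigr do rewrite !big_split /=.
under eq_bigr do rewrite !big_split /=.
rewrite !big_split /= scaler_nat !mulrS mulr0n addr0 addrA; congr (_ + _ + _).
- rewrite (sum_single (i := i)) => [|a /negPf ai].
    by apply: eq_bigr => b _; apply: eq_bigr => c _; rewrite eqxx mul1r.
  by rewrite big1// => b _; rewrite big1// => c _; rewrite ai mul0r scaler0.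
- apply: eq_bigr => a _; rewrite (sum_single (i := i)) => [|b /negPf bi].
    by apply: eq_bigr => c _; rewrite eqxx mul1r S_symm12.
  by rewrite big1// => c _; rewrite bi mul0r scaler0.
- apply: eq_bigr => a _; apply: eq_bigr => b _.
  rewrite (sum_single (i := i)) => [|c /negPf ci].
    by rewrite eqxx mul1r S_symm13 S_symm23.
  by rewrite ci mul0r scaler0.
Qed.

Lemma stein_lin v i j P : E (lin v i j * P) = 6 * \sum_k S v i j k * E (D k P).
Proof.
rewrite /lin -scalerAl E_scale stein_linear// => k.
by move=> /S_valid3[].
Qed.

Lemma trace23 v i : \sum_j S v i j j = 0.
Proof. by rewrite -[RHS](S_trace v i); apply: eq_bigr => j _; rewrite S_symm13. Qed.
Lemma trace13 v j : \sum_i S v i j i = 0.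
Proof. by rewrite -[RHS](S_trace v j); apply: eq_bigr => i _; rewrite S_symm23. Qed.

Lemma stein_quad v i P :
  E (quad v i * P) = 3 * \sum_j \sum_k S v i j k * E (D k (D j P)).
Proof.
rewrite /quad -scalerAl E_scale stein_quadratic ?trace23// => j k.
by move=> /S_valid3[].
Qed.

Lemma stein_cube v P :
  E (cube v * P) = \sum_i \sum_j \sum_k S v i j k * E (D k (D j (D i P))).
Proof.
rewrite /cube stein_cubic//; [exact: S_valid3|exact: trace13|exact: trace23].
Qed.

Lemma dsum1E (K : finType) (F : K -> A) :
  dsum 1 F = \sum_s \sum_k E (D k (F s)) ^+ 2.
Proof. by rewrite /= pair_bigA. Qed.
Lemma dsum2E (K : finType) (F : K -> A) :
  dsum 2 F = \sum_s \sum_j \sum_k E (D k (D j (F s))) ^+ 2.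
Proof.
rewrite pair_bigA -[LHS]/(dsum 1 (fun q : (K * J)%type => D q.2 (F q.1))).
by rewrite dsum1E.
Qed.
Lemma dsum3E (K : finType) (F : K -> A) :
  dsum 3 F = \sum_s \sum_i \sum_j \sum_k E (D k (D j (D i (F s)))) ^+ 2.
Proof.
rewrite pair_bigA -[LHS]/(dsum 2 (fun q : (K * J)%type => D q.2 (F q.1))).
by rewrite dsum2E.
Qed.
Lemma dsum4E (K : finType) (F : K -> A) :
  dsum 4 F = \sum_s \sum_l \sum_i \sum_j \sum_k
                E (D k (D j (D i (D l (F s))))) ^+ 2.
Proof.
rewrite pair_bigA -[LHS]/(dsum 3 (fun q : (K * J)%type => D q.2 (F q.1))).
by rewrite dsum3E.
Qed.

Lemma dsum_tensor n (K L : finType) (a : L -> R) (F : K -> A) :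
  dsum n (fun q : K * L => (a q.2)%:A * F q.1) = (\sum_l a l ^+ 2) * dsum n F.
Proof.
elim: n K F => [|n IH] K F.
  rewrite /= -(pair_bigA _ (fun s l => E ((a l)%:A * F s) ^+ 2)) mulr_sumr.
  apply: eq_bigr => s _; rewrite mulr_suml; apply: eq_bigr => l _.
  by rewrite mulr_algl E_scale exprMn.
rewrite /= -IH.
rewrite -[RHS](@dsum_reindex _ _ _
    (fun q : (K * L) * J => ((q.1.1, q.2), q.1.2))).
  by apply: eq_dsum => q /=; rewrite !mulr_algl D_scale.
by exists (fun q => ((q.1.1, q.2), q.1.2)) => [[[a0 b] d]|[[a0 b] d]].
Qed.

(** Bounds for the derivatives of a product, when the cubic form multiplied in
    has been differentiated three times, twice, once or not at all; c bounds the
    other factors.  The numbers 36 and 9 are the squares of the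
    coefficients 6 and 3 of the derivatives of a cubic form. *)
Definition const3 (c : nat -> R) n := 36 * c n.
Definition const2 c n := leib_const (fun c => 36 * c 1) const3 n c.
Definition const1 c n := leib_const (fun c => 9 * c 2) const2 n c.
Definition const0 c n := leib_const (fun c => c 3) const1 n c.

(** The third derivative of the cubic form is the constant tensor 6 S, which
    has squared norm at most 36; the three next statements climb back to the
    form itself by the rule of Leibniz. *)
Lemma dbounded_scalar v (K : finType) (F : K -> A) c : dbounded F c ->
  dbounded (fun q : K * (J * J * J) => (6 * S v q.2.1.1 q.2.1.2 q.2.2)%:A * F q.1)
       (const3 c).
Proof.
move=> bF n.
rewrite (@dsum_tensor n _ _ (fun q : J * J * J => 6 * S v q.1.1 q.1.2 q.2)).
apply: ler_pM => //; [exact: sumsq_ge0|exact: dsum_ge0|].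
under eq_bigr do rewrite exprMn.
rewrite -mulr_sumr -(pair_bigA _ (fun p k => S v p.1 p.2 k ^+ 2)) /=.
rewrite -(pair_bigA _ (fun i j => \sum_k S v i j k ^+ 2)) /=.
by have := S_norm v; lra.
Qed.

(** Without further derivative, integration by parts turns the linear form
    into a derivative of F contracted with S, and S has norm at most 1. *)
Lemma dbounded_lin v (K : finType) (F : K -> A) c : dbounded F c ->
  dbounded (fun q : K * (J * J) => lin v q.2.1 q.2.2 * F q.1) (const2 c).
Proof.
apply: (@dbounded_leibniz _ (fun q : J * J => lin v q.1 q.2)) => {}K {}F {}c bF.
  under eq_bigr do under eq_bigr do rewrite stein_lin exprMn.
  under eq_bigr do rewrite -mulr_sumr.
  rewrite -mulr_sumr; apply: ler_pM => //.
  - by rewrite sumr_ge0// => s _; exact: sumsq_ge0.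
  - by have -> : 6 ^+ 2 = 36 :> R by ring.
  apply: le_trans (contract_norm_le (fun p : J * J => S v p.1 p.2)
    (fun s k => E (D k (F s)))) _.
  rewrite -dsum1E -(pair_bigA _ (fun i j => \sum_k S v i j k ^+ 2)).
  by rewrite -[leRHS]mul1r ler_pM ?dsum_ge0//; do 2 (apply: sumr_ge0 => ? _); exact: sumsq_ge0.
move=> n; under eq_dsum do rewrite deriv_lin.
exact: (dbounded_scalar v bF).
Qed.

Lemma dbounded_quad v (K : finType) (F : K -> A) c : dbounded F c ->
  dbounded (fun q : K * J => quad v q.2 * F q.1) (const1 c).
Proof.
apply: (@dbounded_leibniz _ (quad v)) => {}K {}F {}c bF.
  under eq_bigr do under eq_bigr do rewrite stein_quad exprMn.
  under eq_bigr do rewrite -mulr_sumr.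
  rewrite -mulr_sumr; apply: ler_pM => //.
  - by rewrite sumr_ge0// => s _; exact: sumsq_ge0.
  - by have -> : 3 ^+ 2 = 9 :> R by ring.
  under eq_bigr do under eq_bigr do rewrite pair_bigA.
  apply: le_trans (contract_norm_le (fun i (p : J * J) => S v i p.1 p.2)
    (fun s (p : J * J) => E (D p.2 (D p.1 (F s))))) _.
  under eq_bigr do rewrite -(pair_bigA _ (fun j k => S v _ j k ^+ 2)) /=.
  under [X in _ * X]eq_bigr => s _ do
    rewrite -(pair_bigA _ (fun j k => E (D k (D j (F s))) ^+ 2)) /=.
  rewrite -dsum2E.
  by rewrite -[leRHS]mul1r ler_pM ?dsum_ge0//; do 2 (apply: sumr_ge0 => ? _); exact: sumsq_ge0.
move=> n; under eq_dsum do rewrite deriv_quad.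
exact: (dbounded_lin v bF).
Qed.

Lemma dbounded_cube v (K : finType) (F : K -> A) c : dbounded F c ->
  dbounded (fun s : K => cube v * F s) (const0 c).
Proof.
move=> bF n.
rewrite -(@dsum_reindex _ _ _ (fun q : K * unit => q.1)); last first.
  by exists (fun s => (s, tt)) => // -[a []].
move: bF n; apply: (@dbounded_leibniz _ (fun _ : unit => cube v)) => {}K {}F {}c bF.
  under eq_bigr do rewrite sum_unit stein_cube.
  have := bF 3; rewrite dsum3E; apply: le_trans.
  apply: ler_sum => s _; apply: le_trans (cauchy_schwarz_sum3 _ _) _.
  rewrite -[leRHS]mul1r; apply: ler_pM; [| |exact: S_norm|exact: lexx].
    by do 2 (apply: sumr_ge0 => ? _); exact: sumsq_ge0.
  by do 2 (apply: sumr_ge0 => ? _); exact: sumsq_ge0.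
move=> n; under eq_dsum do rewrite deriv_cube.
rewrite -(@dsum_reindex _ _ _ (fun q : K * J => (q.1, (tt, q.2)))).
  exact: (dbounded_quad v bF).
by exists (fun q => (q.1, q.2.2)) => [[]//|[a [[] b]]].
Qed.

Fixpoint const_prod m : nat -> R :=
  if m is m'.+1 then const0 (const_prod m') else fun _ => 1.

Definition cube_prod (N : seq V) : A := \prod_(u <- N) cube u.

(** The bounds depend on the number of factors only, not on the tensors. *)
Lemma dbounded_cube_prod (N : seq V) : dbounded (fun _ : unit => cube_prod N) (const_prod (size N)).
Proof.
elim: N => [|v N IH] n; rewrite /cube_prod.
  by under eq_dsum do rewrite big_nil; exact: dbounded_one.
by under eq_dsum do rewrite big_cons; exact: (dbounded_cube v IH).
Qed.

(** Contraction along two legs is the adjoint of contraction along one leg, so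
    it has the same operator norm. *)
Lemma S_gain2 v (t : J -> J -> R) :
  \sum_k (\sum_i \sum_j t i j * S v i j k) ^+ 2
    <= eps * \sum_i \sum_j t i j ^+ 2.
Proof.
set w := fun k => \sum_i \sum_j t i j * S v i j k.
rewrite -/(\sum_k w k ^+ 2); set W := \sum_k w k ^+ 2.
set n2 := \sum_i \sum_j t i j ^+ 2.
have WE : W = \sum_i \sum_j t i j * (\sum_k w k * S v k i j).
  transitivity (\sum_k \sum_i \sum_j t i j * (w k * S v k i j)).
    apply: eq_bigr => k _; rewrite expr2 {2}/w mulr_sumr; apply: eq_bigr => i _.
    rewrite mulr_sumr; apply: eq_bigr => j _.
    by rewrite mulrCA (S_symm13 v k) (S_symm12 v j).
  rewrite exchange_big; apply: eq_bigr => i _.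
  rewrite exchange_big; apply: eq_bigr => j _.
  by rewrite mulr_sumr.
have W0 : 0 <= W by exact: sumsq_ge0.
have n0 : 0 <= n2 by apply: sumr_ge0 => i _; exact: sumsq_ge0.
(* Duality: W = <t, S^* w> with |S^* w|^2 <= eps |w|^2 = eps W. *)
have W2 : W ^+ 2 <= n2 * (eps * W).
  rewrite {1}WE; apply: le_trans (cauchy_schwarz_sum2 _ _) _.
  by apply: ler_wpM2l => //; exact: S_gain.
have [->|Wn0] := eqVneq W 0; first by rewrite mulr_ge0.
have {}W0 : 0 < W by rewrite lt_def Wn0.
by rewrite -(ler_pM2r W0) -expr2 (le_trans W2)//; lra.
Qed.

Definition remainder21_const m : R :=
  36 * (const_prod m 1 + 1) + 18 * (const_prod m 3 + 1).

Lemma const_prod_ge0 (N : seq V) n : 0 <= const_prod (size N) n.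
Proof. exact: le_trans (dsum_ge0 _ _) (dbounded_cube_prod N n). Qed.

(** The node v is joined by two edges to u and by one edge to u'. Contracting
    S_v with S_u along two legs gives the matrix T of squared norm at most eps.
    The remaining leg of u acts either on u', which absorbs both indices of T,
    or on the other factors, and then T meets u' along one leg. *)
Lemma remainder21 v u u' N :
  `|\sum_i \sum_j \sum_k S v i j k * E (lin u i j * (quad u' k * cube_prod N))|
    <= remainder21_const (size N) * eps.
Proof.
set P := cube_prod N.
(* T is S_v S_u contracted along two legs; U and U' are T contracted with S_u'. *)
pose T k l := \sum_i \sum_j S v i j k * S u i j l.
have T_le : \sum_k \sum_l T k l ^+ 2 <= eps.
  apply: (@le_trans _ _ (\sum_k eps * \sum_i \sum_j S v i j k ^+ 2)).
    by apply: ler_sum => k _; exact: S_gain2.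
  rewrite -mulr_sumr -[leRHS]mulr1; apply: ler_wpM2l => //.
  apply: le_trans (S_norm v); rewrite exchange_big.
  by under eq_bigr do rewrite exchange_big.
pose U z := \sum_k \sum_l T k l * S u' k l z.
pose U' l y z := \sum_k T k l * S u' k y z.
have U_le : \sum_z U z ^+ 2 <= eps ^+ 2.
  by apply: le_trans (S_gain2 _ _) _; rewrite expr2; apply: ler_wpM2l.
have U'_le : \sum_l \sum_y \sum_z U' l y z ^+ 2 <= eps ^+ 2.
  apply: (@le_trans _ _ (\sum_l eps * \sum_k T k l ^+ 2)).
    by apply: ler_sum => l _; exact: S_gain.
  by rewrite -mulr_sumr expr2 exchange_big; apply: ler_wpM2l.
have -> : \sum_i \sum_j \sum_k S v i j k * E (lin u i j * (quad u' k * P))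
  = 36 * (\sum_z U z * E (D z P))
    + 18 * (\sum_l \sum_y \sum_z U' l y z * E (D z (D y (D l P)))).
  transitivity (6 * \sum_k \sum_l T k l * E (D l (quad u' k * P))).
    rewrite /T; under [in RHS]eq_bigr do under eq_bigr do rewrite pair_bigA /=.
    rewrite -(contract_sum (fun k p => S v p.1 p.2 k) (fun p l => S u p.1 p.2 l)
      (fun k l => E (D l (quad u' k * P)))).
    rewrite pair_bigA exchange_big; apply: eq_bigr => k _; apply: eq_bigr => p _.
    by rewrite stein_lin.
  transitivity (6 * ((6 * \sum_z U z * E (D z P))
    + (3 * \sum_l \sum_y \sum_z U' l y z * E (D z (D y (D l P)))))); last by ring.
  congr (_ * _).
  under eq_bigr do under eq_bigr do rewrite D_mul deriv_quad E_add stein_lin stein_quad mulrDr.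
  under eq_bigr do rewrite big_split /=.
  rewrite big_split; congr (_ + _).
    have := @contract_sum _ unit (J * J)%type J (fun _ p => T p.1 p.2)
      (fun p z => S u' p.1 p.2 z) (fun _ z => E (D z P)) 6.
    rewrite !sum_unit pair_bigA => /= ->; congr (_ * _).
    by apply: eq_bigr => z _; rewrite /U pair_bigA.
  under eq_bigr do under eq_bigr do rewrite pair_bigA /=.
  rewrite exchange_big /=.
  rewrite (contract_sum (fun l k => T k l) (fun k (p : J * J) => S u' k p.1 p.2)
     (fun l p => E (D p.2 (D p.1 (D l P))))).
  by congr (_ * _); apply: eq_bigr => l _; rewrite pair_bigA.
have b1 : `|\sum_z U z * E (D z P)| <= (const_prod (size N) 1 + 1) * eps.
  apply: norm_le_of_sqr => //; first exact: const_prod_ge0.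
  apply: le_trans (cauchy_schwarz_sum _ _) _.
  apply: ler_pM => //; [exact: sumsq_ge0|exact: sumsq_ge0|].
  by have := dbounded_cube_prod N 1; rewrite dsum1E sum_unit.
have b3 : `|\sum_l \sum_y \sum_z U' l y z * E (D z (D y (D l P)))|
    <= (const_prod (size N) 3 + 1) * eps.
  apply: norm_le_of_sqr => //; first exact: const_prod_ge0.
  apply: le_trans (cauchy_schwarz_sum3 _ _) _.
  apply: ler_pM => //; try by do 2 (apply: sumr_ge0 => ? _); exact: sumsq_ge0.
  by have := dbounded_cube_prod N 3; rewrite dsum3E sum_unit.
apply: le_trans (ler_normD _ _) _; rewrite !normrM !normr_nat.
rewrite /remainder21_const [leRHS]mulrDl -2![in leRHS]mulrA.
by apply: lerD; apply: ler_wpM2l.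
Qed.

Definition remainder111_const m : R :=
  54 * (const_prod m 2 + 1) + 36 * (const1 (const_prod m) 2 + 1)
  + 9 * (const1 (const_prod m) 4 + 1).

Lemma dbounded_quad_cube_prod v (N : seq V) :
  dbounded (fun k : J => quad v k * cube_prod N) (const1 (const_prod (size N))).
Proof.
move=> n; rewrite -(@dsum_reindex _ _ _ (fun q : unit * J => q.2)).
  exact: (dbounded_quad v (dbounded_cube_prod N)).
by exists (fun k => (tt, k)) => // -[[] a].
Qed.

(** The node v is joined by one edge to each of u, u' and u''. Contracting
    S_v with S_u along one leg gives a tensor T of squared norm at most eps.
    The two other legs of u act on u' and on the rest F; according to the
    number of them that meet u', the tensor T is contracted with S_u' along
    three legs (and then with S_u'' along one), along two, or along one. *)
Lemma remainder111 v u u' u'' N :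
  `|\sum_i \sum_j \sum_k S v i j k
       * E (quad u i * (quad u' j * (quad u'' k * cube_prod N)))|
    <= remainder111_const (size N) * eps.
Proof.
set P := cube_prod N; pose F k := quad u'' k * P.
rewrite -/(\sum_i \sum_j \sum_k S v i j k * E (quad u i * (quad u' j * F k))).
have bF : dbounded F (const1 (const_prod (size N))) by exact: dbounded_quad_cube_prod.
have c1_ge0 n : 0 <= const1 (const_prod (size N)) n.
  exact: le_trans (dsum_ge0 _ _) (bF n).
pose T k j l p := \sum_i S v i j k * S u i l p.
have T_sym k j l p : T k j l p = T k j p l.
  by apply: eq_bigr => i _; rewrite (S_symm23 u).
have T_le : \sum_k \sum_j \sum_l \sum_p T k j l p ^+ 2 <= eps.
  apply: (@le_trans _ _ (\sum_k \sum_j eps * \sum_i S v i j k ^+ 2)).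
    by apply: ler_sum => k _; apply: ler_sum => j _; exact: S_gain.
  under eq_bigr do rewrite -mulr_sumr.
  rewrite -mulr_sumr -[leRHS]mulr1; apply: ler_wpM2l => //.
  apply: le_trans (S_norm v); apply: ler_sum => k _; apply: ler_sum => j _.
  by under eq_bigr do rewrite S_symm13.
pose t k := \sum_j \sum_l \sum_p T k j l p * S u' j l p.
pose t' y z := \sum_k t k * S u'' k y z.
pose T2 k p q := \sum_j \sum_l T k j l p * S u' j l q.
pose T3 k l p y z := \sum_j T k j l p * S u' j y z.
have t_le : \sum_k t k ^+ 2 <= eps.
  apply: le_trans T_le; apply: ler_sum => k _.
  apply: le_trans (cauchy_schwarz_sum3 _ _) _; rewrite -[leRHS]mulr1.
  apply: ler_wpM2l => //.
  by do 2 (apply: sumr_ge0 => ? _); exact: sumsq_ge0.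
have t'_le : \sum_y \sum_z t' y z ^+ 2 <= eps ^+ 2.
  by apply: le_trans (S_gain _ _) _; rewrite expr2; apply: ler_wpM2l.
have T2_le : \sum_k \sum_p \sum_q T2 k p q ^+ 2 <= eps ^+ 2.
  apply: (@le_trans _ _ (\sum_k \sum_p eps * \sum_j \sum_l T k j l p ^+ 2)).
    by apply: ler_sum => k _; apply: ler_sum => p _; exact: S_gain2.
  under eq_bigr do rewrite -mulr_sumr.
  rewrite -mulr_sumr expr2; apply: ler_wpM2l => //.
  apply: le_trans T_le; apply: ler_sum => k _; rewrite exchange_big /=.
  by apply: ler_sum => j _; rewrite exchange_big.
have T3_le : \sum_k \sum_l \sum_p \sum_y \sum_z T3 k l p y z ^+ 2 <= eps ^+ 2.
  apply: (@le_trans _ _ (\sum_k \sum_l \sum_p eps * \sum_j T k j l p ^+ 2)).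
    do 3 (apply: ler_sum => ? _); exact: S_gain.
  under eq_bigr do under eq_bigr do rewrite -mulr_sumr.
  under eq_bigr do rewrite -mulr_sumr.
  rewrite -mulr_sumr expr2; apply: ler_wpM2l => //.
  apply: le_trans T_le; apply: ler_sum => k _.
  under eq_bigr do rewrite exchange_big /=.
  by rewrite exchange_big.
have -> : \sum_i \sum_j \sum_k S v i j k * E (quad u i * (quad u' j * F k))
  = 54 * (\sum_y \sum_z t' y z * E (D z (D y P)))
    + 36 * (\sum_k \sum_p \sum_q T2 k p q * E (D q (D p (F k))))
    + 9 * (\sum_k \sum_l \sum_p \sum_y \sum_z
             T3 k l p y z * E (D z (D y (D p (D l (F k)))))).
  transitivity (3 * \sum_k \sum_j \sum_l \sum_p
      T k j l p * E (D p (D l (quad u' j * F k)))).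
    rewrite exchange_sum3 mulr_sumr; apply: eq_bigr => k _.
    rewrite mulr_sumr; apply: eq_bigr => j _.
    by under eq_bigr do rewrite stein_quad; exact: contract_sum12.
  transitivity (3 * (18 * (\sum_y \sum_z t' y z * E (D z (D y P)))
    + 6 * (\sum_k \sum_p \sum_q T2 k p q * E (D q (D p (F k))))
    + 6 * (\sum_k \sum_p \sum_q T2 k p q * E (D q (D p (F k))))
    + 3 * (\sum_k \sum_l \sum_p \sum_y \sum_z
         T3 k l p y z * E (D z (D y (D p (D l (F k)))))))); last by ring.
  congr (_ * _).
  have t'E : 18 * (\sum_y \sum_z t' y z * E (D z (D y P)))
      = \sum_k \sum_j \sum_l \sum_p T k j l p * (6 * S u' j l p * E (F k)).
    transitivity (6 * \sum_k t k * (3 * \sum_y \sum_z S u'' k y z * E (D z (D y P)))).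
      by rewrite contract_sum12 mulrA; congr (_ * _); ring.
    rewrite mulr_sumr; apply: eq_bigr => k _; rewrite -stein_quad mulrA [6 * _]mulrC.
    rewrite /t -mulrA mulr_suml; apply: eq_bigr => j _.
    rewrite mulr_suml; apply: eq_bigr => l _.
    by rewrite mulr_suml; apply: eq_bigr => p _; ring.
  have T2E : 6 * (\sum_k \sum_p \sum_q T2 k p q * E (D q (D p (F k))))
      = \sum_k \sum_j \sum_l \sum_p T k j l p * E (lin u' j l * D p (F k)).
    rewrite mulr_sumr; apply: eq_bigr => k _.
    rewrite [RHS]exchange_sum3 mulr_sumr; apply: eq_bigr => p _.
    rewrite [RHS]exchange_big -contract_sum21.
    by apply: eq_bigr => j _; apply: eq_bigr => l _; rewrite stein_lin.
  rewrite t'E T2E.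
  have -> : 3 * (\sum_k \sum_l \sum_p \sum_y \sum_z
         T3 k l p y z * E (D z (D y (D p (D l (F k))))))
     = \sum_k \sum_j \sum_l \sum_p T k j l p * E (quad u' j * D p (D l (F k))).
    rewrite mulr_sumr; apply: eq_bigr => k _; rewrite [RHS]exchange_big mulr_sumr.
    apply: eq_bigr => l _; rewrite [RHS]exchange_big mulr_sumr.
    apply: eq_bigr => p _; rewrite -contract_sum12.
    by apply: eq_bigr => j _; rewrite stein_quad.
  rewrite -!big_split; apply: eq_bigr => k _; rewrite -!big_split.
  apply: eq_bigr => j _ /=.
  have T_swap : \sum_l \sum_p T k j l p * E (lin u' j l * D p (F k))
      = \sum_l \sum_p T k j l p * E (lin u' j p * D l (F k)) :> R.
    by rewrite exchange_big; apply: eq_bigr => l _; apply: eq_bigr => p _; rewrite T_sym.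
  rewrite [X in _ = _ + X + _ + _]T_swap.
  rewrite -!big_split; apply: eq_bigr => l _; rewrite -!big_split.
  apply: eq_bigr => p _ /=; rewrite -!mulrDr; congr (_ * _).
  move: (F k) => G.
  by rewrite D_mul deriv_quad D_add !D_mul deriv_lin deriv_quad !E_add mulr_algl E_scale !addrA [_ + _ + E (lin u' j p * _)]addrAC.
have b1 : `|\sum_y \sum_z t' y z * E (D z (D y P))|
    <= (const_prod (size N) 2 + 1) * eps.
  apply: norm_le_of_sqr => //; first exact: const_prod_ge0.
  apply: le_trans (cauchy_schwarz_sum2 _ _) _.
  apply: ler_pM => //; try by apply: sumr_ge0 => ? _; exact: sumsq_ge0.
  by have := dbounded_cube_prod N 2; rewrite dsum2E sum_unit.
have b2 : `|\sum_k \sum_p \sum_q T2 k p q * E (D q (D p (F k)))|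
    <= (const1 (const_prod (size N)) 2 + 1) * eps.
  apply: norm_le_of_sqr => //.
  apply: le_trans (cauchy_schwarz_sum3 _ _) _.
  apply: ler_pM => //; try by do 2 (apply: sumr_ge0 => ? _); exact: sumsq_ge0.
  by have := bF 2; rewrite dsum2E.
have b3 : `|\sum_k \sum_l \sum_p \sum_y \sum_z
      T3 k l p y z * E (D z (D y (D p (D l (F k)))))|
    <= (const1 (const_prod (size N)) 4 + 1) * eps.
  apply: norm_le_of_sqr => //.
  apply: le_trans (cauchy_schwarz_sum5 _ _) _.
  apply: ler_pM => //; try by do 4 (apply: sumr_ge0 => ? _); exact: sumsq_ge0.
  by have := bF 4; rewrite dsum4E.
apply: le_trans (ler_normD _ _) _; rewrite [leRHS]mulrDl; apply: lerD.
  apply: le_trans (ler_normD _ _) _; rewrite [leRHS]mulrDl.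
  by rewrite !normrM !normr_nat -2![in leRHS]mulrA; apply: lerD; apply: ler_wpM2l.
by rewrite normrM normr_nat -mulrA; apply: ler_wpM2l.
Qed.

(** The ways of extracting one factor from a product, as needed by Leibniz'
    rule; N is a list because the factors may be repeated. *)
Fixpoint select (N : seq V) : seq (V * seq V) :=
  if N is u :: N' then (u, N') :: [seq (q.1, u :: q.2) | q <- select N'] else [::].

Lemma select_size N q : q \in select N -> size N = (size q.2).+1.
Proof.
elim: N q => //= u N IH q; rewrite inE => /orP[/eqP -> //|/mapP[q' q'N ->]] /=.
by rewrite (IH _ q'N).
Qed.

Lemma size_select N : size (select N) = size N.
Proof. by elim: N => //= u N IH; rewrite size_map IH. Qed.

Lemma deriv_cube_prod i N :
  D i (cube_prod N) = \sum_(q <- select N) quad q.1 i * cube_prod q.2.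
Proof.
elim: N => [|u N IH]; first by rewrite /cube_prod !big_nil D_1.
rewrite {1}/cube_prod big_cons D_mul -/(cube_prod N) IH deriv_cube /= big_cons big_map /=.
congr (_ + _); rewrite mulr_sumr; apply: eq_bigr => q _.
by rewrite /cube_prod big_cons mulrCA.
Qed.

(** The moments of the centred normal law of variance d. *)
Fixpoint gaussian_moment (d : R) n : R :=
  match n with
  | 0 => 1
  | 1 => 0
  | n'.+2 => n'.+1%:R * d * gaussian_moment d n'
  end.

Definition limit_moment (N : seq V) : R :=
  \prod_u gaussian_moment (Delta u) (count_mem u N).

Lemma select_perm N q : q \in select N -> perm_eq N (q.1 :: q.2).
Proof.
elim: N q => //= u N IH q; rewrite inE => /orP[/eqP -> //|/mapP[q' q'N ->]] /=.
apply: (@perm_trans _ (u :: q'.1 :: q'.2)); first by rewrite perm_cons IH.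
by rewrite -[u :: _]/([:: u] ++ [:: q'.1] ++ q'.2) perm_catCA.
Qed.

Lemma map_fst_select N : [seq q.1 | q <- select N] = N.
Proof. by elim: N => //= u N IH; rewrite -map_comp /= IH. Qed.

(** The recurrence satisfied by moments of independent centred normal
    variables: a variable v is paired with one of its copies in N. *)
Lemma limit_moment_cons v N :
  limit_moment (v :: N)
    = \sum_(q <- select N) (v == q.1)%:R * Delta v * limit_moment q.2.
Proof.
set rest := \prod_(u | u != v) gaussian_moment (Delta u) (count_mem u N).
transitivity (\sum_(q <- select N) (v == q.1)%:R * Delta v *
   (gaussian_moment (Delta v) (count_mem v N).-1 * rest)); last first.
  rewrite big_seq [RHS]big_seq; apply: eq_bigr => q /select_perm/permP qN.
  have [vq|_] := eqVneq v q.1; last by rewrite !mul0r.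
  congr (_ * _); rewrite /limit_moment (bigD1 v)//=; congr (_ * _).
    by rewrite qN /= vq eqxx.
  by apply: eq_bigr => u /negPf uv; rewrite qN /= -vq eq_sym uv.
have -> : \sum_(q <- select N) (v == q.1)%:R * Delta v *
   (gaussian_moment (Delta v) (count_mem v N).-1 * rest)
   = (count_mem v N)%:R * Delta v * (gaussian_moment (Delta v) (count_mem v N).-1 * rest).
  rewrite -!mulr_suml; do 2 congr (_ * _).
  rewrite -[in RHS](map_fst_select N) -sum1_count natr_sum big_map [RHS]big_mkcond /=.
  by apply: eq_bigr => q _; rewrite eq_sym; case: eqP.
rewrite /limit_moment (bigD1 v)//= eqxx add1n.
have -> : \prod_(u | u != v) gaussian_moment (Delta u) ((v == u) + count_mem u N) = rest.
  by apply: eq_bigr => u /negPf uv; rewrite eq_sym uv.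
by case: (count_mem v N) => [|n] /=; rewrite ?mul0r// mulrA.
Qed.

Definition rem21 v u u' N :=
  \sum_i \sum_j \sum_k S v i j k * E (lin u i j * (quad u' k * cube_prod N)).
Definition rem111 v u u' u'' N :=
  \sum_i \sum_j \sum_k S v i j k
     * E (quad u i * (quad u' j * (quad u'' k * cube_prod N))).

(** Integration by parts against the cubic form v, sorted by the number of
    distinct factors that receive its three derivatives: one, two or three. *)
Lemma wick_expansion v N :
  E (cube_prod (v :: N)) =
    \sum_(q <- select N) (v == q.1)%:R * Delta v * E (cube_prod q.2)
    + \sum_(q <- select N) \sum_(q' <- select q.2)
        (2 * rem21 v q.1 q'.1 q'.2 + rem21 v q'.1 q.1 q'.2)
    + \sum_(q <- select N) \sum_(q' <- select q.2) \sum_(q'' <- select q'.2)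
        rem111 v q.1 q'.1 q''.1 q''.2.
Proof.
rewrite {1}/cube_prod big_cons -/(cube_prod N) stein_cube -!big_split /=.
(* One factor absorbs all the derivatives, two factors share them in three ways, or three factors take one each. *)
have D3 i j k : E (D k (D j (D i (cube_prod N)))) = \sum_(q <- select N)
   (6 * S q.1 i j k * E (cube_prod q.2) + \sum_(q' <- select q.2)
     (E (lin q.1 i j * (quad q'.1 k * cube_prod q'.2))
      + E (lin q.1 i k * (quad q'.1 j * cube_prod q'.2))
      + E (lin q'.1 j k * (quad q.1 i * cube_prod q'.2))
      + \sum_(q'' <- select q'.2)
         E (quad q.1 i * (quad q'.1 j * (quad q''.1 k * cube_prod q''.2))))).
  rewrite deriv_cube_prod !D_sum E_sum; apply: eq_bigr => q _.
  rewrite D_mul deriv_quad deriv_cube_prod D_add !D_mul deriv_lin deriv_quad deriv_cube_prod D_sum !E_add.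
  rewrite mulr_algl E_scale -addrA; congr (_ + _).
  rewrite !mulr_sumr !E_sum -!big_split /=; apply: eq_bigr => q' _.
  rewrite D_mul deriv_quad deriv_cube_prod mulrDr E_add !mulr_sumr E_sum !addrA.
  congr (_ + _ + _).
  by rewrite mulrCA.
under eq_bigr do under eq_bigr do under eq_bigr do rewrite D3 mulr_sumr.
under eq_bigr do under eq_bigr do rewrite exchange_big /=.
under eq_bigr do rewrite exchange_big /=.
rewrite exchange_big /=; apply: eq_bigr => q _.
rewrite -addrA; under eq_bigr do under eq_bigr do under eq_bigr do rewrite mulrDr.
under eq_bigr do under eq_bigr do rewrite big_split /=.
under eq_bigr do rewrite big_split /=.
rewrite big_split /=; congr (_ + _).
  rewrite -S_cross mulr_sumr mulr_suml; apply: eq_bigr => i _.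
  rewrite mulr_sumr mulr_suml; apply: eq_bigr => j _.
  by rewrite mulr_sumr mulr_suml; apply: eq_bigr => k _; ring.
under eq_bigr do under eq_bigr do under eq_bigr do rewrite mulr_sumr.
under eq_bigr do under eq_bigr do rewrite exchange_big /=.
under eq_bigr do rewrite exchange_big /=.
rewrite exchange_big -big_split /=; apply: eq_bigr => q' _.
(* By symmetry of S v, two of the three ways of sharing give the same sum. *)
have swap1 : rem21 v q.1 q'.1 q'.2 = \sum_i \sum_j \sum_k
    S v i j k * E (lin q.1 i k * (quad q'.1 j * cube_prod q'.2)).
  apply: eq_bigr => i _; rewrite exchange_big; apply: eq_bigr => j _.
  by apply: eq_bigr => k _; rewrite S_symm23.
have swap2 : rem21 v q'.1 q.1 q'.2 = \sum_i \sum_j \sum_k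
    S v i j k * E (lin q'.1 j k * (quad q.1 i * cube_prod q'.2)).
  rewrite /rem21; under eq_bigr do rewrite exchange_big.
  rewrite exchange_big; apply: eq_bigr => k _; apply: eq_bigr => i _.
  by apply: eq_bigr => j _; rewrite S_symm13 S_symm23.
have -> : \sum_(q'' <- select q'.2) rem111 v q.1 q'.1 q''.1 q''.2
  = \sum_i \sum_j \sum_k S v i j k * \sum_(q'' <- select q'.2)
      E (quad q.1 i * (quad q'.1 j * (quad q''.1 k * cube_prod q''.2))).
  rewrite exchange_big; apply: eq_bigr => i _.
  rewrite exchange_big; apply: eq_bigr => j _.
  by rewrite exchange_big; apply: eq_bigr => k _; rewrite mulr_sumr.
rewrite (mulr_natl _ 2) mulr2n {2}swap1 swap2 /rem21.
rewrite -!big_split; apply: eq_bigr => i _; rewrite -!big_split.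
apply: eq_bigr => j _; rewrite -!big_split; apply: eq_bigr => k _ /=.
by rewrite -!mulrDr.
Qed.

Hypothesis Delta_le6 : forall v, 0 <= Delta v <= 6.

(** The recurrence of the Wick expansion, read off for a product of n forms. *)
Fixpoint chaos_const n : R :=
  if n is n'.+1 then
    if n' is m.+1 then
      n'%:R * (6 * chaos_const m) + n'%:R * (m%:R * (3 * remainder21_const m.-1))
      + n'%:R * (m%:R * (m.-1%:R * remainder111_const m.-2))
    else 0
  else 0.

Lemma norm_sum_select_le N (f : V * seq V -> R) b :
  (forall q, q \in select N -> `|f q| <= b) ->
  `|\sum_(q <- select N) f q| <= (size N)%:R * b.
Proof.
move=> fb; apply: le_trans (ler_norm_sum _ _ _) _.
rewrite big_seq; apply: (@le_trans _ _ (\sum_(q <- select N | q \in select N) b)).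
  exact: ler_sum.
by rewrite -big_seq big_const_seq count_predT size_select iter_addr_0 mulr_natl.
Qed.

(** Induction on the number of factors: the terms in which one factor absorbs
    all the derivatives of v reproduce the recurrence of the limit, and the
    others are of order eps. *)
Theorem chaos_product_bound (N : seq V) :
  `|E (cube_prod N) - limit_moment N| <= chaos_const (size N) * eps.
Proof.
have [n] := ubnP (size N); elim: n N => // n IH [|v N] sN.
  by rewrite /cube_prod big_nil E_1 /limit_moment big1 ?subrr ?normr0 ?mul0r.
rewrite wick_expansion limit_moment_cons.
case: N sN => [|u N] sN; first by rewrite !big_nil !addr0 subrr normr0 mul0r.
set NN := u :: N.
set B1 := \sum_(q <- _) _; set C1 := \sum_(q <- _) _; set A1 := \sum_(q <- _) _.
set L1 := \sum_(q <- _) _.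
have A1_le : `|A1 - L1| <= (size NN)%:R * (6 * chaos_const (size N) * eps).
  rewrite /A1 /L1 -sumrB; apply: norm_sum_select_le => q qN.
  have /= [sq] := select_size qN.
  rewrite /= -mulrBr normrM -mulrA sq; apply: ler_pM => //.
    have /andP[d0 d6] := Delta_le6 v.
    by case: eqP => _; rewrite ?mul1r ?mul0r ?normr0// ger0_norm.
  by apply: IH; rewrite -sq; exact: ltnW.
have B1_le : `|B1| <= (size NN)%:R * ((size N)%:R * (3 * remainder21_const (size N).-1 * eps)).
  apply: norm_sum_select_le => q qN; have /= [sq] := select_size qN.
  rewrite sq; apply: norm_sum_select_le => q' q'N; have /= sq' := select_size q'N.
  rewrite sq' /=; apply: le_trans (ler_normD _ _) _; rewrite normrM normr_nat.
  have := remainder21 v q.1 q'.1 q'.2; have := remainder21 v q'.1 q.1 q'.2.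
  by rewrite -/(rem21 _ _ _ _) -/(rem21 _ _ _ _); lra.
have C1_le : `|C1| <= (size NN)%:R * ((size N)%:R * ((size N).-1%:R
    * (remainder111_const (size N).-2 * eps))).
  apply: norm_sum_select_le => q qN; have /= [sq] := select_size qN.
  rewrite sq; apply: norm_sum_select_le => q' q'N; have /= sq' := select_size q'N.
  rewrite sq' /=; apply: norm_sum_select_le => q'' q''N.
  by have /= -> := select_size q''N; exact: remainder111.
have -> : A1 + B1 + C1 - L1 = (A1 - L1) + B1 + C1 by ring.
apply: le_trans (ler_normD _ _) _.
apply: le_trans (lerD (ler_normD _ _) (lexx _)) _.
apply: le_trans (lerD (lerD A1_le B1_le) C1_le) _.
by rewrite le_eqVlt; apply/orP; left; apply/eqP; rewrite /=; ring.
Qed.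
End Chaos.

(** * Racah sums and the ladder relations of the 3j symbols *)

Section Racah.
Variable R : realType.

(** The convention 1 / z! = 0 for negative z removes the bounds of summation
    from Racah's formula. *)
Definition inv_fact (z : int) : R := if 0 <= z then (zfact z)%:R^-1 else 0.

Lemma inv_fact_neg z : z < 0 -> inv_fact z = 0.
Proof. by rewrite /inv_fact leNgt => ->. Qed.

(** Since 1 / z! vanishes at negative integers, the recurrence of the factorial
    holds for all integers, without boundary cases. *)
Lemma mul_inv_fact z : z%:~R * inv_fact z = inv_fact (z - 1).
Proof.
case: z => [[|n]|n].
- by rewrite mul0r inv_fact_neg.
- rewrite /inv_fact (_ : n.+1%:Z - 1 = n%:Z) /=; last by lia.
  rewrite /zfact /= factS natrM invfM mulrA mulfV ?mul1r//.
  by rewrite pnatr_eq0.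
- by rewrite !inv_fact_neg ?mulr0//; lia.
Qed.

(** The sum in the definition of the 3j symbol, for a = l1 + l2 - l3,
    b = l1 - m1, c = l2 + m2, d = l3 - l2 + m1 and e = l3 - l1 - m2. *)
Definition racah_sum (T : nat) (a b c d e : int) : R :=
  \sum_(t < T) (-1) ^+ t * inv_fact t%:Z * inv_fact (a - t%:Z)
    * inv_fact (b - t%:Z) * inv_fact (c - t%:Z)
    * inv_fact (d + t%:Z) * inv_fact (e + t%:Z).

(** The raising relation for the 3j symbols, once square roots are removed.
    The difference of both sides telescopes: its term of index t is
    (-1)^t (A t + A (t - 1)). *)
Lemma racah_sum_ladder (T : nat) (a b c d e : int) : a < T%:Z ->
  (a + d + 1)%:~R * racah_sum T a (b - 1) c (d + 1) e
  + (c + 1)%:~R * racah_sum T a b (c + 1) d (e - 1)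
  = (b + e)%:~R * racah_sum T a b c d e.
Proof.
move=> aT.
pose A (t : int) : R := inv_fact t * inv_fact (a - t - 1)
  * inv_fact (b - t - 1) * inv_fact (c - t) * inv_fact (d + 1 + t) * inv_fact (e + t).
have tele n : \sum_(t < n) ((-1) ^+ t * (A t%:Z + A (t%:Z - 1)))
    = - (-1) ^+ n * A (n%:Z - 1).
  elim: n => [|n IH]; first by rewrite big_ord0 /A inv_fact_neg ?mul0r ?mulr0.
  rewrite big_ord_recr /= IH exprS (_ : n.+1%:Z - 1 = n%:Z); last by lia.
  ring.
apply/eqP; rewrite -subr_eq0; apply/eqP.
transitivity (\sum_(t < T) ((-1) ^+ t * (A t%:Z + A (t%:Z - 1)) *+ 1)); last first.
  under eq_bigr do rewrite mulr1n; rewrite tele /A.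
  by rewrite (@inv_fact_neg (a - (T%:Z - 1) - 1)) ?mulr0 ?mul0r ?mulr0//; lia.
rewrite /racah_sum !mulr_sumr -big_split -sumrB; apply: eq_bigr => t _ /=.
rewrite mulr1n /A.
have -> : b - 1 - t%:Z = b - t%:Z - 1 by lia.
have -> : d + t%:Z = d + 1 + t%:Z - 1 by lia.
have -> : c + 1 - t%:Z = c - t%:Z + 1 by lia.
have -> : e - 1 + t%:Z = e + t%:Z - 1 by lia.
have -> : a - (t%:Z - 1) - 1 = a - t%:Z by lia.
have -> : b - (t%:Z - 1) - 1 = b - t%:Z by lia.
have -> : c - (t%:Z - 1) = c - t%:Z + 1 by lia.
have -> : d + 1 + (t%:Z - 1) = d + 1 + t%:Z - 1 by lia.
have -> : e + (t%:Z - 1) = e + t%:Z - 1 by lia.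
have -> : inv_fact (c - t%:Z) = (c - t%:Z + 1)%:~R * inv_fact (c - t%:Z + 1).
  by rewrite mul_inv_fact addrK.
rewrite -!mul_inv_fact !(rmorphD, rmorphN, rmorph1) /=.
ring.
Qed.

Lemma racah_sum_trunc (T a : nat) (b c d e : int) : (a < T)%N ->
  racah_sum T a b c d e = racah_sum a.+1 a b c d e.
Proof.
move=> aT; pose F (t : nat) := (-1) ^+ t * inv_fact t%:Z * inv_fact (a%:Z - t%:Z)
    * inv_fact (b - t%:Z) * inv_fact (c - t%:Z)
    * inv_fact (d + t%:Z) * inv_fact (e + t%:Z).
rewrite /racah_sum (big_ord_widen _ F aT) [RHS]big_mkcond /=.
apply: eq_bigr => t _; case: ifP => // ta.
by rewrite (@inv_fact_neg (a%:Z - t%:Z)) ?mulr0 ?mul0r//; lia.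
Qed.

(** The substitution of a - t for t exchanges the arguments b, c with e, d. For
    the 3j symbols this is the change of sign of all the orders. *)
Lemma racah_sum_reflect (T a : nat) (b c d e : int) : (a < T)%N ->
  racah_sum T a (a%:Z + d) (a%:Z + e) (b - a%:Z) (c - a%:Z)
    = (-1) ^+ a * racah_sum T a b c d e.
Proof.
move=> aT; rewrite !(racah_sum_trunc _ _ _ _ aT) /racah_sum.
rewrite [LHS](reindex_inj rev_ord_inj) mulr_sumr; apply: eq_bigr => t _ /=.
have ta : (t <= a)%N by rewrite -ltnS.
rewrite subSS; have -> : (-1) ^+ (a - t) = (-1) ^+ a * (-1) ^+ t :> R.
  by rewrite -signr_odd oddB// signr_addb !signr_odd.
have -> : a%:Z - (a - t)%N%:Z = t%:Z by lia.
have -> : a%:Z + d - (a - t)%N%:Z = d + t%:Z by lia.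
have -> : a%:Z + e - (a - t)%N%:Z = e + t%:Z by lia.
have -> : b - a%:Z + (a - t)%N%:Z = b - t%:Z by lia.
have -> : c - a%:Z + (a - t)%N%:Z = c - t%:Z by lia.
have -> : (a - t)%N%:Z = a%:Z - t%:Z by lia.
ring.
Qed.

Lemma racah_sum_swap (T : nat) (a b c d e : int) :
  racah_sum T a b c d e = racah_sum T a c b e d.
Proof. by apply: eq_bigr => t _; ring. Qed.

End Racah.

(** * Rotation-invariant tensors *)

Section Invariant.
Variable R : realType.
Implicit Types (l : nat) (m : int).

(** The matrix coefficient of the raising operator from the order m to m + 1
    in degree l. *)
Definition ladder_coef l m : R := Num.sqrt ((l%:Z - m) * (l%:Z + m + 1))%:~R.

Lemma ladder_coef_opp l m : ladder_coef l (- m) = ladder_coef l (m - 1).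
Proof. by congr (Num.sqrt _%:~R); ring. Qed.

(** Invariance under rotations, in infinitesimal form: w has total weight zero
    and is annihilated by the raising and lowering operators. *)
Record invariant_tensor l1 l2 l3 (w : int -> int -> int -> R) : Prop := {
  inv_supp : forall m1 m2 m3, w m1 m2 m3 != 0 ->
    [/\ m1 + m2 + m3 = 0, `|m1| <= l1%:Z, `|m2| <= l2%:Z & `|m3| <= l3%:Z];
  inv_raise : forall m1 m2 m3,
    ladder_coef l1 m1 * w (m1 + 1) m2 m3 + ladder_coef l2 m2 * w m1 (m2 + 1) m3
    + ladder_coef l3 m3 * w m1 m2 (m3 + 1) = 0;
  inv_lower : forall m1 m2 m3,
    ladder_coef l1 (m1 - 1) * w (m1 - 1) m2 m3
    + ladder_coef l2 (m2 - 1) * w m1 (m2 - 1) m3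
    + ladder_coef l3 (m3 - 1) * w m1 m2 (m3 - 1) = 0
}.

Lemma invariant_swap12 l1 l2 l3 w : invariant_tensor l1 l2 l3 w ->
  invariant_tensor l2 l1 l3 (fun m1 m2 m3 => w m2 m1 m3).
Proof.
case=> sw rw lw; split=> m1 m2 m3.
- by move=> /sw[h1 h2 h3 h4]; split=> //; lia.
- by rewrite -(rw m2 m1 m3) [X in X + _]addrC.
- by rewrite -(lw m2 m1 m3) [X in X + _]addrC.
Qed.

Lemma invariant_swap23 l1 l2 l3 w : invariant_tensor l1 l2 l3 w ->
  invariant_tensor l1 l3 l2 (fun m1 m2 m3 => w m1 m3 m2).
Proof.
case=> sw rw lw; split=> m1 m2 m3.
- by move=> /sw[h1 h2 h3 h4]; split=> //; lia.
- by rewrite -(rw m1 m3 m2) addrAC.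
- by rewrite -(lw m1 m3 m2) addrAC.
Qed.

Lemma invariant_sub l1 l2 l3 w w' : invariant_tensor l1 l2 l3 w ->
  invariant_tensor l1 l2 l3 w' ->
  invariant_tensor l1 l2 l3 (fun m1 m2 m3 => w m1 m2 m3 - w' m1 m2 m3).
Proof.
case=> sw rw lw [sw' rw' lw']; split=> m1 m2 m3.
- have [w0|/sw//] := eqVneq (w m1 m2 m3) 0.
  by rewrite w0 sub0r oppr_eq0 => /sw'.
- by have := rw m1 m2 m3; have := rw' m1 m2 m3; lra.
- by have := lw m1 m2 m3; have := lw' m1 m2 m3; lra.
Qed.

Lemma ladder_coef_eq0 l m : - l%:Z <= m -> m < l%:Z -> ladder_coef l m != 0.
Proof.
move=> h1 h2; rewrite sqrtr_eq0 -ltNge ltr0z; apply: mulr_gt0; lia.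
Qed.

Lemma ladder_coef_top l : ladder_coef l l%:Z = 0.
Proof. by rewrite /ladder_coef subrr mul0r sqrtr0. Qed.

(** The lowering relation determines the values at first order m - 1 from
    those at first order m, so an invariant tensor is determined by its values
    at the highest order of one leg. *)
Lemma invariant_eq0 l1 l2 l3 w : invariant_tensor l1 l2 l3 w ->
  (forall m2 m3, w l1%:Z m2 m3 = 0) -> forall m1 m2 m3, w m1 m2 m3 = 0.
Proof.
move=> iw top.
have desc (n : nat) m2 m3 : (n <= l1.*2)%N -> w (l1%:Z - n%:Z) m2 m3 = 0.
  elim: n m2 m3 => [|n IH] m2 m3 nl; first by rewrite subr0.
  have := inv_lower iw (l1%:Z - n%:Z) m2 m3.
  rewrite !IH ?mulr0 ?addr0; try lia.
  rewrite (_ : _ - n%:Z - 1 = l1%:Z - n.+1%:Z); last by lia.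
  by move/eqP; rewrite mulf_eq0 (negPf (ladder_coef_eq0 _ _)); [move/eqP|lia|lia].
move=> m1 m2 m3; apply/eqP/negP => /negP /[dup] /(inv_supp iw)[_ h _ _].
have := @desc `|l1%:Z - m1|%N m2 m3.
have -> : l1%:Z - `|l1%:Z - m1|%N%:Z = m1 by lia.
by move=> ->; rewrite ?eqxx//; lia.
Qed.

End Invariant.

(** * Sums over the orders of a degree *)

Section OrderSums.
Variable R : nmodType.
Implicit Types (l L : nat) (m : int) (f g : int -> R).

Definition msum l (f : int -> R) : R := \sum_(i < l.*2.+1) f (order_of i).

Lemma eq_msum l f g : (forall m, `|m| <= l%:Z -> f m = g m) -> msum l f = msum l g.
Proof.
move=> h; apply: eq_bigr => i _; apply: h; rewrite /order_of.
by have := ltn_ord i; lia.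
Qed.

Lemma msum_int l f : msum l f = \sum_(0 <= k < l.*2.+1) f (k%:Z - l%:Z).
Proof. by rewrite big_mkord. Qed.

Lemma msum_single l f m : `|m| <= l%:Z -> (forall m', m' != m -> f m' = 0) ->
  msum l f = f m.
Proof.
move=> ml h.
have lt : (`|(m + l%:Z)%R|%N < l.*2.+1)%N by lia.
have oE : order_of (Ordinal lt) = m by rewrite /order_of /=; lia.
rewrite /msum (bigD1 (Ordinal lt))//= big1 ?addr0 ?oE// => i il.
apply: h; apply: contra_neq il => im; apply: val_inj => /=.
by move: im; rewrite /order_of; lia.
Qed.

Lemma msum_widen l L f : (l <= L)%N -> (forall m, l%:Z < `|m| -> f m = 0) ->
  msum L f = msum l f.
Proof.
move=> lL h; rewrite !msum_int.
rewrite (@big_cat_nat _ _ _ (L - l))/=; [|lia|lia].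
rewrite (@big_cat_nat _ _ _ (L + l).+1 (L - l))/=; [|lia|lia].
rewrite big1_seq ?add0r; last first.
  by move=> k; rewrite mem_index_iota => /andP[_ /andP[_ k1]]; apply: h; lia.
rewrite [X in _ + X]big1_seq ?addr0; last first.
  by move=> k; rewrite mem_index_iota => /andP[_ /andP[k1 k2]]; apply: h; lia.
rewrite -{1}[(L - l)%N]add0n big_addn (_ : ((L + l).+1 - (L - l) = l.*2.+1)%N); last by lia.
by apply: eq_big_nat => k kl; congr (f _); lia.
Qed.

Lemma msum_shift l f : f (- l%:Z) = 0 -> f (l%:Z + 1) = 0 ->
  msum l (fun m => f (m + 1)) = msum l f.
Proof.
move=> f0 f1; rewrite !msum_int big_nat_recr//= [RHS]big_nat_recl//=.
rewrite (_ : 0%:Z - l%:Z = - l%:Z) ?f0 ?add0r; last by lia.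
rewrite (_ : _ - _ + 1 = l%:Z + 1) ?f1 ?addr0; last by lia.
by apply: eq_bigr => k _; congr (f _); lia.
Qed.

Lemma msum_opp l f : msum l (fun m => f (- m)) = msum l f.
Proof.
rewrite /msum [RHS](reindex_inj rev_ord_inj); apply: eq_bigr => i _.
by congr (f _); rewrite /order_of /=; have := ltn_ord i; lia.
Qed.

Lemma msum0 l f : (forall m, f m = 0) -> msum l f = 0.
Proof. by move=> h; rewrite /msum big1. Qed.

End OrderSums.

(** * The 3j symbols are invariant *)

Section Wigner.
Variable R : realType.
Implicit Types (l : nat) (m : int).

Lemma signz_add (x y : int) : (-1) ^ (x + y) = (-1) ^ x * (-1) ^ y :> R.
Proof. by rewrite expfzDr// oppr_eq0 oner_eq0. Qed.

Lemma signz_opp (x : int) : (-1) ^ (- x) = (-1) ^ x :> R.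
Proof. by rewrite -exprz_inv invrN1. Qed.

Lemma signz_sqr (x : int) : (-1) ^ x * (-1) ^ x = 1 :> R.
Proof. by rewrite -{2}signz_opp -signz_add subrr. Qed.

Lemma signz_even (n : nat) : ~~ odd n -> (-1) ^ n%:Z = 1 :> R.
Proof. by move=> /negPf no; rewrite -exprnP -signr_odd no. Qed.

Lemma racah_sum_eq0 T (a b c d e : int) :
  [\/ b < 0, a + e < 0 | c + d < 0] -> racah_sum R T a b c d e = 0.
Proof.
move=> h; rewrite /racah_sum big1// => t _.
case: h => h.
- by rewrite (@inv_fact_neg _ (b - t%:Z)) ?mulr0 ?mul0r//; lia.
- have [|] := lerP t%:Z a => ta.
    by rewrite (@inv_fact_neg _ (e + t%:Z)) ?mulr0 ?mul0r//; lia.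
  by rewrite (@inv_fact_neg _ (a - t%:Z)) ?mulr0 ?mul0r//; lia.
- have [|] := lerP t%:Z c => tc.
    by rewrite (@inv_fact_neg _ (d + t%:Z)) ?mulr0 ?mul0r//; lia.
  by rewrite (@inv_fact_neg _ (c - t%:Z)) ?mulr0 ?mul0r//; lia.
Qed.

Definition weight_norm l m : R := Num.sqrt (zfact (l%:Z + m) * zfact (l%:Z - m))%N%:R.

Lemma zfactS (z : int) : 0 <= z -> zfact (z + 1) = (`|z|.+1 * zfact z)%N.
Proof. by case: z => // n _; rewrite /zfact (_ : n%:Z + 1 = n.+1%:Z) /= ?factS//; lia. Qed.

(** In Racah's formula the square roots attached to the orders absorb the
    square root of the ladder coefficient, leaving a rational factor. *)
Lemma ladder_weight_norm l m : `|m| <= l%:Z -> m < l%:Z ->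
  ladder_coef R l m * weight_norm l (m + 1) = (l%:Z + m + 1)%:~R * weight_norm l m.
Proof.
move=> ml ml'; rewrite /ladder_coef /weight_norm -sqrtrM; last first.
  by rewrite ler0z; apply: mulr_ge0; lia.
have lmE : (l%:Z + m + 1)%:~R = Num.sqrt ((l%:Z + m + 1)%:~R ^+ 2) :> R.
  by rewrite sqrtr_sqr ger0_norm// ler0z; lia.
rewrite [X in _ = X * _]lmE.
rewrite -sqrtrM ?sqr_ge0//; congr Num.sqrt.
rewrite (_ : l%:Z + (m + 1) = l%:Z + m + 1); last by lia.
rewrite (_ : l%:Z - m = l%:Z - (m + 1) + 1); last by lia.
rewrite !zfactS; [|lia|lia].
have -> : (l%:Z - (m + 1) + 1) * (l%:Z + m + 1)
    = (`|(l%:Z - (m + 1))%R|.+1 * `|(l%:Z + m)%R|.+1)%N%:Z by lia.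
have -> : l%:Z + m + 1 = `|(l%:Z + m)%R|.+1%:Z by lia.
rewrite -!pmulrn -!natrX -!natrM; congr (_%:R); ring.
Qed.

Section Triangle.
Variables l1 l2 l3 : nat.
Hypothesis tri : (l1 <= l2 + l3)%N /\ (l2 <= l1 + l3)%N /\ (l3 <= l1 + l2)%N.
Let L1 := l1%:Z. Let L2 := l2%:Z. Let L3 := l3%:Z.
Let T := (l1 + l2).+1.

Definition triangle_norm : R :=
  Num.sqrt ((zfact (L1 + L2 - L3) * zfact (L1 - L2 + L3)
                 * zfact (- L1 + L2 + L3))%N%:R
                / (zfact (L1 + L2 + L3 + 1))%:R).

(** The 3j symbol without its selection rules. *)
Definition wigner_core m1 m2 m3 : R :=
  (-1) ^ (L1 - L2 - m3) * triangle_norm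
  * (weight_norm l1 m1 * weight_norm l2 m2 * weight_norm l3 m3)
  * racah_sum R T (L1 + L2 - L3) (L1 - m1) (L2 + m2) (L3 - L2 + m1) (L3 - L1 - m2).

Lemma wigner_supp m1 m2 m3 : wigner3j R l1 l2 l3 m1 m2 m3 != 0 ->
    [/\ m1 + m2 + m3 = 0, `|m1| <= l1%:Z, `|m2| <= l2%:Z & `|m3| <= l3%:Z].
Proof.
rewrite /wigner3j /=; case: ifP; last by rewrite eqxx.
by case/and5P => /eqP ? ? ? ? _ _.
Qed.

Lemma wignerE m1 m2 m3 : m1 + m2 + m3 = 0 ->
  `|m1| <= L1 -> `|m2| <= L2 -> `|m3| <= L3 ->
  wigner3j R l1 l2 l3 m1 m2 m3 = wigner_core m1 m2 m3.
Proof.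
case: tri => t1 [t2 t3] s h1 h2 h3; rewrite /wigner3j.
rewrite -/L1 -/L2 -/L3 ifT; last first.
  by rewrite s eqxx h1 h2 h3 /=; apply/andP; split; rewrite /L1 /L2 /L3; lia.
rewrite /wigner_core /triangle_norm; congr (_ * _ * _ * _).
  by rewrite /weight_norm !natrM !sqrtrM ?mulr_ge0 ?ler0n.
rewrite /racah_sum big_mkcond; apply: eq_bigr => t _.
rewrite (_ : L3 - L2 + m1 + t%:Z = L3 - L2 + t%:Z + m1); last by ring.
rewrite (_ : L3 - L1 - m2 + t%:Z = L3 - L1 + t%:Z - m2); last by ring.
rewrite (_ : L1 - m1 - t%:Z = L1 - t%:Z - m1); last by ring.
rewrite (_ : L2 + m2 - t%:Z = L2 - t%:Z + m2); last by ring.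
rewrite /inv_fact (_ : zfact t%:Z = t`!)//=.
do 5 case: (0 <= _) => /=; rewrite ?mulr0 ?mul0r//.
rewrite !natrM !invfM; ring.
Qed.

(** Each of the three terms is a common factor times a term of the ladder
    relation for Racah sums; the terms at the end of a ladder vanish on both
    sides. *)
Lemma wigner_core_raise m1 m2 m3 : m1 + m2 + m3 = -1 ->
  `|m1| <= L1 -> `|m2| <= L2 -> `|m3| <= L3 ->
  ladder_coef R l1 m1 * wigner3j R l1 l2 l3 (m1 + 1) m2 m3
  + ladder_coef R l2 m2 * wigner3j R l1 l2 l3 m1 (m2 + 1) m3
  + ladder_coef R l3 m3 * wigner3j R l1 l2 l3 m1 m2 (m3 + 1) = 0.
Proof.
move=> s h1 h2 h3; case: (tri) => tri1 [tri2 tri3].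
pose a := L1 + L2 - L3; pose b := L1 - m1; pose c := L2 + m2.
pose d := L3 - L2 + m1; pose e := L3 - L1 - m2.
pose pre := (-1) ^ (L1 - L2 - m3) * triangle_norm
  * (weight_norm l1 m1 * weight_norm l2 m2 * weight_norm l3 m3).
have -> : ladder_coef R l1 m1 * wigner3j R l1 l2 l3 (m1 + 1) m2 m3
   = pre * ((a + d + 1)%:~R * racah_sum R T a (b - 1) c (d + 1) e).
  have [m1l|m1l] := ltrP m1 L1.
    rewrite wignerE; [|lia|lia|done|done].
    rewrite /wigner_core (_ : a + d + 1 = L1 + m1 + 1); last by rewrite /a /d; ring.
    rewrite (_ : L1 - (m1 + 1) = b - 1); last by rewrite /b; ring.
    rewrite (_ : L3 - L2 + (m1 + 1) = d + 1); last by rewrite /d; ring.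
    have := ladder_weight_norm h1 m1l; rewrite /pre -/L1 -/a -/c -/e.
    set ql := weight_norm l1 (m1 + 1); set lc := ladder_coef R l1 m1 => H.
    transitivity ((-1) ^ (L1 - L2 - m3) * triangle_norm
      * ((lc * ql) * weight_norm l2 m2 * weight_norm l3 m3)
      * racah_sum R T a (b - 1) c (d + 1) e); first by ring.
    by rewrite H; ring.
  have -> : m1 = L1 by lia.
  rewrite ladder_coef_top mul0r racah_sum_eq0 ?mulr0//; apply: Or31.
  by rewrite /b; lia.
have -> : ladder_coef R l2 m2 * wigner3j R l1 l2 l3 m1 (m2 + 1) m3
   = pre * ((c + 1)%:~R * racah_sum R T a b (c + 1) d (e - 1)).
  have [m2l|m2l] := ltrP m2 L2.
    rewrite wignerE; [|lia|done|lia|done].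
    rewrite /wigner_core.
    rewrite (_ : L2 + (m2 + 1) = c + 1); last by rewrite /c; ring.
    rewrite (_ : L3 - L1 - (m2 + 1) = e - 1); last by rewrite /e; ring.
    have := ladder_weight_norm h2 m2l; rewrite /pre -/L2 -/a -/b -/c -/d.
    set ql := weight_norm l2 (m2 + 1); set lc := ladder_coef R l2 m2 => H.
    transitivity ((-1) ^ (L1 - L2 - m3) * triangle_norm
      * (weight_norm l1 m1 * (lc * ql) * weight_norm l3 m3)
      * racah_sum R T a b (c + 1) d (e - 1)); first by ring.
    by rewrite H; ring.
  have m2E : m2 = L2 by lia.
  rewrite {1}m2E ladder_coef_top mul0r racah_sum_eq0 ?mulr0//; apply: Or32.
  by rewrite /a /e; lia.
have -> : ladder_coef R l3 m3 * wigner3j R l1 l2 l3 m1 m2 (m3 + 1)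
   = - (pre * ((b + e)%:~R * racah_sum R T a b c d e)).
  have [m3l|m3l] := ltrP m3 L3.
    rewrite wignerE; [|lia|done|done|lia].
    rewrite /wigner_core (_ : b + e = L3 + m3 + 1); last by rewrite /b /e; lia.
    rewrite (_ : L1 - L2 - (m3 + 1) = L1 - L2 - m3 + -1); last by ring.
    rewrite signz_add.
    have := ladder_weight_norm h3 m3l; rewrite /pre -/L3 -/a -/b -/c -/d -/e.
    set ql := weight_norm l3 (m3 + 1); set lc := ladder_coef R l3 m3 => H.
    rewrite (_ : (-1) ^ (-1) = -1 :> R); last by rewrite signz_opp.
    transitivity (- ((-1) ^ (L1 - L2 - m3) * triangle_norm
      * (weight_norm l1 m1 * weight_norm l2 m2 * (lc * ql))
      * racah_sum R T a b c d e)); first by ring.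
    by rewrite H; ring.
  have m3E : m3 = L3 by lia.
  rewrite {1}m3E ladder_coef_top mul0r racah_sum_eq0 ?mulr0 ?oppr0//; apply: Or33.
  by rewrite /c /d; lia.
rewrite -mulrDr racah_sum_ladder ?subrr//.
by rewrite /a /T; lia.
Qed.

Lemma ladder_coef_bot l : ladder_coef R l (- l%:Z - 1) = 0.
Proof. by rewrite /ladder_coef (_ : l%:Z + _ + 1 = 0) ?mulr0 ?sqrtr0//; ring. Qed.

Lemma wigner_eq0 m1 m2 m3 :
  ~ [/\ m1 + m2 + m3 = 0, `|m1| <= l1%:Z, `|m2| <= l2%:Z & `|m3| <= l3%:Z] ->
  wigner3j R l1 l2 l3 m1 m2 m3 = 0.
Proof. by move=> h; apply/eqP/negP => /negP /wigner_supp. Qed.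

(** When one of the orders is out of range, two terms vanish by the selection
    rules, and the third one does too unless it lies at the end of a ladder, where
    its coefficient is zero. *)
Lemma wigner_raise m1 m2 m3 :
  ladder_coef R l1 m1 * wigner3j R l1 l2 l3 (m1 + 1) m2 m3
  + ladder_coef R l2 m2 * wigner3j R l1 l2 l3 m1 (m2 + 1) m3
  + ladder_coef R l3 m3 * wigner3j R l1 l2 l3 m1 m2 (m3 + 1) = 0.
Proof.
have [s|s] := eqVneq (m1 + m2 + m3) (-1); last first.
  by rewrite !wigner_eq0 ?mulr0 ?addr0//; case; move: s; rewrite -subr_eq0; lia.
have [h1|h1] := boolP (`|m1| <= L1); last first.
  rewrite [X in _ + X + _](_ : _ = 0); last by rewrite wigner_eq0 ?mulr0//; case; lia.
  rewrite [X in _ + _ + X](_ : _ = 0); last by rewrite wigner_eq0 ?mulr0//; case; lia.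
  rewrite !addr0; have [->|m1l] := eqVneq m1 (- L1 - 1).
    by rewrite ladder_coef_bot mul0r.
  by rewrite wigner_eq0 ?mulr0//; case; lia.
have [h2|h2] := boolP (`|m2| <= L2); last first.
  rewrite [X in X + _ + _](_ : _ = 0); last by rewrite wigner_eq0 ?mulr0//; case; lia.
  rewrite [X in _ + _ + X](_ : _ = 0); last by rewrite wigner_eq0 ?mulr0//; case; lia.
  rewrite add0r addr0; have [->|m2l] := eqVneq m2 (- L2 - 1).
    by rewrite ladder_coef_bot mul0r.
  by rewrite wigner_eq0 ?mulr0//; case; lia.
have [h3|h3] := boolP (`|m3| <= L3); last first.
  rewrite [X in X + _ + _](_ : _ = 0); last by rewrite wigner_eq0 ?mulr0//; case; lia.
  rewrite [X in _ + X + _](_ : _ = 0); last by rewrite wigner_eq0 ?mulr0//; case; lia.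
  rewrite !add0r; have [->|m3l] := eqVneq m3 (- L3 - 1).
    by rewrite ladder_coef_bot mul0r.
  by rewrite wigner_eq0 ?mulr0//; case; lia.
exact: wigner_core_raise.
Qed.

Hypothesis even_sum : ~~ odd (l1 + l2 + l3).

(** The reflection of the Racah sum gives the sign (-1)^(l1 + l2 - l3), which
    is 1 since l1 + l2 + l3 is even. *)
Lemma wigner_opp m1 m2 m3 :
  wigner3j R l1 l2 l3 (- m1) (- m2) (- m3) = wigner3j R l1 l2 l3 m1 m2 m3.
Proof.
have [/andP[/eqP s /and3P[h1 h2 h3]]|h] := boolP ((m1 + m2 + m3 == 0) &&
    [&& `|m1| <= L1, `|m2| <= L2 & `|m3| <= L3]); last first.
  by rewrite !wigner_eq0// => -[*]; move: h; rewrite /L1 /L2 /L3; lia.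
case: (tri) => tri1 [tri2 tri3].
rewrite !wignerE//; try by lia.
have aE : L1 + L2 - L3 = (l1 + l2 - l3)%N%:Z by rewrite /L1 /L2 /L3; lia.
rewrite /wigner_core /weight_norm !opprK ![(zfact (_ - m1) * _)%N]mulnC.
rewrite ![(zfact (_ - m2) * _)%N]mulnC ![(zfact (_ - m3) * _)%N]mulnC.
have -> : racah_sum R T (L1 + L2 - L3) (L1 + m1) (L2 - m2) (L3 - L2 - m1) (L3 - L1 + m2)
  = racah_sum R T (L1 + L2 - L3) (L1 - m1) (L2 + m2) (L3 - L2 + m1) (L3 - L1 - m2).
  rewrite aE -[RHS]mul1r -(@signz_even (l1 + l2 - l3)); last first.
    by move: even_sum; rewrite oddB// !oddD.
  rewrite -exprnP -racah_sum_reflect; last by rewrite /T; lia.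
  by congr racah_sum; rewrite -aE; ring.
suff -> : (-1) ^ (L1 - L2 + m3) = (-1) ^ (L1 - L2 - m3) :> R by [].
have -> : L1 - L2 + m3 = - (L1 - L2 - m3) + ((L1 - L2) + (L1 - L2)) by ring.
by rewrite (signz_add (- _)) (signz_add (L1 - L2) (L1 - L2)) signz_sqr mulr1 signz_opp.
Qed.

(** The lowering relation is the raising one read at opposite orders. *)
Lemma wigner_invariant : invariant_tensor l1 l2 l3 (wigner3j R l1 l2 l3).
Proof.
split; [exact: wigner_supp|exact: wigner_raise|move=> m1 m2 m3].
have := wigner_raise (- m1) (- m2) (- m3).
rewrite !ladder_coef_opp -[X in _ * X + _ + _]wigner_opp.
rewrite -[X in _ + _ * X + _]wigner_opp -[X in _ + _ + _ * X]wigner_opp.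
by rewrite !opprD !opprK.
Qed.

(** For equal degrees the exchange of the two first columns is the reflection
    of the Racah sum combined with its symmetry. *)
Lemma wigner_swap12 : l1 = l2 -> forall m1 m2 m3,
  wigner3j R l1 l2 l3 m2 m1 m3 = wigner3j R l1 l2 l3 m1 m2 m3.
Proof.
move=> l12 m1 m2 m3.
have [/andP[/eqP s /and3P[h1 h2 h3]]|h] := boolP ((m1 + m2 + m3 == 0) &&
    [&& `|m1| <= L1, `|m2| <= L2 & `|m3| <= L3]); last first.
  by rewrite !wigner_eq0// => -[*]; move: h; rewrite /L1 /L2 /L3; lia.
case: (tri) => tri1 [tri2 tri3].
rewrite !wignerE//; try by rewrite /L1 /L2; lia.
have aE : L1 + L2 - L3 = (l1 + l2 - l3)%N%:Z by rewrite /L1 /L2 /L3; lia.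
rewrite /wigner_core; congr (_ * _ * _).
  by rewrite l12; ring.
rewrite [RHS]racah_sum_swap aE -[RHS]mul1r -(@signz_even (l1 + l2 - l3)); last first.
  by move: even_sum; rewrite oddB// !oddD.
rewrite -exprnP -racah_sum_reflect; last by rewrite /T; lia.
by rewrite -aE; congr racah_sum; rewrite /L1 /L2 l12; ring.
Qed.

(** At the highest order m1 = l1 only the term t = 0 of the sum remains. *)
Lemma wigner_top m2 m3 : L1 + m2 + m3 = 0 -> `|m2| <= L2 -> `|m3| <= L3 ->
  wigner3j R l1 l2 l3 L1 m2 m3 = (-1) ^ (L1 - L2 - m3) * triangle_norm
    * (weight_norm l1 L1 * weight_norm l2 m2 * weight_norm l3 m3)
    * (inv_fact R (L1 + L2 - L3) * inv_fact R (L1 - L2 + L3)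
       * (inv_fact R (L2 + m2) * inv_fact R (L3 + m3))).
Proof.
move=> s h2 h3; rewrite wignerE//.
rewrite /wigner_core; congr (_ * _).
rewrite /racah_sum /T big_ord_recl big1 ?addr0; last first.
  by move=> i _; rewrite lift0 (@inv_fact_neg _ (L1 - L1 - _)) ?mulr0 ?mul0r// subrr; lia.
rewrite subrr expr0 mul1r.
have i0 : inv_fact R 0 = 1 by rewrite /inv_fact /= invr1.
rewrite !i0.
rewrite (_ : L3 - L2 + L1 = L1 - L2 + L3); last by ring.
rewrite (_ : L3 - L1 - m2 = L3 + m3); last by lia.
ring.
Qed.

(** Racah's formula is not visibly symmetric in the last two columns. The
    difference of both sides is an invariant tensor and vanishes at the highest
    order of the first leg, by the explicit value there. *)
Lemma wigner_swap23 : l2 = l3 -> forall m1 m2 m3,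
  wigner3j R l1 l2 l3 m1 m3 m2 = wigner3j R l1 l2 l3 m1 m2 m3.
Proof.
move=> l23 m1 m2 m3; apply/eqP; rewrite -subr_eq0; apply/eqP.
have iw := wigner_invariant.
have iw' : invariant_tensor l1 l2 l3 (fun m1 m2 m3 => wigner3j R l1 l2 l3 m1 m3 m2).
  have := invariant_swap23 iw; move: (fun m1 m2 m3 => wigner3j R l1 l2 l3 m1 m3 m2) => f.
  by rewrite l23.
apply: (invariant_eq0 (invariant_sub iw' iw)) => {}m2 {}m3.
have [/and3P[/eqP s h2 h3]|h] := boolP [&& L1 + m2 + m3 == 0, `|m2| <= L2 & `|m3| <= L3];
  last first.
  rewrite !wigner_eq0 ?subrr// => -[*]; move: h; rewrite /L1 /L2 /L3; lia.
rewrite -/L1 !wigner_top//; try by rewrite /L2 /L3; lia.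
apply/eqP; rewrite subr_eq0; apply/eqP.
have -> : (-1) ^ (L1 - L2 - m2) = (-1) ^ (L1 - L2 - m3) :> R.
  have -> : L1 - L2 - m2 = (L1 - L2 - m3) + L1 + (m3 + m3).
    have -> : m2 = - L1 - m3 by lia.
    by ring.
  rewrite (signz_add (_ + _)) (signz_add m3) signz_sqr mulr1 (signz_add (_ - m3)).
  rewrite (@signz_even l1) ?mulr1//.
  by move: even_sum; rewrite l23 -addnA addnn oddD odd_double addbF.
by rewrite /L2 /L3 l23; ring.
Qed.

End Triangle.
End Wigner.

(** * Orthogonality and traces of invariant tensors *)

Section Gram.
Variable R : realType.
Implicit Types (l : nat) (m : int) (w : int -> int -> int -> R).

(** The Gram matrix of the slices of w along its first leg. *)
Definition gram l2 l3 (w : int -> int -> int -> R) m m' : R :=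
  msum l2 (fun m2 => msum l3 (fun m3 => w m m2 m3 * w m' m2 m3)).

Lemma gram_offdiag l1 l2 l3 w m m' : invariant_tensor l1 l2 l3 w -> m != m' ->
  gram l2 l3 w m m' = 0.
Proof.
move=> iw mm'; apply: msum0 => m2; apply: msum0 => m3.
have [->|/(inv_supp iw)[s _ _ _]] := eqVneq (w m m2 m3) 0; first by rewrite mul0r.
have [->|/(inv_supp iw)[s' _ _ _]] := eqVneq (w m' m2 m3) 0; first by rewrite mulr0.
by move: mm' => /eqP []; lia.
Qed.

Lemma msum_add l (f g : int -> R) : msum l (fun m => f m + g m) = msum l f + msum l g.
Proof. exact: big_split. Qed.
Lemma msum_mull l c (f : int -> R) : msum l (fun m => c * f m) = c * msum l f.
Proof. by rewrite /msum mulr_sumr. Qed.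
Lemma msum_exchange l l' (f : int -> int -> R) :
  msum l (fun m => msum l' (f m)) = msum l' (fun m' => msum l (fun m => f m m')).
Proof. exact: exchange_big. Qed.

Lemma invariant_out l1 l2 l3 w m1 m2 m3 : invariant_tensor l1 l2 l3 w ->
  ~ [/\ m1 + m2 + m3 = 0, `|m1| <= l1%:Z, `|m2| <= l2%:Z & `|m3| <= l3%:Z] ->
  w m1 m2 m3 = 0.
Proof. by move=> iw h; apply/eqP/negP => /negP /(inv_supp iw). Qed.

(** The raising operator of the first leg is the opposite of the sum of those
    of the two other legs, whose adjoints are the lowering operators: this is
    the argument of Schur's lemma that the Gram matrix commutes with the
    ladder. *)
Lemma gram_step l1 l2 l3 w m : invariant_tensor l1 l2 l3 w ->
  - l1%:Z <= m -> m < l1%:Z ->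
  gram l2 l3 w (m + 1) (m + 1) = gram l2 l3 w m m.
Proof.
move=> iw h1 h2; apply: (mulfI (ladder_coef_eq0 R h1 h2)).
set c1 := ladder_coef R l1; set c2 := ladder_coef R l2; set c3 := ladder_coef R l3.
transitivity (- (msum l2 (fun m2 => msum l3 (fun m3 =>
     w (m + 1) m2 m3 * (c2 m2 * w m (m2 + 1) m3))))
  - msum l2 (fun m2 => msum l3 (fun m3 =>
     w (m + 1) m2 m3 * (c3 m3 * w m m2 (m3 + 1))))).
  apply/eqP; rewrite -subr_eq0 opprD !opprK addrA.
  rewrite /gram -!msum_mull -!msum_add; apply/eqP/msum0 => m2.
  rewrite -msum_mull -!msum_add; apply: msum0 => m3.
  rewrite (_ : _ + _ = w (m + 1) m2 m3 * (c1 m * w (m + 1) m2 m3 +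
     c2 m2 * w m (m2 + 1) m3 + c3 m3 * w m m2 (m3 + 1))); last by ring.
  by rewrite (inv_raise iw) mulr0.
have -> : msum l2 (fun m2 => msum l3 (fun m3 =>
     w (m + 1) m2 m3 * (c2 m2 * w m (m2 + 1) m3)))
  = msum l2 (fun m2 => msum l3 (fun m3 =>
     w (m + 1) (m2 - 1) m3 * (c2 (m2 - 1) * w m m2 m3))).
  rewrite -[RHS]msum_shift; first last.
  - by apply: msum0 => m3; rewrite (invariant_out iw (m2 := l2%:Z + 1)) ?mulr0//; case; lia.
  - apply: msum0 => m3.
    by rewrite (invariant_out iw (m2 := - l2%:Z - 1)) ?mul0r//; case; lia.
  by apply: eq_msum => m2 _; apply: eq_msum => m3 _; rewrite addrK.
have -> : msum l2 (fun m2 => msum l3 (fun m3 =>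
     w (m + 1) m2 m3 * (c3 m3 * w m m2 (m3 + 1))))
  = msum l2 (fun m2 => msum l3 (fun m3 =>
     w (m + 1) m2 (m3 - 1) * (c3 (m3 - 1) * w m m2 m3))).
  apply: eq_msum => m2 _; rewrite -[RHS]msum_shift; first last.
  - by rewrite (invariant_out iw (m3 := l3%:Z + 1)) ?mulr0//; case; lia.
  - by rewrite (invariant_out iw (m3 := - l3%:Z - 1)) ?mul0r//; case; lia.
  by apply: eq_msum => m3 _; rewrite addrK.
apply/eqP; rewrite eq_sym -subr_eq0 opprD !opprK addrA.
rewrite /gram -!msum_mull -!msum_add; apply/eqP/msum0 => m2.
rewrite -msum_mull -!msum_add; apply: msum0 => m3.
rewrite (_ : _ + _ = w m m2 m3 * (c1 m * w m m2 m3 +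
     c2 (m2 - 1) * w (m + 1) (m2 - 1) m3 + c3 (m3 - 1) * w (m + 1) m2 (m3 - 1)));
  last by ring.
by have := inv_lower iw (m + 1) m2 m3; rewrite !addrK => ->; rewrite mulr0.
Qed.

Lemma gram_const l1 l2 l3 w m : invariant_tensor l1 l2 l3 w -> `|m| <= l1%:Z ->
  gram l2 l3 w m m = gram l2 l3 w l1%:Z l1%:Z.
Proof.
move=> iw ml.
have [n mE] : exists n : nat, m = l1%:Z - n%:Z by exists `|l1%:Z - m|%N; lia.
have : (n <= l1.*2)%N by lia.
rewrite {}mE => {ml}; elim: n => [|n IH] nl; first by rewrite subr0.
rewrite -IH; last by lia.
rewrite -(gram_step iw); [|lia|lia].
by congr gram; lia.
Qed.

Definition tensor_norm l1 l2 l3 (w : int -> int -> int -> R) : R :=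
  msum l1 (fun m1 => msum l2 (fun m2 => msum l3 (fun m3 => w m1 m2 m3 ^+ 2))).

Lemma tensor_norm_gram l1 l2 l3 w : invariant_tensor l1 l2 l3 w ->
  tensor_norm l1 l2 l3 w = (l1.*2.+1)%:R * gram l2 l3 w l1%:Z l1%:Z.
Proof.
move=> iw; rewrite /tensor_norm.
under [LHS]eq_msum => m h.
  under eq_msum => m2 _ do under eq_msum => m3 _ do rewrite expr2.
  rewrite -/(gram l2 l3 w m m) (gram_const iw h); over.
by rewrite /msum sumr_const card_ord mulr_natl.
Qed.

Lemma tensor_norm_swap12 l1 l2 l3 w :
  tensor_norm l2 l1 l3 (fun m1 m2 m3 => w m2 m1 m3) = tensor_norm l1 l2 l3 w.
Proof. exact: msum_exchange. Qed.

Lemma tensor_norm_swap23 l1 l2 l3 w :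
  tensor_norm l1 l3 l2 (fun m1 m2 m3 => w m1 m3 m2) = tensor_norm l1 l2 l3 w.
Proof. by apply: eq_msum => m _; exact: msum_exchange. Qed.

(** The Gram matrix is a scalar matrix, of trace the squared norm of w. *)
Lemma gramE l1 l2 l3 w m m' : invariant_tensor l1 l2 l3 w ->
  tensor_norm l1 l2 l3 w = 1 -> `|m| <= l1%:Z ->
  gram l2 l3 w m m' = (m == m')%:R / (l1.*2.+1)%:R.
Proof.
move=> iw n1 ml; have [<-|mm'] := eqVneq m m'; last first.
  by rewrite (gram_offdiag iw mm') mul0r.
rewrite (gram_const iw ml) mul1r; apply: (mulfI (_ : (l1.*2.+1)%:R != 0)).
  by rewrite pnatr_eq0.
by rewrite -tensor_norm_gram// n1 mulfV// pnatr_eq0.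
Qed.

(** Contraction of two legs of the same degree with the invariant bilinear form
    gives an invariant vector of positive degree l1, hence zero. Only its
    component of order 0 needs an argument: by the lowering relation at
    (1, m, -m) it is a difference of two sums that agree after a shift of m. *)
Lemma invariant_trace l1 l w m1 : invariant_tensor l1 l l w -> (0 < l1)%N ->
  msum l (fun m => (-1) ^ m * w m1 m (- m)) = 0.
Proof.
move=> iw l1_gt0; have [->|m10] := eqVneq m1 0; last first.
  apply: msum0 => m; rewrite (invariant_out iw) ?mulr0// => -[]; lia.
have c0 : ladder_coef R l1 0 != 0 by apply: ladder_coef_eq0; lia.
pose f m := (-1) ^ m * (ladder_coef R l (m - 1) * w 1 (m - 1) (- m)).
have shifted : msum l f
    = msum l (fun m => (-1) ^ (m + 1) * (ladder_coef R l (- m - 1) * w 1 m (- m - 1))).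
  rewrite -[LHS]msum_shift; first last.
  - by rewrite /f (invariant_out iw (m3 := - (l%:Z + 1))) ?mulr0//; case; lia.
  - by rewrite /f (invariant_out iw (m2 := - l%:Z - 1)) ?mulr0//; case; lia.
  apply: eq_msum => m _; rewrite /f addrK opprD; congr (_ * (_ * _)).
  by rewrite -ladder_coef_opp opprK.
apply: (mulfI c0); rewrite mulr0.
transitivity (msum l (fun m => (-1) ^ (m + 1) * (ladder_coef R l (- m - 1) * w 1 m (- m - 1)))
  - msum l f); last by rewrite -shifted subrr.
rewrite -[- msum l f]mulN1r -!msum_mull -msum_add; apply: eq_msum => m _; rewrite /f.
have -> : (-1) ^ (m + 1) = - (-1) ^ m :> R by rewrite signz_add expr1z mulrN1.
have := inv_lower iw 1 m (- m); rewrite subrr => lowered.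
transitivity ((-1) ^ m * (ladder_coef R l1 0 * w 0 m (- m))); first by ring.
have -> : ladder_coef R l1 0 * w 0 m (- m) = - (ladder_coef R l (m - 1) * w 1 (m - 1) (- m))
   - ladder_coef R l (- m - 1) * w 1 m (- m - 1).
  by apply/eqP; rewrite -subr_eq0 -lowered; apply/eqP; ring.
ring.
Qed.

End Gram.

(** * Normalization of the 3j symbols *)

Section WignerNorm.
Variable R : realType.

(** A form of Vandermonde's identity: both sides are the coefficient of X^k in
    (1 - X)^(- a - 1) (1 - X)^(- p - 1). *)
Lemma sum_binomial_product (a p k : nat) :
  (\sum_(i < k.+1) 'C(a + (k - i), a) * 'C(p + i, p) = 'C(a + p + k + 1, k))%N.
Proof.
have diag n : (\sum_(i < n.+1) 'C(p + i, p) = 'C(p + n + 1, n))%N.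
  elim: n => [|n IHn]; first by rewrite big_ord_recl big_ord0 !addn0 binn bin0.
  rewrite big_ord_recr /= IHn addn1 -addnS addn1 binS addnC; congr (_ + _)%N.
  by rewrite -[in RHS]bin_sub ?addnK ?leq_addl.
elim: k a => [|k IHk] a.
  by rewrite big_ord_recl big_ord0 /= !addn0 !binn bin0.
elim: a => [|a IHa].
  by under eq_bigr do rewrite bin0 mul1n; rewrite diag add0n.
rewrite addn1 !addSn binS -[in X in (_ = X + _)%N](addn1 (a + p + k.+1)) -IHa.
have -> : 'C((a + p + k.+1).+1, k) = 'C(a.+1 + p + k + 1, k) by congr binomial; lia.
rewrite -IHk addnC big_ord_recr /= subnn addn0 binn.
rewrite [X in (_ = _ + X)%N]big_ord_recr /= subnn addn0 binn addnA; congr (_ + _)%N.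
rewrite -big_split /=; apply: eq_bigr => i _; rewrite -mulnDl; congr (_ * _)%N.
have ik : (i <= k)%N by rewrite -ltnS.
by rewrite subSn// addSnnS !addnS binS addSn addnC.
Qed.

Lemma sqr_weight_norm l (m : int) :
  weight_norm R l m ^+ 2 = (zfact (l%:Z + m))%:R * (zfact (l%:Z - m))%:R.
Proof. by rewrite sqr_sqrtr ?ler0n// natrM. Qed.

Lemma inv_factE (n : nat) : inv_fact R n%:Z = (n`!)%:R^-1.
Proof. by []. Qed.

Lemma fact_neq0 (n : nat) : (n`!)%:R != 0 :> R.
Proof. by rewrite pnatr_eq0 -lt0n fact_gt0. Qed.

Lemma bin_ratio (a j : nat) :
  ('C(a + j, a))%:R = ((a + j)`!)%:R / ((a`!)%:R * (j`!)%:R) :> R.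
Proof.
have := bin_fact (leq_addr j a); rewrite addKn => /(congr1 (fun n => n%:R : R)).
rewrite !natrM => <-; rewrite mulfK// mulf_neq0 ?fact_neq0//.
Qed.

(** At the highest order the squares of the symbols are products of two
    binomial coefficients, so their sum is given by Vandermonde's identity. *)
Lemma wigner_gram_top (l1 l2 l3 : nat) :
  (l1 <= l2 + l3)%N /\ (l2 <= l1 + l3)%N /\ (l3 <= l1 + l2)%N ->
  ~~ odd (l1 + l2 + l3) ->
  gram l2 l3 (wigner3j R l1 l2 l3) l1%:Z l1%:Z = ((l1.*2.+1)%:R)^-1.
Proof.
move=> tri even; case: (tri) => tri1 [tri2 tri3].
(* The second order is written i - l2 with 0 <= i <= k; the third one is then forced. *)
pose a := (l1 + l2 - l3)%N; pose p := (l1 + l3 - l2)%N; pose k := (l2 + l3 - l1)%N.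
pose w := wigner3j R l1 l2 l3.
have aE : (a + l3 = l1 + l2)%N by rewrite /a; lia.
have pE : (p + l2 = l1 + l3)%N by rewrite /p; lia.
have kE : (k + l1 = l2 + l3)%N by rewrite /k; lia.
move: aE pE kE; move: a p k => a p k aE pE kE.
have term (i : nat) : (i <= k)%N ->
  w l1%:Z (i%:Z - l2%:Z) ((k - i)%N%:Z - l3%:Z) ^+ 2
  = (k`!)%:R * ((a + p)`!)%:R / ((a + p + k + 1)`!)%:R
    * ('C(a + (k - i), a) * 'C(p + i, p))%N%:R.
  move=> ik; rewrite /w (wigner_top _ tri even); try by lia.
  rewrite !exprMn [X in X * _ * _ * _]expr2 signz_sqr mul1r.
  rewrite !sqr_weight_norm.
  have -> : l1%:Z + l2%:Z - l3%:Z = a%:Z by lia.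
  have -> : l1%:Z - l2%:Z + l3%:Z = p%:Z by lia.
  have -> : l2%:Z + (i%:Z - l2%:Z) = i%:Z by ring.
  have -> : l3%:Z + ((k - i)%N%:Z - l3%:Z) = (k - i)%N%:Z by ring.
  have -> : l2%:Z - (i%:Z - l2%:Z) = (a + (k - i))%N%:Z by lia.
  have -> : l3%:Z - ((k - i)%N%:Z - l3%:Z) = (p + i)%N%:Z by lia.
  have -> : l1%:Z + l1%:Z = (a + p)%N%:Z by lia.
  have -> : l1%:Z - l1%:Z = 0%N by rewrite subrr.
  rewrite !inv_factE natrM !bin_ratio /triangle_norm sqr_sqrtr ?divr_ge0 ?ler0n//.
  have -> : l1%:Z + l2%:Z - l3%:Z = a%:Z by lia.
  have -> : l1%:Z - l2%:Z + l3%:Z = p%:Z by lia.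
  have -> : - l1%:Z + l2%:Z + l3%:Z = k%:Z by lia.
  have -> : l1%:Z + l2%:Z + l3%:Z + 1 = (a + p + k + 1)%N%:Z by lia.
  rewrite !natrM /zfact /= fact0.
  move: (k - i)%N => j.
  field; rewrite ?fact_neq0 ?oner_eq0//.
transitivity (\sum_(i < k.+1) w l1%:Z (i%:Z - l2%:Z) ((k - i)%N%:Z - l3%:Z) ^+ 2).
  rewrite /gram msum_int.
  rewrite (@big_cat_nat _ _ _ k.+1)//=; last by lia.
  rewrite [X in _ + X]big1_seq ?addr0; last first.
    move=> i; rewrite mem_index_iota => /andP[_ /andP[ki il]].
    apply: msum0 => m3; rewrite wigner_eq0 ?mul0r//.
    by case; lia.
  rewrite big_mkord; apply: eq_bigr => i _.
  have ik : (i <= k)%N by rewrite -ltnS.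
  rewrite (@msum_single _ _ _ ((k - i)%N%:Z - l3%:Z)) ?expr2//.
    by lia.
  move=> m3 m3E; rewrite wigner_eq0 ?mul0r// => -[h _ _ _].
  by move/eqP: m3E; apply; clear -h ik kE; lia.
rewrite (eq_bigr _ (fun (i : 'I_k.+1) _ => term i (ltn_ord i))).
rewrite -mulr_sumr -natr_sum sum_binomial_product.
have -> : (l1.*2.+1)%N = (a + p).+1 by lia.
have kn : (k <= a + p + k + 1)%N by lia.
have nk : (a + p + k + 1 - k = (a + p).+1)%N by lia.
have := bin_fact kn; move: kn; rewrite nk; move: (a + p)%N => q {nk}.
move: (q + k + 1)%N => n; rewrite factS => kn /(congr1 (fun n => n%:R : R)).
rewrite !natrM => <-; field.
by rewrite -(natrD _ 1 q) !pnatr_eq0 -!lt0n !fact_gt0 bin_gt0 kn.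
Qed.

Lemma wigner_tensor_norm (l1 l2 l3 : nat) :
  (l1 <= l2 + l3)%N /\ (l2 <= l1 + l3)%N /\ (l3 <= l1 + l2)%N ->
  ~~ odd (l1 + l2 + l3) -> tensor_norm l1 l2 l3 (wigner3j R l1 l2 l3) = 1.
Proof.
move=> tri even; rewrite (tensor_norm_gram (wigner_invariant R tri even)).
by rewrite wigner_gram_top// mulfV// pnatr_eq0.
Qed.

End WignerNorm.

(** * Invariant tensors in the real basis of orders *)

Section RealBasis.
Variable R : realType.
Local Open Scope complex_scope.
Implicit Types (l : nat) (m n : int) (w : int -> int -> int -> R).

Lemma msum_two (M : nmodType) l (f : int -> M) m : m != 0 -> `|m| <= l%:Z ->
  (forall n, `|n| != `|m| -> f n = 0) -> msum l f = f m + f (- m).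
Proof.
move=> m0 ml f0.
transitivity (msum l (fun n => if n == m then f n else 0)
            + msum l (fun n => if n == - m then f n else 0)).
  rewrite /msum -big_split; apply: eq_bigr => i _ /=.
  case: eqP => [->|nm]; case: eqP => [nm'|nm']; rewrite ?addr0 ?add0r//.
    by move/eqP: m0; case; lia.
  by apply: f0; apply/eqP; lia.
rewrite (msum_single (m := m))//; last by move=> n /negPf ->.
rewrite (msum_single (m := - m)) ?normrN ?eqxx// => n /negPf -> //.
Qed.

Definition isqrt2 : R := (Num.sqrt 2)^-1.
Lemma isqrt2_sqr : isqrt2 * isqrt2 + isqrt2 * isqrt2 = 1.
Proof.
have s2 : Num.sqrt 2 * Num.sqrt 2 = 2 :> R by rewrite -expr2 sqr_sqrtr// ler0n.
rewrite /isqrt2 -invfM s2 -mulr2n -(mulr_natl (2^-1)) divff//.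
Qed.

(** The coefficient of the real Gaussian coordinate of order n in the harmonic
    coefficient of order m: for m > 0 the coordinates m and -m carry the real
    and imaginary parts, and negative orders follow from
    a_(l, -m) = (-1)^m conj(a_(l, m)). *)
Definition basis_coef m n : R[i] :=
  if m == 0 then (n == 0)%:R
  else if 0 < m then (n == m)%:R * isqrt2 +i* ((n == - m)%:R * isqrt2)
  else (-1) ^+ `|m|%N * ((n == - m)%:R * isqrt2 -i* ((n == m)%:R * isqrt2)).

Lemma sign_sqr (k : nat) : (-1) ^+ k * (-1) ^+ k = 1 :> R[i].
Proof. by rewrite -expr2 sqrr_sign. Qed.

Lemma sign_cancel (s a b c d : R[i]) : s * s = 1 ->
  s * a * (s * b) + s * c * (s * d) = a * b + c * d.
Proof.
move=> ss; transitivity (s * s * (a * b + c * d)); first by ring.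
by rewrite ss mul1r.
Qed.

Lemma sign_cancel_conj (z z' s : R[i]) : s * s = 1 ->
  z * conjc z' + s * conjc z * (s * z') = z * conjc z' + conjc z * z'.
Proof.
move=> ss; transitivity (z * conjc z' + s * s * (conjc z * z')); first by ring.
by rewrite ss mul1r.
Qed.

Lemma conjc_sign (k : nat) : conjc ((-1) ^+ k : R[i]) = (-1) ^+ k.
Proof. by rewrite rmorphXn rmorphN1. Qed.

Lemma basis_coef_conj m n : conjc (basis_coef m n) = (-1) ^+ `|m|%N * basis_coef (- m) n.
Proof.
rewrite /basis_coef oppr_eq0; case: ltrgt0P => [m0|m0|->].
- rewrite [in RHS]ifF; last by apply/negP; lia.
  by rewrite abszN mulrA sign_sqr mul1r opprK.
- rewrite ifT; last by lia.
  by rewrite rmorphM /= conjc_sign !opprK.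
- by rewrite expr0 mul1r rmorph_nat.
Qed.

Lemma basis_coef_eq0 m n : `|n| != `|m| -> basis_coef m n = 0.
Proof.
move=> nm; rewrite /basis_coef.
have /negPf-> : n != m by apply: contra_neq nm => ->.
have /negPf-> : n != - m by apply: contra_neq nm => ->; rewrite normrN.
case: eqP => [m0|_].
  by have /negPf-> : n != 0 by apply: contra_neq nm => ->; rewrite m0.
by rewrite mul0r oppr0 -[0 +i* 0]/(0 : R[i]) mulr0 if_same.
Qed.

Lemma complex_split (z : R[i]) : z = complex.Re z +i* complex.Im z.
Proof. by case: z. Qed.

(** Real and imaginary parts have the same variance and are uncorrelated, so
    a complex coefficient has mean square zero. *)
Lemma basis_coef_isotropic m : m != 0 ->
  basis_coef m m * basis_coef m m + basis_coef m (- m) * basis_coef m (- m) = 0.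
Proof.
move=> m0; have N1 : m == - m = false by apply/eqP; move/eqP: m0; lia.
have N2 : - m == m = false by apply/eqP; move/eqP: m0; lia.
rewrite /basis_coef (negPf m0) !eqxx N1 N2 !mul1r !mul0r; case: ifP => _.
  by apply/eqP; rewrite eq_complex /=; apply/andP; split; apply/eqP; ring.
rewrite sign_cancel ?sign_sqr//.
by apply/eqP; rewrite eq_complex /=; apply/andP; split; apply/eqP; ring.
Qed.

Lemma basis_rows l m m' : `|m| <= l%:Z -> `|m'| <= l%:Z ->
  msum l (fun n => basis_coef m n * conjc (basis_coef m' n)) = (m == m')%:R.
Proof.
move=> ml m'l; have [mm'|mm'] := eqVneq `|m| `|m'|; last first.
  have /negPf-> : m != m' by apply: contra_neq mm' => ->.
  apply: msum0 => n; have [nm|nm] := eqVneq `|n| `|m|.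
    by rewrite (@basis_coef_eq0 m') ?rmorph0 ?mulr0// nm.
  by rewrite basis_coef_eq0 ?mul0r.
have [m0|m0] := eqVneq m 0.
  have -> : m' = 0 by move: mm'; rewrite m0; lia.
  rewrite (msum_single (m := 0))// ?m0 ?eqxx /basis_coef ?eqxx ?rmorph1 ?mulr1//.
  by move=> n /negPf ->; rewrite mul0r.
rewrite (msum_two m0)//; last by move=> n nm; rewrite basis_coef_eq0 ?mul0r.
have N1 : m == - m = false by apply/eqP; lia.
have N2 : - m == m = false by apply/eqP; lia.
have [m'm|m'm] := eqVneq m' m.
  rewrite m'm /basis_coef (negPf m0); case: ltP => m_sgn.
    rewrite !eqxx N1 N2 !mul1r !mul0r.
    by apply/eqP; rewrite eq_complex /=; apply/andP; split; apply/eqP;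
      have := isqrt2_sqr; lra.
  rewrite !rmorphM /= !conjc_sign !eqxx N1 N2 !mul1r !mul0r.
  rewrite sign_cancel ?sign_sqr//.
  by apply/eqP; rewrite eq_complex /=; apply/andP; split; apply/eqP;
      have := isqrt2_sqr; lra.
have m'E : m' = - m by lia.
rewrite m'E !basis_coef_conj opprK.
transitivity ((-1) ^+ `|- m|%N * (basis_coef m m * basis_coef m m
   + basis_coef m (- m) * basis_coef m (- m))); first by ring.
by rewrite basis_coef_isotropic ?mulr0.
Qed.

Lemma basis_coef_opp m n : basis_coef (- m) n = (-1) ^+ `|m|%N * conjc (basis_coef m n).
Proof. by rewrite basis_coef_conj mulrA sign_sqr mul1r. Qed.

Lemma basis_coef_flip m n : basis_coef m n = (-1) ^+ `|m|%N * conjc (basis_coef (- m) n).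
Proof. by have := basis_coef_opp (- m) n; rewrite opprK abszN. Qed.

Lemma basis_cols l n n' : `|n| <= l%:Z -> `|n'| <= l%:Z ->
  msum l (fun m => basis_coef m n * conjc (basis_coef m n')) = (n == n')%:R.
Proof.
move=> nl n'l; have [nn'|nn'] := eqVneq `|n| `|n'|; last first.
  have /negPf-> : n != n' by apply: contra_neq nn' => ->.
  apply: msum0 => m; have [nm|nm] := eqVneq `|m| `|n|.
    by rewrite (@basis_coef_eq0 m n') ?rmorph0 ?mulr0// nm eq_sym.
  by rewrite basis_coef_eq0 ?mul0r// eq_sym.
have [n0|n0] := eqVneq n 0.
  have -> : n' = 0 by move: nn'; rewrite n0; lia.
  rewrite (msum_single (m := 0))// ?n0 ?eqxx /basis_coef ?eqxx ?rmorph1 ?mulr1//.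
  move=> m m0; rewrite -/(basis_coef m 0) basis_coef_eq0 ?mul0r//.
  by apply/eqP; move/eqP: m0; lia.
rewrite (msum_two n0)//; last first.
  by move=> m mn; rewrite basis_coef_eq0 ?mul0r// eq_sym.
rewrite !basis_coef_opp rmorphM /= conjc_sign conjcK.
rewrite sign_cancel_conj ?sign_sqr//.
have N1 : n == - n = false by apply/eqP; move/eqP: n0; lia.
rewrite /basis_coef (negPf n0); have [<-|n'n] := eqVneq n n'.
  rewrite eqxx N1; case: ifP => _.
    by apply/eqP; rewrite eq_complex /=; apply/andP; split; apply/eqP;
      have := isqrt2_sqr; lra.
  rewrite !rmorphM /= !conjc_sign sign_cancel ?sign_sqr//.
  by apply/eqP; rewrite eq_complex /=; apply/andP; split; apply/eqP;
      have := isqrt2_sqr; lra.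
have -> : n' = - n by lia.
rewrite !eqxx N1; case: ifP => _.
  by apply/eqP; rewrite eq_complex /=; apply/andP; split; apply/eqP; ring.
rewrite !rmorphM /= !conjc_sign sign_cancel ?sign_sqr//.
by apply/eqP; rewrite eq_complex /=; apply/andP; split; apply/eqP; ring.
Qed.

(** The change of basis is unitary. *)
Lemma parseval l (u v : int -> R[i]) :
  msum l (fun n => msum l (fun m => u m * basis_coef m n)
                   * conjc (msum l (fun m => v m * basis_coef m n)))
    = msum l (fun m => u m * conjc (v m)).
Proof.
transitivity (msum l (fun m => msum l (fun m' => u m * conjc (v m') *
    msum l (fun n => basis_coef m n * conjc (basis_coef m' n))))).
  under eq_msum => n _.
    rewrite /msum rmorph_sum mulr_suml; under eq_bigr do rewrite mulr_sumr; over.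
  rewrite /msum exchange_big; apply: eq_bigr => i _.
  rewrite exchange_big; apply: eq_bigr => i' _; rewrite mulr_sumr.
  by apply: eq_bigr => j _; rewrite /= rmorphM /= mulrACA.
apply: eq_msum => m ml.
rewrite (eq_msum (g := fun m' => u m * conjc (v m') * (m == m')%:R)); last first.
  by move=> m' m'l; rewrite basis_rows.
rewrite (msum_single (m := m))// ?eqxx ?mulr1// => m' m'm.
by rewrite eq_sym (negPf m'm) mulr0.
Qed.

(** The bracketing contracts one leg at a time, so that Parseval's identity can
    be applied leg by leg. *)
Definition real_tensor l1 l2 l3 w n1 n2 n3 : R[i] :=
  msum l3 (fun m3 => msum l2 (fun m2 => msum l1 (fun m1 =>
    (w m1 m2 m3)%:C * basis_coef m1 n1) * basis_coef m2 n2) * basis_coef m3 n3).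

(** What is used of the 3j symbols of an admissible triple; unlike their
    definition, this is stable under permutation of the legs. *)
Record unit_invariant l1 l2 l3 w : Prop := {
  unit_inv : invariant_tensor l1 l2 l3 w;
  unit_norm : tensor_norm l1 l2 l3 w = 1;
  unit_opp : forall m1 m2 m3, w (- m1) (- m2) (- m3) = w m1 m2 m3
}.

Lemma unit_invariant_swap12 l1 l2 l3 w : unit_invariant l1 l2 l3 w ->
  unit_invariant l2 l1 l3 (fun m1 m2 m3 => w m2 m1 m3).
Proof.
case=> iw nw ow; split; [exact: invariant_swap12| |by move=> *].
by rewrite tensor_norm_swap12.
Qed.

Lemma unit_invariant_swap23 l1 l2 l3 w : unit_invariant l1 l2 l3 w ->
  unit_invariant l1 l3 l2 (fun m1 m2 m3 => w m1 m3 m2).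
Proof.
case=> iw nw ow; split; [exact: invariant_swap23| |by move=> *].
by rewrite tensor_norm_swap23.
Qed.

Lemma real_tensorE l1 l2 l3 w n1 n2 n3 : real_tensor l1 l2 l3 w n1 n2 n3 =
  msum l1 (fun m1 => msum l2 (fun m2 => msum l3 (fun m3 =>
    (w m1 m2 m3)%:C * basis_coef m1 n1 * basis_coef m2 n2 * basis_coef m3 n3))).
Proof.
rewrite /real_tensor /msum.
transitivity (\sum_(i3 < l3.*2.+1) \sum_(i2 < l2.*2.+1) \sum_(i1 < l1.*2.+1)
    ((w (order_of i1) (order_of i2) (order_of i3))%:C * basis_coef (order_of i1) n1
     * basis_coef (order_of i2) n2 * basis_coef (order_of i3) n3)).
  apply: eq_bigr => i3 _; rewrite mulr_suml; apply: eq_bigr => i2 _.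
  by rewrite !mulr_suml.
under eq_bigr do rewrite exchange_big.
by rewrite exchange_big; apply: eq_bigr => i1 _; rewrite exchange_big.
Qed.

Lemma real_tensor_swap12 l1 l2 l3 w n1 n2 n3 :
  real_tensor l2 l1 l3 (fun m1 m2 m3 => w m2 m1 m3) n2 n1 n3
    = real_tensor l1 l2 l3 w n1 n2 n3.
Proof.
rewrite !real_tensorE /msum exchange_big; do 3 (apply: eq_bigr => ? _); ring.
Qed.

Lemma real_tensor_swap23 l1 l2 l3 w n1 n2 n3 :
  real_tensor l1 l3 l2 (fun m1 m2 m3 => w m1 m3 m2) n1 n3 n2
    = real_tensor l1 l2 l3 w n1 n2 n3.
Proof.
rewrite !real_tensorE /msum; apply: eq_bigr => ? _; rewrite exchange_big.
do 2 (apply: eq_bigr => ? _); ring.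
Qed.

Lemma conjc_real (x : R) : conjc x%:C = x%:C.
Proof. by rewrite /= oppr0. Qed.

Lemma conjcM (x y : R[i]) : conjc (x * y) = conjc x * conjc y.
Proof. exact: rmorphM. Qed.

Lemma conjc_msum l (f : int -> R[i]) : conjc (msum l f) = msum l (fun m => conjc (f m)).
Proof. exact: rmorph_sum. Qed.

(** Conjugation changes the sign of all the orders and multiplies by
    (-1)^(m1 + m2 + m3), which is 1 on the support of w. *)
Lemma real_tensor_conj l1 l2 l3 w n1 n2 n3 : unit_invariant l1 l2 l3 w ->
  conjc (real_tensor l1 l2 l3 w n1 n2 n3) = real_tensor l1 l2 l3 w n1 n2 n3.
Proof.
case=> iw _ ow; rewrite !real_tensorE conjc_msum -[RHS]msum_opp.
apply: eq_msum => m1 _; rewrite conjc_msum -[RHS]msum_opp.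
apply: eq_msum => m2 _; rewrite conjc_msum -[RHS]msum_opp.
apply: eq_msum => m3 _; rewrite ow !conjcM conjc_real !basis_coef_conj.
have [->|/(inv_supp iw)[s _ _ _]] := eqVneq (w m1 m2 m3) 0.
  by rewrite rmorph0 !mul0r.
have sg : (-1) ^+ `|m1|%N * (-1) ^+ `|m2|%N * (-1) ^+ `|m3|%N = 1 :> R[i].
  rewrite -!exprD -signr_odd (_ : odd _ = false)//.
  by rewrite !oddD; move: s; lia.
transitivity ((-1) ^+ `|m1|%N * (-1) ^+ `|m2|%N * (-1) ^+ `|m3|%N *
   ((w m1 m2 m3)%:C * basis_coef (- m1) n1 * basis_coef (- m2) n2 * basis_coef (- m3) n3)).
  by ring.
by rewrite sg mul1r.
Qed.

Lemma real_tensor_real l1 l2 l3 w n1 n2 n3 : unit_invariant l1 l2 l3 w ->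
  real_tensor l1 l2 l3 w n1 n2 n3 = (complex.Re (real_tensor l1 l2 l3 w n1 n2 n3))%:C.
Proof.
move=> uw; have := real_tensor_conj n1 n2 n3 uw.
case: (real_tensor _ _ _ _ _ _ _) => x y /= [] /eqP.
by rewrite eqNr => /eqP ->.
Qed.

Lemma real_tensor_gram l1 l2 l3 w n n' : unit_invariant l1 l2 l3 w ->
  `|n| <= l1%:Z -> `|n'| <= l1%:Z ->
  msum l2 (fun n2 => msum l3 (fun n3 =>
    complex.Re (real_tensor l1 l2 l3 w n n2 n3)
    * complex.Re (real_tensor l1 l2 l3 w n' n2 n3)))
  = (n == n')%:R / (l1.*2.+1)%:R.
Proof.
move=> uw nl n'l; apply: (@complexI R).
transitivity (msum l2 (fun n2 => msum l3 (fun n3 =>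
    real_tensor l1 l2 l3 w n n2 n3 * conjc (real_tensor l1 l2 l3 w n' n2 n3)))).
  rewrite /msum rmorph_sum; apply: eq_bigr => i _.
  rewrite rmorph_sum; apply: eq_bigr => j _ /=.
  by rewrite real_tensor_conj// rmorphM /= -!real_tensor_real.
under eq_msum do rewrite parseval.
pose B n m2 m3 := msum l1 (fun m1 => (w m1 m2 m3)%:C * basis_coef m1 n).
transitivity (msum l3 (fun m3 => msum l2 (fun n2 =>
   msum l2 (fun m2 => B n m2 m3 * basis_coef m2 n2) *
   conjc (msum l2 (fun m2 => B n' m2 m3 * basis_coef m2 n2))))).
  exact: exchange_big.
under eq_msum do rewrite parseval.
transitivity (msum l1 (fun m => msum l1 (fun m' =>
   basis_coef m n * conjc (basis_coef m' n') * (gram l2 l3 w m m')%:C))).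
  rewrite /msum; transitivity (\sum_(i3 < l3.*2.+1) \sum_(i2 < l2.*2.+1)
     \sum_(i < l1.*2.+1) \sum_(i' < l1.*2.+1)
      basis_coef (order_of i) n * conjc (basis_coef (order_of i') n') *
      (w (order_of i) (order_of i2) (order_of i3)
       * w (order_of i') (order_of i2) (order_of i3))%:C).
    apply: eq_bigr => i3 _; apply: eq_bigr => i2 _; rewrite conjc_msum /msum mulr_suml.
    apply: eq_bigr => i _; rewrite mulr_sumr; apply: eq_bigr => i' _.
    by rewrite conjcM conjc_real rmorphM /=; ring.
  rewrite exchange_big; under eq_bigr do rewrite exchange_big.
  under eq_bigr do under eq_bigr do rewrite exchange_big.
  rewrite exchange_big; apply: eq_bigr => i _.
  rewrite exchange_big; apply: eq_bigr => i' _.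
  rewrite /gram /msum rmorph_sum mulr_sumr; apply: eq_bigr => i2 _.
  by rewrite rmorph_sum mulr_sumr.
transitivity (msum l1 (fun m => basis_coef m n * conjc (basis_coef m n')
     * ((l1.*2.+1)%:R^-1)%:C)); last first.
  by rewrite -[LHS]/(\sum_(i < l1.*2.+1) _) -mulr_suml
    -[X in X * _]/(msum l1 (fun m => basis_coef m n * conjc (basis_coef m n')))
    basis_cols// rmorphM /= rmorph_nat.
  apply: eq_msum => m ml.
  under eq_msum => m' _ do rewrite (gramE _ (unit_inv uw) (unit_norm uw) ml).
  rewrite (msum_single (m := m))// ?eqxx ?mul1r// => m' m'm.
  by rewrite eq_sym (negPf m'm) mul0r rmorph0 mulr0.
Qed.

(** In the real basis the invariant bilinear form is the standard one, because
    conj(basis_coef m) is (-1)^m basis_coef (-m). *)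
Lemma real_tensor_trace l1 l w n1 : unit_invariant l1 l l w -> (0 < l1)%N ->
  msum l (fun n => real_tensor l1 l l w n1 n n) = 0.
Proof.
move=> uw l1_gt0.
transitivity (msum l1 (fun m1 => msum l (fun m2 => msum l (fun m3 =>
    (w m1 m2 m3)%:C * basis_coef m1 n1 *
      ((-1) ^+ `|m2|%N * msum l (fun n => basis_coef m3 n * conjc (basis_coef (- m2) n))))))).
  under eq_msum do rewrite real_tensorE.
  rewrite /msum exchange_big; apply: eq_bigr => i1 _.
  rewrite exchange_big; apply: eq_bigr => i2 _.
  rewrite exchange_big; apply: eq_bigr => i3 _.
  rewrite !mulr_sumr; apply: eq_bigr => j _.
  by rewrite (basis_coef_flip (order_of i2)); ring.
apply: msum0 => m1.
transitivity (basis_coef m1 n1 * (msum l (fun m => (-1) ^ m * w m1 m (- m)))%:C); last first.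
  by rewrite (invariant_trace _ (unit_inv uw)) ?rmorph0 ?mulr0.
transitivity (msum l (fun m => basis_coef m1 n1 * ((-1) ^ m * w m1 m (- m))%:C)); last first.
  by rewrite /msum rmorph_sum mulr_sumr.
apply: eq_msum => m2 m2l.
rewrite (eq_msum (g := fun m3 => (w m1 m2 m3)%:C * basis_coef m1 n1 *
      ((-1) ^+ `|m2|%N * (m3 == - m2)%:R))); last first.
  by move=> m3 m3l; rewrite basis_rows// normrN.
rewrite (msum_single (m := - m2)) ?normrN//; last first.
  by move=> m3 /negPf ->; rewrite !mulr0.
rewrite eqxx mulr1 rmorphM /=.
have -> : ((-1) ^ m2)%:C = (-1) ^+ `|m2|%N :> R[i].
  have -> : (-1) ^ m2 = (-1) ^+ `|m2|%N :> R.
    case: m2 {m2l} => n; first by rewrite -exprnP.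
    by rewrite NegzE signz_opp -exprnP abszN.
  by rewrite rmorphXn rmorphN1.
ring.
Qed.

End RealBasis.

(** * Symmetric traceless tensors of the bispectrum *)

Section SpinTensor.
Variables (R : realType) (L : nat).
Local Notation J := ('I_L.+1 * 'I_(L.*2.+1))%type.
Implicit Types (i j k : J) (l : nat) (w : int -> int -> int -> R).

Definition spin j : nat := j.1.
Definition order j : int := order_of j.2.
Definition in_spin l j := (spin j == l) && (`|order j| <= l%:Z).

Lemma order_inj i j : spin i = spin j -> order i = order j -> i = j.
Proof.
case: i j => [a b] [a' b'] /= h h'.
rewrite (val_inj h : a = a'); congr pair; apply: val_inj => /=.
by move: h'; rewrite /order /order_of /=; lia.
Qed.

Lemma sum_in_spin (M : nmodType) l (F : int -> M) : (l <= L)%N ->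
  \sum_j (if in_spin l j then F (order j) else 0) = msum l F.
Proof.
move=> lL; have lL' : (l < L.+1)%N by [].
rewrite -(pair_bigA _ (fun a b => if in_spin l (a, b) then F (order (a, b)) else 0)) /=.
rewrite (sum_single (i := Ordinal lL')); last first.
  move=> a al; rewrite big1// => b _; rewrite /in_spin /spin /= ifF//.
  apply/negP => /andP[/eqP al' _]; move/eqP: al; apply; exact: val_inj.
transitivity (msum L (fun m => if `|m| <= l%:Z then F m else 0)).
  by apply: eq_bigr => b _; rewrite /in_spin /spin /order /= eqxx.
rewrite (msum_widen lL); last by move=> m ml; rewrite ifF//; lia.
by apply: eq_msum => m ->.
Qed.

(** The tensor is extended by zero to a common index set for all the degrees up
    to L; an index carries a degree (its spin) and an order. *)
Definition spin_tensor l1 l2 l3 w i j k : R :=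
  if in_spin l1 i && in_spin l2 j && in_spin l3 k then
    complex.Re (real_tensor l1 l2 l3 w (order i) (order j) (order k)) else 0.

Lemma spin_tensor_swap12 l1 l2 l3 w i j k :
  spin_tensor l2 l1 l3 (fun m1 m2 m3 => w m2 m1 m3) j i k = spin_tensor l1 l2 l3 w i j k.
Proof. by rewrite /spin_tensor real_tensor_swap12 [in_spin l2 j && _]andbC. Qed.

Lemma spin_tensor_swap23 l1 l2 l3 w i j k :
  spin_tensor l1 l3 l2 (fun m1 m2 m3 => w m1 m3 m2) i k j = spin_tensor l1 l2 l3 w i j k.
Proof. by rewrite /spin_tensor real_tensor_swap23 andbAC. Qed.

Lemma sum_spin_tensor2 (M : nmodType) l2 l3 (F : int -> int -> M) (b : bool) :
  (l2 <= L)%N -> (l3 <= L)%N ->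
  \sum_j \sum_k (if b && in_spin l2 j && in_spin l3 k then F (order j) (order k) else 0)
   = if b then msum l2 (fun n2 => msum l3 (F n2)) else 0.
Proof.
move=> l2L l3L; case: b => /=; last by rewrite big1// => j _; rewrite big1.
rewrite -(sum_in_spin _ l2L); apply: eq_bigr => j _; case: ifP => _ /=.
  exact: (sum_in_spin _ l3L).
by rewrite big1.
Qed.

Lemma spin_tensor_gram l1 l2 l3 w i i' : unit_invariant l1 l2 l3 w ->
  (l2 <= L)%N -> (l3 <= L)%N ->
  \sum_j \sum_k spin_tensor l1 l2 l3 w i j k * spin_tensor l1 l2 l3 w i' j k
    = if i == i' then (in_spin l1 i)%:R / (l1.*2.+1)%:R else 0.
Proof.
move=> uw l2L l3L.
pose F n2 n3 := complex.Re (real_tensor l1 l2 l3 w (order i) n2 n3)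
   * complex.Re (real_tensor l1 l2 l3 w (order i') n2 n3).
transitivity (\sum_j \sum_k (if (in_spin l1 i && in_spin l1 i') && in_spin l2 j && in_spin l3 k
   then F (order j) (order k) else 0)).
  apply: eq_bigr => j _; apply: eq_bigr => k _; rewrite /spin_tensor /F.
  by do 4 case: in_spin; rewrite /= ?mul0r ?mulr0.
rewrite sum_spin_tensor2//; rewrite /F; have [ii'|ii'] := eqVneq i i'.
  rewrite -ii' andbb; case: ifP => [/andP[_ il]|_]; last by rewrite mul0r.
  by rewrite (real_tensor_gram uw) ?eqxx.
case: ifP => // /andP[/andP[/eqP s1 o1] /andP[/eqP s2 o2]].
rewrite (real_tensor_gram uw)// (_ : _ == _ = false) ?mul0r//.
apply/negP => /eqP oo; move/eqP: ii'; apply; apply: order_inj => //.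
by rewrite s1.
Qed.

Definition has_gain (eps : R) (T : J -> J -> J -> R) := forall t : J -> R,
  \sum_j \sum_k (\sum_i t i * T i j k) ^+ 2 <= eps * \sum_i t i ^+ 2.

(** The squared norm of the contraction is the Gram matrix of the first leg
    evaluated at t, and this matrix is a projection divided by 2 l1 + 1. *)
Lemma spin_tensor_gain eps l1 l2 l3 w : unit_invariant l1 l2 l3 w ->
  (l2 <= L)%N -> (l3 <= L)%N -> (l1.*2.+1)%:R^-1 <= eps ->
  has_gain eps (spin_tensor l1 l2 l3 w).
Proof.
move=> uw l2L l3L le t; set T := spin_tensor _ _ _ _.
have -> : \sum_j \sum_k (\sum_i t i * T i j k) ^+ 2
    = \sum_i \sum_i' t i * t i' * \sum_j \sum_k T i j k * T i' j k.
  transitivity (\sum_j \sum_k \sum_i \sum_i' t i * t i' * (T i j k * T i' j k)).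
    apply: eq_bigr => j _; apply: eq_bigr => k _; rewrite expr2 mulr_suml.
    by apply: eq_bigr => i _; rewrite mulr_sumr; apply: eq_bigr => i' _; rewrite mulrACA.
  under eq_bigr do rewrite exchange_big.
  rewrite exchange_big; apply: eq_bigr => i _.
  under eq_bigr do rewrite exchange_big.
  rewrite exchange_big; apply: eq_bigr => i' _.
  by rewrite mulr_sumr; apply: eq_bigr => j _; rewrite mulr_sumr.
rewrite mulr_sumr; apply: ler_sum => i _.
rewrite (sum_single (i := i)) => [|i' ii']; last first.
  by rewrite (spin_tensor_gram _ _ uw)// eq_sym (negPf ii') mulr0.
rewrite (spin_tensor_gram _ _ uw)// eqxx -expr2 mulrC ler_wpM2r ?sqr_ge0//.
by apply: le_trans le; case: in_spin; rewrite ?mul1r// mul0r invr_ge0 ler0n.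
Qed.

Lemma spin_tensor_norm l1 l2 l3 w : unit_invariant l1 l2 l3 w ->
  (l1 <= L)%N -> (l2 <= L)%N -> (l3 <= L)%N ->
  \sum_i \sum_j \sum_k spin_tensor l1 l2 l3 w i j k ^+ 2 = 1.
Proof.
move=> uw l1L l2L l3L.
under eq_bigr do under eq_bigr do under eq_bigr do rewrite expr2.
under eq_bigr do rewrite (spin_tensor_gram _ _ uw)// eqxx.
rewrite -mulr_suml; have := @sum_in_spin R l1 (fun _ => 1) l1L.
have -> : \sum_j (if in_spin l1 j then 1 else 0) = \sum_j (in_spin l1 j)%:R :> R.
  by apply: eq_bigr => j _; case: in_spin.
by move=> ->; rewrite /msum sumr_const card_ord mulfV// pnatr_eq0.
Qed.

Lemma spin_tensor_trace l1 l2 l3 w i : unit_invariant l1 l2 l3 w ->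
  (l2 <= L)%N -> (0 < l1)%N -> \sum_j spin_tensor l1 l2 l3 w i j j = 0.
Proof.
move=> uw l2L l1_gt0; have [l23|l23] := eqVneq l2 l3; last first.
  rewrite big1// => j _; rewrite /spin_tensor; case: ifP => // /andP[/andP[_]].
  by move=> /andP[/eqP h2 _] /andP[/eqP h3 _]; rewrite -h2 -h3 eqxx in l23.
case: l3 / l23 uw => uw; rewrite /spin_tensor.
case: (in_spin l1 i) => /=; last by rewrite big1.
under eq_bigr do rewrite andbb.
rewrite (sum_in_spin (fun n => complex.Re (real_tensor l1 l2 l2 w (order i) n n)))//.
apply: (@complexI R); rewrite -[RHS](real_tensor_trace (order i) uw l1_gt0).
rewrite /msum rmorph_sum; apply: eq_bigr => n _ /=.
by rewrite -real_tensor_real.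
Qed.

Definition symmetrize (T : J -> J -> J -> R) i j k : R :=
  6^-1 * (T i j k + T i k j + T j i k + T j k i + T k i j + T k j i).

Lemma symmetrize12 T i j k : symmetrize T i j k = symmetrize T j i k.
Proof. by rewrite /symmetrize; ring. Qed.
Lemma symmetrize23 T i j k : symmetrize T i j k = symmetrize T i k j.
Proof. by rewrite /symmetrize; ring. Qed.

(** Convexity of the square, so that symmetrization preserves the gain. *)
Lemma sqr_mean6 (a b c d e f : R) : (6^-1 * (a + b + c + d + e + f)) ^+ 2
  <= 6^-1 * (a ^+ 2 + b ^+ 2 + c ^+ 2 + d ^+ 2 + e ^+ 2 + f ^+ 2).
Proof.
have key : (a + b + c + d + e + f) ^+ 2
   <= 6 * (a ^+ 2 + b ^+ 2 + c ^+ 2 + d ^+ 2 + e ^+ 2 + f ^+ 2).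
  rewrite -subr_ge0.
  have -> : 6 * (a ^+ 2 + b ^+ 2 + c ^+ 2 + d ^+ 2 + e ^+ 2 + f ^+ 2) - (a + b + c + d + e + f) ^+ 2
    = (a - b) ^+ 2 + (a - c) ^+ 2 + (a - d) ^+ 2 + (a - e) ^+ 2 + (a - f) ^+ 2
    + (b - c) ^+ 2 + (b - d) ^+ 2 + (b - e) ^+ 2 + (b - f) ^+ 2 + (c - d) ^+ 2
    + (c - e) ^+ 2 + (c - f) ^+ 2 + (d - e) ^+ 2 + (d - f) ^+ 2 + (e - f) ^+ 2 by ring.
  by repeat apply: addr_ge0; exact: sqr_ge0.
rewrite exprMn expr2 -mulrA; apply: ler_wpM2l; first by rewrite invr_ge0 ler0n.
by rewrite ler_pdivrMl ?ltr0n.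
Qed.

Definition perm23 w m1 m2 m3 := w m1 m3 m2.
Definition perm12 w m1 m2 m3 := w m2 m1 m3.

(** A permuted spin tensor is the spin tensor of the permuted triple, so that
    bounds along the first leg apply to every leg. *)
Lemma spin_tensor_perms l1 l2 l3 w i j k : let T := spin_tensor l1 l2 l3 w in
  [/\ T i k j = spin_tensor l1 l3 l2 (perm23 w) i j k,
      T j i k = spin_tensor l2 l1 l3 (perm12 w) i j k,
      T j k i = spin_tensor l3 l1 l2 (perm12 (perm23 w)) i j k,
      T k i j = spin_tensor l2 l3 l1 (perm23 (perm12 w)) i j k &
      T k j i = spin_tensor l3 l2 l1 (perm23 (perm12 (perm23 w))) i j k].
Proof.
move=> T; rewrite /T; split.
- by rewrite -spin_tensor_swap23.
- by rewrite -spin_tensor_swap12.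
- by rewrite -spin_tensor_swap23 -spin_tensor_swap12.
- by rewrite -spin_tensor_swap12 -spin_tensor_swap23.
- by rewrite -spin_tensor_swap23 -spin_tensor_swap12 -spin_tensor_swap23.
Qed.

Section Symmetrized.
Variables (l1 l2 l3 : nat) (w : int -> int -> int -> R) (eps : R).
Hypothesis uw : unit_invariant l1 l2 l3 w.
Hypotheses (l1L : (l1 <= L)%N) (l2L : (l2 <= L)%N) (l3L : (l3 <= L)%N).
Hypotheses (l1_gt0 : (0 < l1)%N) (l2_gt0 : (0 < l2)%N) (l3_gt0 : (0 < l3)%N).
Let T := spin_tensor l1 l2 l3 w.

Let uw23 := unit_invariant_swap23 uw.
Let uw12 := unit_invariant_swap12 uw.
Let uw1223 := unit_invariant_swap12 uw23.
Let uw2312 := unit_invariant_swap23 uw12.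
Let uw232312 := unit_invariant_swap23 uw1223.

Lemma symmetrize_trace k : \sum_i symmetrize T i i k = 0.
Proof.
have h1 : \sum_i T i i k = 0.
  apply: etrans (spin_tensor_trace k uw1223 l1L l3_gt0); apply: eq_bigr => i _.
  by have [_ _ h _ _] := spin_tensor_perms l1 l2 l3 w k i i; exact: h.
have h2 : \sum_i T i k i = 0.
  apply: etrans (spin_tensor_trace k uw12 l1L l2_gt0); apply: eq_bigr => i _.
  by have [_ h _ _ _] := spin_tensor_perms l1 l2 l3 w k i i; exact: h.
have h3 : \sum_i T k i i = 0 by exact: (spin_tensor_trace k uw l2L l1_gt0).
rewrite /symmetrize -mulr_sumr !big_split /=.
by rewrite h1 h2 h3 !addr0 mulr0.
Qed.

Lemma symmetrize_gain : (l1.*2.+1)%:R^-1 <= eps -> (l2.*2.+1)%:R^-1 <= eps ->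
  (l3.*2.+1)%:R^-1 <= eps -> has_gain eps (symmetrize T).
Proof.
move=> e1 e2 e3 t.
set n2 := \sum_i t i ^+ 2.
pose c (U : J -> J -> J -> R) j k := \sum_i t i * U i j k.
have split6 j k : \sum_i t i * symmetrize T i j k = 6^-1 *
  (c T j k + c (spin_tensor l1 l3 l2 (perm23 w)) j k
   + c (spin_tensor l2 l1 l3 (perm12 w)) j k
   + c (spin_tensor l3 l1 l2 (perm12 (perm23 w))) j k
   + c (spin_tensor l2 l3 l1 (perm23 (perm12 w))) j k
   + c (spin_tensor l3 l2 l1 (perm23 (perm12 (perm23 w)))) j k).
  rewrite /c -!big_split mulr_sumr; apply: eq_bigr => i _ /=.
  have [p1 p2 p3 p4 p5] := spin_tensor_perms l1 l2 l3 w i j k.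
  by rewrite /symmetrize /T p1 p2 p3 p4 p5; ring.
under eq_bigr do under eq_bigr do rewrite split6.
apply: (@le_trans _ _ (\sum_j \sum_k 6^-1 *
  (c T j k ^+ 2 + c (spin_tensor l1 l3 l2 (perm23 w)) j k ^+ 2
   + c (spin_tensor l2 l1 l3 (perm12 w)) j k ^+ 2
   + c (spin_tensor l3 l1 l2 (perm12 (perm23 w))) j k ^+ 2
   + c (spin_tensor l2 l3 l1 (perm23 (perm12 w))) j k ^+ 2
   + c (spin_tensor l3 l2 l1 (perm23 (perm12 (perm23 w)))) j k ^+ 2))).
  by apply: ler_sum => j _; apply: ler_sum => k _; exact: sqr_mean6.
under eq_bigr do rewrite -mulr_sumr !big_split /=.
rewrite -mulr_sumr !big_split /= /c.
have := @spin_tensor_gain eps _ _ _ _ uw l2L l3L e1 t.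
have := @spin_tensor_gain eps _ _ _ _ uw23 l3L l2L e1 t.
have := @spin_tensor_gain eps _ _ _ _ uw12 l1L l3L e2 t.
have := @spin_tensor_gain eps _ _ _ _ uw1223 l1L l2L e3 t.
have := @spin_tensor_gain eps _ _ _ _ uw2312 l3L l1L e2 t.
have := @spin_tensor_gain eps _ _ _ _ uw232312 l2L l1L e3 t.
rewrite -/n2 -/(perm23 _) -/(perm12 _) => g6 g5 g4 g3 g2 g1.
rewrite ler_pdivrMl ?ltr0n//; move: g1 g2 g3 g4 g5 g6; rewrite /perm23 /perm12 /T.
lra.
Qed.

End Symmetrized.

(** The indices carrying a coefficient of the field: degree zero is excluded. *)
Definition valid_index j := (0 < spin j)%N && (`|order j| <= (spin j)%:Z).

Lemma in_spin_valid l j : (0 < l)%N -> in_spin l j -> valid_index j.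
Proof. by move=> l0 /andP[/eqP sj oj]; rewrite /valid_index sj l0. Qed.

Lemma symmetrize_valid l1 l2 l3 w i j k :
  (0 < l1)%N -> (0 < l2)%N -> (0 < l3)%N ->
  symmetrize (spin_tensor l1 l2 l3 w) i j k != 0 -> valid_index i.
Proof.
move=> h1 h2 h3; apply: contraNT => nv.
have out l : (0 < l)%N -> in_spin l i = false.
  by move=> l0; apply: contraNF nv; exact: in_spin_valid.
by rewrite /symmetrize /spin_tensor !out// !andbF /= !addr0 mulr0.
Qed.

(** Pairing with a symmetric tensor does not see the symmetrization. *)
Lemma dot_symmetrize (T H : J -> J -> J -> R) :
  (forall i j k, H i j k = H j i k) -> (forall i j k, H i j k = H i k j) ->
  \sum_i \sum_j \sum_k symmetrize T i j k * H i j k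
    = \sum_i \sum_j \sum_k T i j k * H i j k.
Proof.
move=> h12 h23; set D := RHS.
have d1 : \sum_i \sum_j \sum_k T i k j * H i j k = D.
  apply: eq_bigr => i _; rewrite exchange_big.
  by apply: eq_bigr => j _; apply: eq_bigr => k _; rewrite h23.
have d2 : \sum_i \sum_j \sum_k T j i k * H i j k = D.
  rewrite exchange_big; apply: eq_bigr => i _; apply: eq_bigr => j _.
  by apply: eq_bigr => k _; rewrite h12.
have d3 : \sum_i \sum_j \sum_k T j k i * H i j k = D.
  rewrite exchange_big; apply: eq_bigr => i _; rewrite exchange_big.
  by apply: eq_bigr => j _; apply: eq_bigr => k _; rewrite h12 h23.
have d4 : \sum_i \sum_j \sum_k T k i j * H i j k = D.
  under eq_bigr do rewrite exchange_big.
  rewrite exchange_big; apply: eq_bigr => i _.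
  by apply: eq_bigr => j _; apply: eq_bigr => k _; rewrite h23 h12.
have d5 : \sum_i \sum_j \sum_k T k j i * H i j k = D.
  rewrite exchange_sum3; apply: eq_bigr => i _; apply: eq_bigr => j _.
  by apply: eq_bigr => k _; rewrite h12 h23 h12.
transitivity (6^-1 * (D + D + D + D + D + D)); last by field.
rewrite -{2}d1 -{2}d2 -{2}d3 -{2}d4 -{2}d5 /D -!big_split mulr_sumr.
apply: eq_bigr => i _; rewrite -!big_split mulr_sumr.
apply: eq_bigr => j _; rewrite -!big_split mulr_sumr.
by apply: eq_bigr => k _ /=; rewrite /symmetrize; ring.
Qed.

Section WignerTensor.

Definition ordered_admissible (l1 l2 l3 : nat) :=
  [&& admissible l1 l2 l3, (l1 <= l2)%N, (l2 <= l3)%N & (l3 <= L)%N].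

Lemma wigner_unit l1 l2 l3 : ordered_admissible l1 l2 l3 ->
  unit_invariant l1 l2 l3 (wigner3j R l1 l2 l3).
Proof.
case/and4P => /and5P[_ _ _ h1 /and3P[h2 h3 even]] _ _ _.
have tri : (l1 <= l2 + l3)%N /\ (l2 <= l1 + l3)%N /\ (l3 <= l1 + l2)%N by [].
split; [exact: wigner_invariant|exact: wigner_tensor_norm|].
by move=> m1 m2 m3; exact: wigner_opp.
Qed.

Definition wigner_tensor (l1 l2 l3 : nat) := spin_tensor l1 l2 l3 (wigner3j R l1 l2 l3).

Lemma real_tensor_ext l1 l2 l3 w w' n1 n2 n3 :
  (forall m1 m2 m3, w m1 m2 m3 = w' m1 m2 m3) ->
  real_tensor l1 l2 l3 w n1 n2 n3 = real_tensor l1 l2 l3 w' n1 n2 n3.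
Proof.
by move=> e; rewrite !real_tensorE; do 3 (apply: eq_msum => ? _); rewrite e.
Qed.

Lemma wigner_tensor_spin l1 l2 l3 i j k : wigner_tensor l1 l2 l3 i j k != 0 ->
  [/\ spin i = l1, spin j = l2 & spin k = l3].
Proof.
rewrite /wigner_tensor /spin_tensor; case: ifP; last by rewrite eqxx.
by case/andP => /andP[/andP[/eqP ? _] /andP[/eqP ? _]] /andP[/eqP ? _].
Qed.

Lemma wigner_tensor_swap12 l1 l3 i j k : ordered_admissible l1 l1 l3 ->
  wigner_tensor l1 l1 l3 j i k = wigner_tensor l1 l1 l3 i j k.
Proof.
case/and4P => /and5P[_ _ _ h1 /and3P[h2 h3 even]] _ _ _.
have tri : (l1 <= l1 + l3)%N /\ (l1 <= l1 + l3)%N /\ (l3 <= l1 + l1)%N by [].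
rewrite /wigner_tensor -spin_tensor_swap12 /spin_tensor.
case: ifP => // _; congr complex.Re; apply: real_tensor_ext => m1 m2 m3.
exact: wigner_swap12.
Qed.

Lemma wigner_tensor_swap23 l1 l2 i j k : ordered_admissible l1 l2 l2 ->
  wigner_tensor l1 l2 l2 i k j = wigner_tensor l1 l2 l2 i j k.
Proof.
case/and4P => /and5P[_ _ _ h1 /and3P[h2 h3 even]] _ _ _.
have tri : (l1 <= l2 + l2)%N /\ (l2 <= l1 + l2)%N /\ (l2 <= l1 + l2)%N by [].
rewrite /wigner_tensor -spin_tensor_swap23 /spin_tensor.
case: ifP => // _; congr complex.Re; apply: real_tensor_ext => m1 m2 m3.
exact: wigner_swap23.
Qed.

Lemma wigner_tensor_mismatch l1 l2 l3 i j k :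
  [\/ spin i <> l1, spin j <> l2 | spin k <> l3] -> wigner_tensor l1 l2 l3 i j k = 0.
Proof.
move=> h; apply/eqP/negP => /negP /wigner_tensor_spin[? ? ?].
by case: h.
Qed.

Lemma symmetric_perms (W : J -> J -> J -> R) i j k :
  (forall i j k, W j i k = W i j k) -> (forall i j k, W i k j = W i j k) ->
  [/\ W i k j = W i j k, W j i k = W i j k, W j k i = W i j k,
      W k i j = W i j k & W k j i = W i j k].
Proof.
move=> s12 s23; split=> //.
- by rewrite (s23 j i k) (s12 i j k).
- by rewrite (s12 i k j) (s23 i j k).
- by rewrite (s12 j k i) (s23 j i k) (s12 i j k).
Qed.

(** Among the six permuted copies in the symmetrization, those which preserve
    the triple of degrees equal the tensor itself, by the symmetry of the 3j
    symbol under exchange of equal columns, and the others have disjoint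
    support. There are Delta of the former. *)
Lemma wigner_tensor_mul_sym l1 l2 l3 i j k : ordered_admissible l1 l2 l3 ->
  wigner_tensor l1 l2 l3 i j k * symmetrize (wigner_tensor l1 l2 l3) i j k
    = 6^-1 * (bisp_Delta l1 l2 l3)%:R * wigner_tensor l1 l2 l3 i j k ^+ 2.
Proof.
move=> oa; set T := wigner_tensor l1 l2 l3.
have [->|/wigner_tensor_spin[si sj sk]] := eqVneq (T i j k) 0.
  by rewrite mul0r expr0n mulr0.
case/and4P: (oa) => _ l12 l23 _; rewrite /symmetrize /bisp_Delta.
have [e12|n12] := eqVneq l1 l2; have [e23|n23] := eqVneq l2 l3.
- have e13 : l1 = l3 by rewrite e12.
  have [p1 p2 p3 p4 p5] : [/\ T i k j = T i j k, T j i k = T i j k, T j k i = T i j k,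
      T k i j = T i j k & T k j i = T i j k].
    apply: symmetric_perms => a b c; rewrite /T.
      by move: oa; rewrite -e13 -e12 => oa'; exact: wigner_tensor_swap12.
    by move: oa; rewrite -e13 -e12 => oa'; exact: wigner_tensor_swap23.
  by rewrite p1 p2 p3 p4 p5 e13 eqxx /=; field.
- have n13 : l1 <> l3 by rewrite e12; apply/eqP.
  have /eqP/negPf -> := n13.
  have p2 : T j i k = T i j k.
    by rewrite /T; move: oa; rewrite -e12 => oa'; exact: wigner_tensor_swap12.
  have p1 : T i k j = 0.
    by apply: wigner_tensor_mismatch; apply: Or33; rewrite sj; apply/eqP.
  have p3 : T j k i = 0.
    by apply: wigner_tensor_mismatch; apply: Or33; rewrite si.
  have p4 : T k i j = 0.
    by apply: wigner_tensor_mismatch; apply: Or33; rewrite sj; apply/eqP.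
  have p5 : T k j i = 0.
    by apply: wigner_tensor_mismatch; apply: Or33; rewrite si.
  by rewrite p1 p2 p3 p4 p5 /=; field.
- have n12' : l1 <> l2 by apply/eqP.
  have n13 : l1 <> l3 by rewrite -e23.
  have /eqP/negPf -> := n13.
  have p1 : T i k j = T i j k.
    by rewrite /T; move: oa; rewrite -e23 => oa'; exact: wigner_tensor_swap23.
  have p2 : T j i k = 0.
    by apply: wigner_tensor_mismatch; apply: Or32; rewrite si.
  have p3 : T j k i = 0.
    by apply: wigner_tensor_mismatch; apply: Or33; rewrite si.
  have p4 : T k i j = 0.
    by apply: wigner_tensor_mismatch; apply: Or32; rewrite si.
  have p5 : T k j i = 0.
    by apply: wigner_tensor_mismatch; apply: Or33; rewrite si.
  by rewrite p1 p2 p3 p4 p5 /=; field.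
- have n12' : l1 <> l2 by apply/eqP.
  have n23' : l2 <> l3 by apply/eqP.
  have n13 : l1 <> l3 by clear -l12 l23 n12' n23'; lia.
  have /eqP/negPf -> := n13.
  have p1 : T i k j = 0.
    by apply: wigner_tensor_mismatch; apply: Or33; rewrite sj.
  have p2 : T j i k = 0.
    by apply: wigner_tensor_mismatch; apply: Or32; rewrite si.
  have p3 : T j k i = 0.
    by apply: wigner_tensor_mismatch; apply: Or33; rewrite si.
  have p4 : T k i j = 0.
    by apply: wigner_tensor_mismatch; apply: Or32; rewrite si.
  have p5 : T k j i = 0.
    by apply: wigner_tensor_mismatch; apply: Or33; rewrite si.
  by rewrite p1 p2 p3 p4 p5 /=; field.
Qed.

(** Distinct ordered triples are not permutations of each other, so the supports
    are disjoint. *)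
Lemma wigner_tensor_mul_sym0 l1 l2 l3 l1' l2' l3' i j k :
  ordered_admissible l1 l2 l3 -> ordered_admissible l1' l2' l3' ->
  (l1, l2, l3) <> (l1', l2', l3') ->
  wigner_tensor l1 l2 l3 i j k * symmetrize (wigner_tensor l1' l2' l3') i j k = 0.
Proof.
move=> /and4P[_ h1 h2 _] /and4P[_ h3 h4 _] neq.
have [->|/wigner_tensor_spin[si sj sk]] := eqVneq (wigner_tensor l1 l2 l3 i j k) 0.
  by rewrite mul0r.
rewrite /symmetrize.
have z a b c : (spin a = l1' -> spin b = l2' -> spin c = l3' -> False) ->
    wigner_tensor l1' l2' l3' a b c = 0.
  by move=> h; apply/eqP/negP => /negP /wigner_tensor_spin[? ? ?]; exact: h.
rewrite !z ?addr0 ?mulr0// => e1 e2 e3; apply: neq; congr (_, _, _); lia.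
Qed.

Definition sym_tensor l1 l2 l3 := symmetrize (wigner_tensor l1 l2 l3).

Lemma sym_tensor_dot l1 l2 l3 : ordered_admissible l1 l2 l3 ->
  6 * (\sum_i \sum_j \sum_k sym_tensor l1 l2 l3 i j k * sym_tensor l1 l2 l3 i j k)
    = (bisp_Delta l1 l2 l3)%:R.
Proof.
move=> oa; rewrite dot_symmetrize; [|exact: symmetrize12|exact: symmetrize23].
under eq_bigr do under eq_bigr do under eq_bigr do rewrite wigner_tensor_mul_sym//.
under eq_bigr do under eq_bigr do rewrite -mulr_sumr.
under eq_bigr do rewrite -mulr_sumr.
case/and4P: (oa) => _ h1 h2 h3.
rewrite -mulr_sumr (spin_tensor_norm (wigner_unit oa)) ?mulr1//.
- by rewrite mulrA mulfV ?mul1r// pnatr_eq0.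
- exact: leq_trans h1 (leq_trans h2 h3).
- exact: leq_trans h2 h3.
Qed.

Lemma sym_tensor_dot0 l1 l2 l3 l1' l2' l3' :
  ordered_admissible l1 l2 l3 -> ordered_admissible l1' l2' l3' ->
  (l1, l2, l3) <> (l1', l2', l3') ->
  \sum_i \sum_j \sum_k sym_tensor l1 l2 l3 i j k * sym_tensor l1' l2' l3' i j k = 0.
Proof.
move=> oa oa' neq; rewrite dot_symmetrize; [|exact: symmetrize12|exact: symmetrize23].
rewrite big1// => i _; rewrite big1// => j _; rewrite big1// => k _.
exact: wigner_tensor_mul_sym0.
Qed.

End WignerTensor.
End SpinTensor.

(** * Moments of the normal law *)

Section NormalMoments.
Local Open Scope classical_set_scope.
Variables (R : realType) (s : R).
Hypothesis s_gt0 : 0 < s.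
Local Notation mu := (@lebesgue_measure R).
Local Notation pdf := (normal_pdf 0 s).

Lemma normal_pdfE0 x : pdf x = normal_peak s * expR (- (x ^+ 2 / (s ^+ 2 *+ 2))).
Proof.
by rewrite normal_pdfE ?gt_eqF// /normal_fun subr0 mulNr.
Qed.

Lemma is_derive_normal_pdf (x : R) : is_derive x 1 pdf (- (x / s ^+ 2) * pdf x).
Proof.
have -> : pdf = fun x => normal_peak s * expR (- (x ^+ 2 / (s ^+ 2 *+ 2))).
  by apply/funext => y; exact: normal_pdfE0.
have s2 : s != 0 by rewrite gt_eqF.
have d1 : is_derive x 1 (fun y : R => - (y ^+ 2 / (s ^+ 2 *+ 2))) (- (x / s ^+ 2)).
  apply: is_derive_eq; rewrite /GRing.scale /= -[s ^+ 2 *+ 2]mulr_natr.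
  by field.
have d2 := @is_derive1_comp R expR _ x _ _ _ d1.
apply: is_derive_eq; rewrite /GRing.scale /=; ring.
Qed.

Lemma continuous_normal_pdf0 : continuous pdf.
Proof. by apply: continuous_normal_pdf; rewrite gt_eqF. Qed.

Lemma derivable_everywhere_oo (F : R -> R) (a b : R) :
  (forall x, derivable F x 1) -> derivable_oo_LRcontinuous F a b.
Proof.
move=> dF; have cF x : {for x, continuous F}.
  by apply/differentiable_continuous/derivable1_diffP; exact: dF.
split; first by move=> x _; exact: dF.
- exact: cvg_at_right_filter (cF a).
- exact: cvg_at_left_filter (cF b).
Qed.

Lemma pow_le_fact_expR (y : R) k : 0 <= y -> y ^+ k <= k`!%:R * expR y.
Proof.
move=> y0; case: k => [|k].
  by rewrite expr0 fact0 mul1r; apply: le_trans (expR_ge1Dx y); rewrite lerDl.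
have := expR_ge1Dxn k y0.
rewrite -(ler_pM2l (_ : 0 < (k.+1)`!%:R)) ?ltr0n ?fact_gt0//; apply: le_trans.
rewrite mulrDr mulr1 mulrCA mulfV ?mulr1; first by rewrite lerDr ler0n.
by rewrite pnatr_eq0 -lt0n fact_gt0.
Qed.

(** Part of the Gaussian exponent absorbs the power: what remains is an integrable
    normal density, of standard deviation 2 s. *)
Lemma pow_normal_pdf_le k : exists2 c : R, 0 <= c &
  forall x, `|x| ^+ k * pdf x <= c * normal_pdf 0 (2 * s) x.
Proof.
have s2 : 2 * s != 0 by rewrite mulf_neq0 ?gt_eqF.
have p1 : 0 < normal_peak s by apply: normal_peak_gt0; rewrite gt_eqF.
have p2 : 0 < normal_peak (2 * s) by exact: normal_peak_gt0.
(* The exponents of the two densities differ by x^2 / q, as 1/2 - 1/8 = 3/8. *)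
pose q := 8 * s ^+ 2 / 3.
have q0 : 0 < q by rewrite divr_gt0 ?mulr_gt0 ?exprn_gt0.
exists ((1 + q ^+ k * k`!%:R) * (normal_peak s / normal_peak (2 * s))).
  by rewrite mulr_ge0 ?divr_ge0 ?addr_ge0 ?mulr_ge0 ?exprn_ge0 ?ler0n// ltW.
move=> x; rewrite normal_pdfE0 normal_pdfE// /normal_fun subr0.
pose y := x ^+ 2 / q.
have y0 : 0 <= y by rewrite divr_ge0 ?sqr_ge0// ltW.
have xk : `|x| ^+ k <= (1 + q ^+ k * k`!%:R) * expR y.
  have h1 : `|x| ^+ k <= 1 + (x ^+ 2) ^+ k.
    rewrite -real_normK ?num_real// -exprM mulnC exprM.
    by have := sqr_ge0 (`|x| ^+ k - 1); nra.
  have h2 : (x ^+ 2) ^+ k = q ^+ k * y ^+ k.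
    by rewrite -exprMn /y mulrCA mulfV ?mulr1// gt_eqF.
  apply: le_trans h1 _; rewrite h2 mulrDl mul1r; apply: lerD.
    by apply: le_trans (expR_ge1Dx y); rewrite lerDl.
  by rewrite -mulrA; apply: ler_wpM2l; [rewrite exprn_ge0// ltW|exact: pow_le_fact_expR].
apply: le_trans (ler_wpM2r _ xk) _.
  by rewrite mulr_ge0 ?expR_ge0 ?ltW.
rewrite le_eqVlt; apply/orP; left; apply/eqP.
have -> : expR (- x ^+ 2 / ((2 * s) ^+ 2 *+ 2))
  = expR y * expR (- (x ^+ 2 / (s ^+ 2 *+ 2))).
  rewrite -expRD /y /q; congr (expR _).
  rewrite -[(2 * s) ^+ 2 *+ 2]mulr_natr -[s ^+ 2 *+ 2]mulr_natr; field.
  by rewrite gt_eqF.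
field; by rewrite gt_eqF.
Qed.

Lemma integrable_pow_normal_pdf k :
  mu.-integrable setT (fun x : R => (x ^+ k * pdf x)%:E).
Proof.
have [c c0 le_c] := pow_normal_pdf_le k.
have s2 : 2 * s != 0 by rewrite mulf_neq0 ?gt_eqF.
apply: (@le_integrable _ _ _ mu setT _ _
   (fun x => c%:E * (normal_pdf 0 (2 * s) x)%:E)%E) => //.
- apply/measurable_EFinP; apply: measurable_funM.
    exact: measurable_funX.
  exact: measurable_normal_pdf.
- move=> x _ /=; rewrite lee_fin normrM normrX [X in _ * X]ger0_norm ?normal_pdf_ge0//.
  by rewrite [leRHS]ger0_norm// mulr_ge0// normal_pdf_ge0.
- by apply: integrableZl => //; exact: integrable_normal_pdf.
Qed.

Definition centered_itv (n : nat) : set R := `[- n%:R, n%:R].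

Lemma cvg_integral_itv (f : R -> \bar R) : mu.-integrable setT f ->
  (\int[mu]_(x in centered_itv n) f x)%E @[n --> \oo] --> (\int[mu]_x f x)%E.
Proof.
move=> intf.
have mf := measurable_int _ intf.
under eq_fun do rewrite integral_mkcond.
have [] // := @dominated_convergence _ _ _ mu setT measurableT
  (fun n : nat => f \_ (centered_itv n)) f (fun x => `|f x|%E).
- move=> n; apply/(measurable_restrictT f (measurable_itv _)).
  exact: measurable_funTS.
- apply: aeW => x _; apply: cvg_near_cst.
  near=> n; rewrite patchE ifT// inE /centered_itv /= in_itv /= -ler_norml.
  near: n; exact: nbhs_infty_ger.
- exact: integrable_abse.
- apply: aeW => x n _; rewrite patchE; case: ifP => //= _.
  by rewrite normr0 abse_ge0.
Unshelve. all: end_near. Qed.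

Lemma derive_pow (k : nat) (x : R) : is_derive x 1 (fun y : R => y ^+ k) (k%:R * x ^+ k.-1).
Proof.
split; first exact: exprn_derivable.
by rewrite exp_derive /GRing.scale /= mulr1.
Qed.

Lemma by_parts_normal_pdf k (n : nat) : (0 < n)%N ->
  (\int[mu]_(x in centered_itv n) (x ^+ k.+1 * pdf x)%:E
   = ((- n%:R) ^+ k * (s ^+ 2 * pdf (- n%:R)) - n%:R ^+ k * (s ^+ 2 * pdf n%:R))%:E
     + (k%:R * s ^+ 2)%:E * \int[mu]_(x in centered_itv n) (x ^+ k.-1 * pdf x)%:E)%E.
Proof.
move=> n0.
have s2 : s ^+ 2 != 0 by rewrite expf_neq0 ?gt_eqF.
pose G x := - s ^+ 2 * pdf x.
have dG (x : R) : is_derive x 1 G (x * pdf x).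
  have := is_derive_normal_pdf x => dpdf.
  by apply: is_derive_eq; rewrite /GRing.scale /=; field; rewrite gt_eqF.
have dF := derive_pow k.
have cpow j : continuous (fun x : R => x ^+ j)
  by move=> x; apply/differentiable_continuous/derivable1_diffP; exact: exprn_derivable.
have := @integration_by_parts R (fun x => x ^+ k) G (fun x => k%:R * x ^+ k.-1)
  (fun x => x * pdf x) (- n%:R) n%:R.
have nn : - n%:R < n%:R :> R by apply: (@lt_trans _ _ 0); rewrite ?oppr_lt0 ltr0n.
move=> /(_ nn) ibp.
have -> : (\int[mu]_(x in centered_itv n) (x ^+ k.+1 * pdf x)%:E
  = \int[mu]_(x in `[(- n%:R)%R, (n%:R)%R]) (x ^+ k * (x * pdf x))%:E)%E.
  by apply: eq_integral => x _; rewrite mulrA -exprSr.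
rewrite ibp; first last.
- by move=> x _; rewrite derive1E derive_val.
- by apply: derivable_everywhere_oo => x; exact: ex_derive.
- apply: continuous_subspaceT => x; apply: cvgM => //.
  exact: continuous_normal_pdf0.
- by move=> x _; rewrite derive1E derive_val.
- by apply: derivable_everywhere_oo => x; exact: ex_derive.
- apply: continuous_subspaceT => x; apply: cvgM; first exact: cvg_cst.
  exact: cpow.
have intk : mu.-integrable (centered_itv n) (fun x : R => (x ^+ k.-1 * pdf x)%:E).
  apply: (integrableS measurableT) => //; first exact: measurable_itv.
  exact: integrable_pow_normal_pdf.
have -> : (\int[mu]_(x in `[(- n%:R)%R, (n%:R)%R]) (k%:R * x ^+ k.-1 * G x)%:E
   = (- (k%:R * s ^+ 2))%:E * \int[mu]_(x in centered_itv n) (x ^+ k.-1 * pdf x)%:E)%E.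
  rewrite -integralZl//; last exact: measurable_itv.
  by apply: eq_integral => x _; rewrite -EFinM /G; congr EFin; ring.
rewrite EFinN mulNe oppeK; congr (_%:E + _)%E.
by rewrite /G; ring.
Qed.

(** Integration by parts on [-n, n], where x pdf is the derivative of
    - s^2 pdf; the boundary terms tend to zero. *)
Lemma normal_moment_rec k :
  (\int[mu]_x (x ^+ k.+1 * pdf x)%:E
    = (k%:R * s ^+ 2)%:E * \int[mu]_x (x ^+ k.-1 * pdf x)%:E)%E.
Proof.
have c1 := cvg_integral_itv (integrable_pow_normal_pdf k.+1).
have c2 := cvg_integral_itv (integrable_pow_normal_pdf k.-1).
have [c c0 le_c] := pow_normal_pdf_le k.+1.
pose b (n : nat) := (- n%:R) ^+ k * (s ^+ 2 * pdf (- n%:R)) - n%:R ^+ k * (s ^+ 2 * pdf n%:R).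
have b0 : (b n)%:E @[n --> \oo] --> 0%E.
  apply: cvg_EFin; first by apply: nearW.
  (* By the domination of the power k + 1, the boundary terms are at most C / n. *)
  pose C := 2 * s ^+ 2 * (c * normal_peak (2 * s)).
  apply/norm_cvg0P; apply: (@squeeze_cvgr _ _ _ _ (cst 0) (fun n => C * n.+1%:R^-1 * 2)).
  - near=> n; rewrite normr_ge0 /=.
    have n0 : (0 < n)%N by near: n; exact: nbhs_infty_gt.
    have n0' : 0 < n%:R :> R by rewrite ltr0n.
    have pdf_opp : pdf (- n%:R) = pdf n%:R by rewrite !normal_pdfE0 sqrrN.
    have p_ge0 : 0 <= pdf n%:R by exact: normal_pdf_ge0.
    have p_le : n%:R ^+ k * pdf n%:R <= c * normal_peak (2 * s) * n%:R^-1.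
      rewrite ler_pdivlMr// mulrAC -exprSr.
      have := le_c n%:R; rewrite normr_nat => /le_trans; apply.
      by rewrite ler_wpM2l// normal_pdf_ub// mulf_neq0 ?gt_eqF.
    have n1 : n%:R^-1 <= n.+1%:R^-1 * 2 :> R.
      rewrite ler_pdivlMl ?ltr0Sn// ler_pdivrMr// -natrM ler_nat.
      by rewrite mul2n -addnn -addn1 leq_add2l.
    rewrite /b pdf_opp; apply: le_trans (ler_normB _ _) _.
    rewrite !normrM !normrX normrN normr_nat (ger0_norm (ltW s_gt0)) (ger0_norm p_ge0).
    have s0 : 0 <= s ^+ 2 by exact: sqr_ge0.
    have q_le : n%:R ^+ k * pdf n%:R <= c * normal_peak (2 * s) * (n.+1%:R^-1 * 2).
      apply: le_trans p_le _; apply: ler_wpM2l => //.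
      by rewrite mulr_ge0// normal_peak_ge0.
    have := ler_wpM2l s0 q_le; rewrite /C.
    set u := _ ^+ k; set v := n.+1%:R^-1; move: (normal_peak _) => w; nra.
  - exact: cvg_cst.
  - rewrite -[X in _ --> X](mul0r 2) -(mulr0 C); apply: cvgMr_tmp; apply: cvgMl_tmp.
    exact: cvg_harmonic.
have c3 : ((b n)%:E + (k%:R * s ^+ 2)%:E *
   \int[mu]_(x in centered_itv n) (x ^+ k.-1 * pdf x)%:E)%E @[n --> \oo]
   --> (0 + (k%:R * s ^+ 2)%:E * \int[mu]_x (x ^+ k.-1 * pdf x)%:E)%E.
  by apply: cvgeD => //; apply: cvgeZl.
rewrite add0e in c3.
have c1' : ((b n)%:E + (k%:R * s ^+ 2)%:E *
   \int[mu]_(x in centered_itv n) (x ^+ k.-1 * pdf x)%:E)%E @[n --> \oo]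
   --> (\int[mu]_x (x ^+ k.+1 * pdf x)%:E)%E.
  apply: cvg_trans c1; apply: near_eq_cvg; near=> n.
  apply: by_parts_normal_pdf; near: n; exact: nbhs_infty_gt.
exact: (cvg_unique _ c1' c3).
Unshelve. all: end_near. Qed.

Lemma normal_moment n :
  (\int[mu]_x ((x / s) ^+ n * pdf x)%:E = (gaussian_moment 1 n)%:E)%E.
Proof.
have s0 : s != 0 by rewrite gt_eqF.
have scale k : (\int[mu]_x ((x / s) ^+ k * pdf x)%:E
    = (s ^- k)%:E * \int[mu]_x (x ^+ k * pdf x)%:E)%E.
  rewrite -integralZl//; last exact: integrable_pow_normal_pdf.
  by apply: eq_integral => x _; rewrite -EFinM exprMn exprVn; congr EFin; ring.
have h n' : (\int[mu]_x ((x / s) ^+ n' * pdf x)%:E = (gaussian_moment 1 n')%:E)%E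
  /\ (\int[mu]_x ((x / s) ^+ n'.+1 * pdf x)%:E = (gaussian_moment 1 n'.+1)%:E)%E.
  elim: n' => [|n' [IH1 IH2]].
    split.
      under eq_integral do rewrite expr0 mul1r.
      exact: integral_normal_pdf.
    by rewrite scale normal_moment_rec mul0r mul0e mule0.
  split=> //; rewrite scale normal_moment_rec (_ : gaussian_moment 1 n'.+2
    = n'.+1%:R * gaussian_moment 1 n') /= ?mulr1// [in RHS]EFinM -IH1 scale !muleA -!EFinM.
  by congr (_%:E * _)%E; rewrite !exprS; field; rewrite ?expf_neq0 ?s0.
by case: (h n).
Qed.

Lemma integrable_normal_moment n :
  mu.-integrable setT (fun x : R => ((x / s) ^+ n * pdf x)%:E).
Proof.
have := integrableZl measurableT (s ^- n) (integrable_pow_normal_pdf n).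
apply: eq_integrable => // x _.
by rewrite -EFinM exprMn exprVn; congr EFin; ring.
Qed.

End NormalMoments.

(** * Independent families and products *)

Section WeightedIntegral.
Local Open Scope classical_set_scope.
Local Open Scope ereal_scope.
Context d d' (Omega : measurableType d) (T : measurableType d') (R : realType).
Variables (P : {measure set Omega -> \bar R}) (X : Omega -> T) (h : Omega -> R).
Hypothesis mX : measurable_fun setT X.
Hypothesis mh : measurable_fun setT h.
Hypothesis h_ge0 : forall w, (0 <= h w)%R.

Import HBNNSimple.

Lemma integral_weighted_nnsfun (g : {nnsfun T >-> R}) :
  \int[P]_w (g (X w) * h w)%:E
    = \sum_(y \in range g) y%:E * \int[P]_w (\1_(g @^-1` [set y]) (X w) * h w)%:E.
Proof.
have mind (y : R) : measurable_fun setT (fun w => \1_(g @^-1` [set y]) (X w) : R).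
  by apply: (measurableT_comp _ mX); exact: measurable_indic.
transitivity (\int[P]_w (\sum_(y \in range g)
   ((y * \1_(g @^-1` [set y]) (X w))%:E * (h w)%:E))).
  apply: eq_integral => w _; rewrite EFinM -ge0_mule_fsuml => [|y].
    by rewrite fsumEFin // -(fimfunE _ (X w)).
  exact: nnfun_muleindic_ge0.
rewrite ge0_integral_fsum//; last 2 first.
- move=> y; apply: emeasurable_funM; last exact/measurable_EFinP.
  by apply/measurable_EFinP; exact: measurable_funM.
- by move=> y w _; apply: mule_ge0; [exact: nnfun_muleindic_ge0|rewrite lee_fin].
apply: eq_fsbigr => y _.
have [y0|y0] := leP 0%R y.
  under eq_integral do rewrite -EFinM -mulrA EFinM.
  rewrite ge0_integralZl// ?lee_fin//.
  - by apply/measurable_EFinP; exact: measurable_funM.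
  - by move=> w _; rewrite lee_fin mulr_ge0.
rewrite preimage_nnfun0//.
rewrite [LHS]integral0_eq ?integral0_eq ?mule0// => w _; rewrite indic0 ?mul0r//.
by rewrite mulr0 mul0e.
Qed.

Lemma cvg_integral_weighted (f : T -> R) (f_ : {nnsfun T >-> R}^nat) :
  measurable_fun setT f -> (forall x, (0 <= f x)%R) ->
  (forall x, EFin \o f_^~ x @ \oo --> (f x)%:E) ->
  (forall x n m, (n <= m)%N -> (f_ n x <= f_ m x)%R) ->
  \int[P]_w (f (X w) * h w)%:E = limn (fun n => \int[P]_w (f_ n (X w) * h w)%:E).
Proof.
move=> mf f_ge0 f_cvg nd.
rewrite -monotone_convergence//.
- apply: eq_integral => w _; apply/esym/cvg_lim => //.
  under eq_fun do rewrite EFinM.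
  by rewrite EFinM; apply: cvgeZr => //; exact: f_cvg.
- move=> n; apply/measurable_EFinP; apply: measurable_funM => //.
  exact: measurableT_comp.
- by move=> n w _; rewrite lee_fin mulr_ge0.
- by move=> w _ n m nm; rewrite lee_fin ler_wpM2r//; exact: nd.
Qed.

End WeightedIntegral.

Section EqualWeightedImages.
Local Open Scope classical_set_scope.
Local Open Scope ereal_scope.
Context d d1 d2 (T : measurableType d) (Omega1 : measurableType d1)
  (Omega2 : measurableType d2) (R : realType).
Import HBNNSimple.
Variables (P1 : {measure set Omega1 -> \bar R}) (X1 : Omega1 -> T) (h1 : Omega1 -> R).
Variables (P2 : {measure set Omega2 -> \bar R}) (X2 : Omega2 -> T) (h2 : Omega2 -> R).

(** If X1 under the density h1 and X2 under the density h2 have the same image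
    measure, then they give the same integrals; approximate f by simple
    functions. This serves both for changes of variables, with h1 = 1, and for
    independence, with h1 a product of the other factors and h2 constant. *)
Lemma ge0_integral_weighted (f : T -> R) :
  measurable_fun setT X1 -> measurable_fun setT h1 -> (forall w, (0 <= h1 w)%R) ->
  measurable_fun setT X2 -> measurable_fun setT h2 -> (forall w, (0 <= h2 w)%R) ->
  (forall B : set T, measurable B ->
    \int[P1]_w (\1_B (X1 w) * h1 w)%:E = \int[P2]_w (\1_B (X2 w) * h2 w)%:E) ->
  measurable_fun setT f -> (forall x, (0 <= f x)%R) ->
  \int[P1]_w (f (X1 w) * h1 w)%:E = \int[P2]_w (f (X2 w) * h2 w)%:E.
Proof.
move=> mX1 mh1 h10 mX2 mh2 h20 weighted mf f_ge0.
have mEf : measurable_fun setT (EFin \o f) by exact/measurable_EFinP.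
pose f_ := nnsfun_approx measurableT mEf.
have f_cvg x : EFin \o f_^~ x @ \oo --> (f x)%:E.
  by apply: (cvg_nnsfun_approx measurableT mEf) => // y _; rewrite lee_fin.
have nd x n m : (n <= m)%N -> (f_ n x <= f_ m x)%R.
  by move=> nm; exact/lefP/nd_nnsfun_approx.
rewrite !(cvg_integral_weighted _ _ _ _ mf f_ge0 f_cvg nd)//.
congr (lim (_ @ \oo)); apply/funext => n.
rewrite !integral_weighted_nnsfun//; apply: eq_fsbigr => y _.
by rewrite weighted.
Qed.
End EqualWeightedImages.

Section IndependentProducts.
Local Open Scope classical_set_scope.
Context d d' (Omega : measurableType d) (T : measurableType d') (R : realType).
Variables (P : probability Omega R) (J : choiceType) (D : set J) (X : J -> Omega -> T).
Hypothesis mX : forall j, D j -> measurable_fun setT (X j).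
Hypothesis indep : independent_family P D X.

Lemma prod_indic (t : seq J) (A : J -> set Omega) w :
  \prod_(j <- t) \1_(A j) w = \1_(\bigcap_(j in [set` t]) A j) w :> R.
Proof.
rewrite [RHS]indicE; case: (asboolP (forall j, j \in t -> A j w)) => h.
  rewrite mem_set ?big1_seq//.
  by move=> j /andP[_ jt]; rewrite indicE mem_set//; exact: h.
rewrite memNset//.
move: h => /existsNP[j /not_implyP[jt nAj]].
by rewrite (big_rem j)//= indicE memNset// mul0r.
Qed.

Lemma measurable_prod_comp (s : seq J) (f : J -> T -> R) :
  (forall j, j \in s -> D j) -> (forall j, measurable_fun setT (f j)) ->
  measurable_fun setT (fun w => \prod_(j <- s) f j (X j w)).
Proof.
elim: s => [|i s IH] Ds mf.
  by under eq_fun do rewrite big_nil; exact: measurable_cst.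
under eq_fun do rewrite big_cons; apply: measurable_funM.
  by apply: measurableT_comp => //; apply: mX; apply: Ds; rewrite mem_head.
by apply: IH => // j js; apply: Ds; rewrite in_cons js orbT.
Qed.

(** Induction on s replaces the indicators of the definition of independence,
    one index at a time, by arbitrary nonnegative functions; the list t holds
    the indices which still carry an indicator. *)
Lemma indep_ge0_aux (s t : seq J) (f : J -> T -> R) (B : J -> set T) :
  uniq (s ++ t) -> (forall j, j \in s ++ t -> D j) ->
  (forall j, measurable_fun setT (f j)) -> (forall j x, 0 <= f j x) ->
  (forall j, measurable (B j)) ->
  (forall j, j \in s -> (\int[P]_w (f j (X j w))%:E < +oo)%E) ->
  (\int[P]_w (\prod_(j <- s) f j (X j w) * \prod_(j <- t) \1_(B j) (X j w))%:E
    = \prod_(j <- s) \int[P]_w (f j (X j w))%:E * \prod_(j <- t) P (X j @^-1` B j))%E.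
Proof.
move=> + + mf f_ge0; elim: s t B => [|i s IH] t B.
  move=> /= ut Dt mB _; rewrite big_nil mul1e -indep//.
  have mcap : measurable (\bigcap_(j in [set` t]) (X j @^-1` B j)).
    apply: fin_bigcap_measurable; first exact: finite_seq.
    move=> j jt; rewrite -[Y in measurable Y]setTI; apply: mX => //.
    exact: Dt.
  under eq_integral do rewrite big_nil mul1r (prod_indic t (fun j => X j @^-1` B j)).
  by rewrite integral_indic// setIT.
move=> /= /andP[ist ust] Dst mB fin.
have Di : D i by apply: Dst; rewrite mem_head.
have Dst' j : j \in s ++ t -> D j by move=> js; apply: Dst; rewrite in_cons js orbT.
pose h w := \prod_(j <- s) f j (X j w) * \prod_(j <- t) (\1_(B j) (X j w) : R).
pose c := (\prod_(j <- s) \int[P]_w (f j (X j w))%:E * \prod_(j <- t) P (X j @^-1` B j))%E.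
have c_ge0 : (0 <= c)%E.
  apply: mule_ge0; apply: prode_ge0 => j _ //.
  by apply: integral_ge0 => w _; rewrite lee_fin.
have c_fin : c \is a fin_num.
  apply: fin_numM; rewrite big_seq; apply: prode_fin_num => j jm.
    rewrite ge0_fin_numE; last by apply: integral_ge0 => w _; rewrite lee_fin.
    by apply: fin; rewrite in_cons jm orbT.
  apply: fin_num_measure; rewrite -[Y in measurable Y]setTI; apply: mX => //.
  by apply: Dst'; rewrite mem_cat jm orbT.
transitivity (\int[P]_w (f i (X i w) * h w)%:E)%E.
  by apply: eq_integral => w _; rewrite big_cons mulrA.
have mh : measurable_fun setT h.
  apply: measurable_funM.
    apply: measurable_prod_comp => // j js.
    by apply: Dst'; rewrite mem_cat js.
  apply: (measurable_prod_comp (f := fun j => \1_(B j))) => // j jt.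
    by apply: Dst'; rewrite mem_cat jt orbT.
have h_ge0 w : 0 <= h w by apply: mulr_ge0; apply: prodr_ge0.
have mXi := mX Di.
have integral_mulc (g : T -> R) : measurable_fun setT g -> (forall x, 0 <= g x) ->
    (\int[P]_w (g (X i w) * fine c)%:E = c * \int[P]_w (g (X i w))%:E)%E.
  move=> mg g_ge0; under eq_integral do rewrite EFinM muleC.
  rewrite ge0_integralZl// ?lee_fin ?fine_ge0 ?fineK//.
    by apply/measurable_EFinP; exact: measurableT_comp.
  by move=> w _; rewrite lee_fin.
(* The case of an indicator of X i is the induction hypothesis with i moved to the second list. *)
rewrite (@ge0_integral_weighted _ _ _ _ _ _ _ P (X i) h P (X i) (fun=> fine c) (f i))//.
- by rewrite integral_mulc// big_cons muleC -muleA.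
- by move=> w; exact: fine_ge0.
move=> B0 mB0.
pose B' j := if j == i then B0 else B j.
have it : i \notin t by apply: contra ist; rewrite mem_cat => ->; rewrite orbT.
have eqB j : j \in t -> B' j = B j.
  by move=> jt; rewrite /B' ifN//; apply: contraNneq it => <-.
transitivity (\int[P]_w (\prod_(j <- s) f j (X j w)
    * \prod_(j <- i :: t) \1_(B' j) (X j w))%:E)%E.
  apply: eq_integral => w _; rewrite big_cons {1}/B' eqxx /h mulrCA; congr (_ * _)%:E.
  congr (_ * _); rewrite big_seq [RHS]big_seq; apply: eq_bigr => j jt.
  by rewrite eqB.
rewrite IH//.
- transitivity (c * P (X i @^-1` B0))%E; last first.
    rewrite integral_mulc//; congr (_ * _)%E.
    rewrite (@integral_indic _ _ _ P setT measurableT (X i @^-1` B0)) ?setIT//.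
    by rewrite -[Y in measurable Y]setTI; exact: mXi.
  rewrite big_cons {1}/B' eqxx muleCA muleC; congr (_ * _ * _)%E.
  by rewrite big_seq [RHS]big_seq; apply: eq_bigr => j jt; rewrite eqB.
- by rewrite -cat1s uniq_catCA /= ist.
- move=> j; rewrite mem_cat in_cons => /or3P[js|/eqP -> //|jt].
    by apply: Dst'; rewrite mem_cat js.
  by apply: Dst'; rewrite mem_cat jt orbT.
- by move=> j; rewrite /B'; case: ifP.
- by move=> j js; apply: fin; rewrite in_cons js orbT.
Qed.

Lemma integrable_max0 (g : Omega -> R) : P.-integrable setT (EFin \o g) ->
  P.-integrable setT (EFin \o (fun w => Num.max (g w) 0)).
Proof.
move=> ig; apply: (le_integrable _ _ _ ig) => //.
  apply/measurable_EFinP; apply: measurable_maxr => //.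
  by have /measurable_EFinP := measurable_int _ ig.
move=> w _ /=; rewrite lee_fin.
by case: (leP (g w) 0) => gw; rewrite ?normr0 ?normr_ge0.
Qed.

Definition mean_of (g : T -> R) (j : J) : R := fine (\int[P]_w (g (X j w))%:E).

Lemma integral_mean_of (g : T -> R) j : P.-integrable setT (fun w => (g (X j w))%:E) ->
  (\int[P]_w (g (X j w))%:E)%E = (mean_of g j)%:E.
Proof. by move=> ig; rewrite /mean_of fineK//; exact: integrable_fin_num. Qed.

(** The list t holds the indices with nonnegative functions. The head of s is
    moved there after being split into its positive and negative parts. *)
Lemma indep_signed (s t : seq J) (f : J -> T -> R) :
  uniq (s ++ t) -> (forall j, j \in s ++ t -> D j) ->
  (forall j, measurable_fun setT (f j)) ->
  (forall j, j \in t -> forall x, 0 <= f j x) ->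
  (forall j, j \in s ++ t -> P.-integrable setT (fun w => (f j (X j w))%:E)) ->
  P.-integrable setT (fun w => (\prod_(j <- s ++ t) f j (X j w))%:E) /\
  (\int[P]_w (\prod_(j <- s ++ t) f j (X j w))%:E
    = (\prod_(j <- s ++ t) mean_of (f j) j)%:E)%E.
Proof.
elim: s t f => [|i s IH] t f.
  rewrite !cat0s => ut Dt mf f_ge0 intf.
  pose f' j x := `|f j x|.
  have ff' j : j \in t -> forall x, f' j x = f j x.
    by move=> jt x; rewrite /f' ger0_norm// f_ge0.
  have eqI : (\int[P]_w (\prod_(j <- t) f j (X j w))%:E
    = (\prod_(j <- t) mean_of (f j) j)%:E)%E.
    have := @indep_ge0_aux t [::] f' (fun=> setT).
    rewrite cats0 => /(_ ut Dt) H.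
    transitivity (\int[P]_w (\prod_(j <- t) f' j (X j w) *
       \prod_(j <- [::]) \1_(setT : set T) (X j w))%:E)%E.
      apply: eq_integral => w _; rewrite big_nil mulr1; congr EFin.
      by rewrite big_seq [RHS]big_seq; apply: eq_bigr => j jt; rewrite ff'.
    rewrite H//.
    - rewrite big_nil mule1 -prodEFin big_seq [RHS]big_seq.
      apply: eq_bigr => j jt; rewrite -integral_mean_of ?intf//.
      by apply: eq_integral => w _; rewrite ff'.
    - by move=> j; exact: measurableT_comp.
    - by move=> j x; exact: normr_ge0.
    - move=> j jt; have := intf j jt => /integrableP[_]; apply: le_lt_trans.
      by rewrite le_eqVlt; apply/orP; left; apply/eqP; apply: eq_integral.
  split=> //; apply/integrableP; split.
    by apply/measurable_EFinP; apply: measurable_prod_comp.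
  rewrite (_ : (\int[P]_w _)%E = (\prod_(j <- t) mean_of (f j) j)%:E) ?ltry//.
  rewrite -eqI; apply: eq_integral => w _ /=; rewrite ger0_norm//.
  by rewrite big_seq; apply: prodr_ge0 => j jt; exact: f_ge0.
move=> /= /andP[ist ust] Dst mf f_ge0 intf.
pose fp j x := if j == i then Num.max (f j x) 0 else f j x.
pose fm j x := if j == i then Num.max (- f j x) 0 else f j x.
have perm g : \prod_(j <- s ++ i :: t) g j = \prod_(j <- i :: s ++ t) g j :> R.
  by apply: perm_big; rewrite -cat1s perm_catCA.
have mem j : (j \in s ++ i :: t) = (j \in i :: s ++ t).
  by apply: perm_mem; rewrite -cat1s perm_catCA.
have uq : uniq (s ++ i :: t) by rewrite -cat1s uniq_catCA /= ist.
have it : i \notin t by apply: contra ist; rewrite mem_cat => ->; rewrite orbT.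
have neq j : j \in s ++ t -> j == i = false.
  by move=> js; apply/negP => /eqP ji; move: ist; rewrite -ji js.
have Di : P.-integrable setT (fun w => (f i (X i w))%:E) by apply: intf; rewrite mem_head.
have DiN : P.-integrable setT (fun w => (- f i (X i w))%:E).
  have := integrableN Di; exact: eq_integrable.
have [||||ip Ep] := IH (i :: t) fp uq.
- by move=> j; rewrite mem; exact: Dst.
- by move=> j; rewrite /fp; case: (j == i) => //; exact: measurable_maxr.
- move=> j; rewrite in_cons => /orP[/eqP ->|jt] x; rewrite /fp.
    by rewrite eqxx le_max lexx orbT.
  by case: ifP => _; rewrite ?le_max ?lexx ?orbT// f_ge0.
- move=> j; rewrite mem => jm; rewrite /fp; case: eqP => [->|_]; last exact: intf.
  exact: (integrable_max0 Di).
have [||||im Em] := IH (i :: t) fm uq.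
- by move=> j; rewrite mem; exact: Dst.
- move=> j; rewrite /fm; case: (j == i) => //; apply: measurable_maxr => //.
  exact: measurableT_comp.
- move=> j; rewrite in_cons => /orP[/eqP ->|jt] x; rewrite /fm.
    by rewrite eqxx le_max lexx orbT.
  by case: ifP => _; rewrite ?le_max ?lexx ?orbT// f_ge0.
- move=> j; rewrite mem => jm; rewrite /fm; case: eqP => [->|_]; last exact: intf.
  exact: (integrable_max0 DiN).
have split_f w : \prod_(j <- i :: s ++ t) f j (X j w)
  = \prod_(j <- s ++ i :: t) fp j (X j w) - \prod_(j <- s ++ i :: t) fm j (X j w).
  rewrite !perm !big_cons {1}/fp {2}/fm eqxx.
  have -> : \prod_(j <- s ++ t) fp j (X j w) = \prod_(j <- s ++ t) f j (X j w).
    by rewrite big_seq [RHS]big_seq; apply: eq_bigr => j jm; rewrite /fp neq.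
  have -> : \prod_(j <- s ++ t) fm j (X j w) = \prod_(j <- s ++ t) f j (X j w).
    by rewrite big_seq [RHS]big_seq; apply: eq_bigr => j jm; rewrite /fm neq.
  rewrite -mulrBl; congr (_ * _); rewrite /fm eqxx.
  by case: (leP (f i (X i w)) 0) => h; case: (leP (- f i (X i w)) 0) => h'; lra.
split.
  have := integrableB measurableT ip im; apply: eq_integrable => // w _.
  by rewrite split_f EFinB.
under eq_integral do rewrite split_f EFinB.
rewrite integralB// Ep Em -EFinB; congr EFin; rewrite !perm !big_cons.
have -> : \prod_(j <- s ++ t) mean_of (fp j) j = \prod_(j <- s ++ t) mean_of (f j) j.
  rewrite big_seq [RHS]big_seq; apply: eq_bigr => j jm; rewrite /mean_of.
  by congr fine; apply: eq_integral => w _; rewrite /fp neq.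
have -> : \prod_(j <- s ++ t) mean_of (fm j) j = \prod_(j <- s ++ t) mean_of (f j) j.
  rewrite big_seq [RHS]big_seq; apply: eq_bigr => j jm; rewrite /mean_of.
  by congr fine; apply: eq_integral => w _; rewrite /fm neq.
rewrite -mulrBl; congr (_ * _).
have ipi := integrable_max0 Di; have imi := integrable_max0 DiN.
have Efp : (\int[P]_w (fp i (X i w))%:E)%E = (\int[P]_w (Num.max (f i (X i w)) 0)%:E)%E.
  by apply: eq_integral => w _; rewrite /fp eqxx.
have Efm : (\int[P]_w (fm i (X i w))%:E)%E = (\int[P]_w (Num.max (- f i (X i w)) 0)%:E)%E.
  by apply: eq_integral => w _; rewrite /fm eqxx.
rewrite /mean_of Efp Efm -fineB; try exact: integrable_fin_num.
congr fine; rewrite -integralB//; apply: eq_integral => w _; rewrite -EFinB; congr EFin.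
by case: (leP (f i (X i w)) 0) => h; case: (leP (- f i (X i w)) 0) => h'; lra.
Qed.

Lemma indep_expectation_prod (s : seq J) (f : J -> T -> R) :
  uniq s -> (forall j, j \in s -> D j) ->
  (forall j, measurable_fun setT (f j)) ->
  (forall j, j \in s -> P.-integrable setT (fun w => (f j (X j w))%:E)) ->
  P.-integrable setT (fun w => (\prod_(j <- s) f j (X j w))%:E) /\
  (\int[P]_w (\prod_(j <- s) f j (X j w))%:E
    = (\prod_(j <- s) mean_of (f j) j)%:E)%E.
Proof.
move=> us Ds mf intf; have := @indep_signed s [::] f.
by rewrite cats0; apply.
Qed.

End IndependentProducts.

(** * Normal and independent variables *)

Section NormalLaw.
Local Open Scope classical_set_scope.
Context d (Omega : measurableType d) (R : realType).
Variable P : probability Omega R.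
Local Notation mu := (@lebesgue_measure R).

Lemma ge0_integral_normal_law (X : Omega -> R) (s : R) (f : R -> R) :
  0 < s -> has_normal_law P X 0 s ->
  measurable_fun setT f -> (forall x, 0 <= f x) ->
  (\int[P]_w (f (X w))%:E = \int[mu]_x (f x * normal_pdf 0 s x)%:E)%E.
Proof.
move=> s0 [mX law] mf f0.
have := @ge0_integral_weighted _ _ _ _ _ _ R P X (fun=> 1) mu id (normal_pdf 0 s) f.
under eq_integral do rewrite mulr1.
apply=> //; try by move=> *; exact: normal_pdf_ge0.
  exact: measurable_normal_pdf.
move=> B mB; under eq_integral do rewrite mulr1.
rewrite (@integral_indic _ _ _ P setT measurableT (X @^-1` B)) ?setIT; last first.
  by rewrite -[Y in measurable Y]setTI; exact: mX.
rewrite [LHS](law B mB) gt_eqF// /normal_prob [LHS]integral_mkcond; apply: eq_integral => x _.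
rewrite patchE indicE; case: ifP => _ /=; by rewrite ?mul1r ?mul0r.
Qed.

(** The transfer of integrals to the density holds for nonnegative functions, so
    the power is split into its positive and negative parts. *)
Lemma normal_law_moment (X : Omega -> R) (s : R) n :
  0 < s -> has_normal_law P X 0 s ->
  P.-integrable setT (fun w => ((X w / s) ^+ n)%:E) /\
  (\int[P]_w ((X w / s) ^+ n)%:E = (gaussian_moment (1 : R) n)%:E)%E.
Proof.
move=> s0 lawX; have mX := lawX.1.
pose f x := (x / s) ^+ n.
have mf : measurable_fun setT f by apply: measurable_funX; exact: measurable_funM.
pose fp x := Num.max (f x) 0; pose fm x := Num.max (- f x) 0.
have mfp : measurable_fun setT fp by exact: measurable_maxr.
have mfm : measurable_fun setT fm.
  by apply: measurable_maxr => //; exact: measurableT_comp.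
have fp0 x : 0 <= fp x by rewrite le_max lexx orbT.
have fm0 x : 0 <= fm x by rewrite le_max lexx orbT.
have fE x : f x = fp x - fm x.
  by rewrite /fp /fm; case: (leP (f x) 0) => h; case: (leP (- f x) 0) => h'; lra.
have pdf0 x : 0 <= normal_pdf 0 s x by exact: normal_pdf_ge0.
have ipdf : mu.-integrable setT (fun x => (f x * normal_pdf 0 s x)%:E).
  exact: integrable_normal_moment.
have transfer (g : R -> R) : measurable_fun setT g -> (forall x, 0 <= g x) ->
    (forall x, g x <= `|f x|) ->
    P.-integrable setT (fun w => (g (X w))%:E) /\
    mu.-integrable setT (fun x => (g x * normal_pdf 0 s x)%:E).
  move=> mg g0 gf.
  have imu : mu.-integrable setT (fun x => (g x * normal_pdf 0 s x)%:E).
    apply: (le_integrable _ _ _ ipdf) => //.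
      apply/measurable_EFinP; apply: measurable_funM => //.
      exact: measurable_normal_pdf.
    move=> x _ /=; rewrite lee_fin !normrM ler_wpM2r//.
    by rewrite ger0_norm.
  split=> //; apply/integrableP; split.
    by apply/measurable_EFinP; exact: measurableT_comp.
  under eq_integral => w _ do rewrite /= ger0_norm//.
  rewrite (ge0_integral_normal_law s0 lawX mg g0).
  have /integrableP[_] := imu; apply: le_lt_trans.
  rewrite le_eqVlt; apply/orP; left; apply/eqP; apply: eq_integral => x _ /=.
  by rewrite ger0_norm// mulr_ge0.
have [iP1 im1] : P.-integrable setT (fun w => (fp (X w))%:E) /\
    mu.-integrable setT (fun x => (fp x * normal_pdf 0 s x)%:E).
  by apply: transfer => // x; rewrite ge_max normr_ge0 ler_norm.
have [iP2 im2] : P.-integrable setT (fun w => (fm (X w))%:E) /\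
    mu.-integrable setT (fun x => (fm x * normal_pdf 0 s x)%:E).
  by apply: transfer => // x; rewrite ge_max normr_ge0 -normrN ler_norm.
have fEX : (fun w => (f (X w))%:E) = (fun w => (fp (X w))%:E - (fm (X w))%:E)%E.
  by apply/funext => w; rewrite fE EFinB.
split; first by rewrite fEX; exact: integrableB.
rewrite fEX integralB// !(@ge0_integral_normal_law X s)// -integralB//.
rewrite -(normal_moment s0 n); apply: eq_integral => x _.
by rewrite -EFinB -mulrBl -fE.
Qed.

Lemma uniq_bool (b b' : bool) s : uniq [:: b, b' & s] -> b' = ~~ b /\ s = [::].
Proof.
case: s => [|c s]; first by case: b b' => [] [].
by case: b b' c => [] [] [] //=; rewrite !inE /= ?andbF.
Qed.

(** Two independent variables form an independent family indexed by the
    booleans. *)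
Lemma independent2_moments (X Y : Omega -> R) (s : R) m n :
  0 < s -> has_normal_law P X 0 s -> has_normal_law P Y 0 s -> independent2 P X Y ->
  P.-integrable setT (fun w => ((X w / s) ^+ m * (Y w / s) ^+ n)%:E) /\
  (\int[P]_w ((X w / s) ^+ m * (Y w / s) ^+ n)%:E
    = (gaussian_moment (1 : R) m * gaussian_moment (1 : R) n)%:E)%E.
Proof.
move=> s0 lX lY indep.
pose Z b := if b then X else Y; pose e b := if b then m else n.
have mZ b : setT b -> measurable_fun setT (Z b) by case: b => _; [exact: lX.1|exact: lY.1].
have indepZ : independent_family P (setT : set bool) Z.
  move=> s' B us' _ mB.
  have two b : P (\bigcap_(j in [set` [:: b; ~~ b]]) (Z j @^-1` B j))
      = (P (Z b @^-1` B b) * P (Z (~~ b) @^-1` B (~~ b)))%E.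
    have -> : \bigcap_(j in [set` [:: b; ~~ b]]) (Z j @^-1` B j)
        = (X @^-1` B true) `&` (Y @^-1` B false).
      apply/seteqP; split=> w.
        by move=> h; split; [apply: (h true)|apply: (h false)]; case: b {h}.
      by move=> [h1 h2] [].
    by rewrite indep//; case: b; rewrite // muleC.
  have one b : P (\bigcap_(j in [set` [:: b]]) (Z j @^-1` B j)) = P (Z b @^-1` B b).
    congr (P _); apply/seteqP; split=> w; first by apply; exact: mem_head.
    by move=> h j /=; rewrite mem_seq1 => /eqP ->.
  case: s' us' => [_|b [_|b' s']].
  - by rewrite big_nil (_ : \bigcap_(j in _) _ = setT) ?probability_setT// -subTset => w _ j.
  - by rewrite big_seq1 one.
  - by move=> ub; have [-> ->] := uniq_bool ub; rewrite two big_cons big_seq1.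
have [||||iZ EZ] := indep_expectation_prod (s := [:: true; false]) mZ indepZ
  (f := fun b x => (x / s) ^+ e b) => //.
- by move=> b; apply: measurable_funX; exact: measurable_funM.
- by move=> [] _; [exact: (normal_law_moment m s0 lX).1|exact: (normal_law_moment n s0 lY).1].
move: iZ EZ; rewrite !big_cons !big_nil /mean_of.
rewrite (normal_law_moment m s0 lX).2 (normal_law_moment n s0 lY).2 !mulr1 /= => iZ EZ.
have ZE : (fun w => (\prod_(j <- [:: true; false]) (Z j w / s) ^+ e j)%:E)
   = (fun w => ((X w / s) ^+ m * (Y w / s) ^+ n)%:E).
  by apply/funext => w; rewrite !big_cons big_nil mulr1.
by split; [rewrite -ZE|rewrite -EZ; congr integral].
Qed.

End NormalLaw.

(** * Gaussian coordinates of the harmonic coefficients *)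

Section GaussianCoordinates.
Local Open Scope classical_set_scope.
Context d (Omega : measurableType d) (R : realType).
Variables (P : probability Omega R) (C : nat -> R) (a : nat -> int -> Omega -> R[i]).
Hypothesis C_gt0 : forall l, (0 < l)%N -> 0 < C l.
Hypothesis gc : gaussian_coefficients P C a.

(** The real orders n > 0 and n < 0 carry the real and imaginary parts of the
    coefficient of order |n|, normalized to variance 1. *)
Definition gauss_coord l (n : int) w : R :=
  if n == 0 then complex.Re (a l 0 w) / Num.sqrt (C l)
  else if 0 < n then complex.Re (a l n w) / Num.sqrt (C l / 2)
  else complex.Im (a l `|n|%N%:Z w) / Num.sqrt (C l / 2).

Definition coef_pair (lm : nat * nat) w : R * R :=
  (complex.Re (a lm.1 lm.2%:Z w), complex.Im (a lm.1 lm.2%:Z w)).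

Definition coef_index : set (nat * nat) :=
  [set lm : nat * nat | (0 < lm.1)%N /\ (lm.2 <= lm.1)%N].

Lemma measurable_coef_pair lm : coef_index lm -> measurable_fun setT (coef_pair lm).
Proof.
case: lm => l m [/= l0 ml]; apply: measurable_fun_pair => /=.
  case: m ml => [|m] ml; first exact: (coef0_law gc l0).1.
  by apply: (coef_Re_law gc _).1; rewrite ml.
case: m ml => [|m] ml.
  by under eq_fun do rewrite (coef0_real gc)//; exact: measurable_cst.
by apply: (coef_Im_law gc _).1; rewrite ml.
Qed.

Definition pair_monomial (e : nat -> int -> nat) (lm : nat * nat) (x : R * R) : R :=
  let: (l, m) := lm in
  if m == 0%N then (x.1 / Num.sqrt (C l)) ^+ e l 0
  else (x.1 / Num.sqrt (C l / 2)) ^+ e l m%:Z * (x.2 / Num.sqrt (C l / 2)) ^+ e l (- m%:Z).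

Definition pair_moment (e : nat -> int -> nat) (lm : nat * nat) : R :=
  let: (l, m) := lm in
  if m == 0%N then gaussian_moment (1 : R) (e l 0)
  else gaussian_moment (1 : R) (e l m%:Z) * gaussian_moment (1 : R) (e l (- m%:Z)).

Lemma measurable_pair_monomial e lm : measurable_fun setT (pair_monomial e lm).
Proof.
case: lm => l m; rewrite /pair_monomial; case: eqP => _.
  by apply: measurable_funX; exact: measurable_funM.
by apply: measurable_funM; apply: measurable_funX; exact: measurable_funM.
Qed.

Lemma pair_monomial_moment e lm : coef_index lm ->
  P.-integrable setT (fun w => (pair_monomial e lm (coef_pair lm w))%:E) /\
  (\int[P]_w (pair_monomial e lm (coef_pair lm w))%:E = (pair_moment e lm)%:E)%E.
Proof.
case: lm => l m [/= l0 ml].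
have sC : 0 < Num.sqrt (C l) by rewrite sqrtr_gt0 C_gt0.
have sC2 : 0 < Num.sqrt (C l / 2) by rewrite sqrtr_gt0 divr_gt0 ?C_gt0.
rewrite /pair_monomial /pair_moment /coef_pair /=; case: eqP => [->|/eqP m0].
  exact: (normal_law_moment _ _ (coef0_law gc l0)).
have m0l : (0 < m <= l)%N by rewrite lt0n m0.
apply: independent2_moments => //.
- exact: (coef_Re_law gc m0l).
- exact: (coef_Im_law gc m0l).
- exact: (coef_Re_Im_independent gc m0l).
Qed.

Lemma pair_monomials_moment e (s : seq (nat * nat)) : uniq s ->
  (forall lm, lm \in s -> coef_index lm) ->
  P.-integrable setT (fun w => (\prod_(lm <- s) pair_monomial e lm (coef_pair lm w))%:E) /\
  (\int[P]_w (\prod_(lm <- s) pair_monomial e lm (coef_pair lm w))%:E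
    = (\prod_(lm <- s) pair_moment e lm)%:E)%E.
Proof.
move=> us sD.
have [||] := indep_expectation_prod (D := coef_index) (s := s) measurable_coef_pair
  (coef_independent gc) (f := pair_monomial e) us sD.
- exact: measurable_pair_monomial.
- by move=> j js; exact: (pair_monomial_moment e (sD _ js)).1.
move=> int1 ->; split => //; congr EFin.
rewrite big_seq [RHS]big_seq; apply: eq_bigr => j js.
by rewrite /mean_of (pair_monomial_moment e (sD _ js)).2.
Qed.

Section Coordinates.
Variable L : nat.
Local Notation J := ('I_L.+1 * 'I_(L.*2.+1))%type.
Implicit Types j : J.

Definition coord j w : R :=
  if valid_index j then gauss_coord (spin j) (order j) w else 0.

(** The coordinates of invalid index are constant zero, hence the moment of
    exponent 0 is 1 and the other ones vanish. *)
Definition coord_moment j n : R :=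
  if valid_index j then gaussian_moment (1 : R) n else (n == 0%N)%:R.

Definition index_of l (n : int) : J := (inord l, inord (absz (n + L%:Z))).

Lemma spin_index_of l n : (l <= L)%N -> spin (index_of l n) = l.
Proof. by move=> lL; rewrite /spin /= inordK. Qed.

Lemma order_index_of l n : `|n| <= L%:Z -> order (index_of l n) = n.
Proof. by move=> nL; rewrite /order /order_of /= inordK; lia. Qed.

(** Independence is given between the pairs formed by a degree and a nonnegative
    order, so the two coordinates of orders n and -n are grouped together. *)
Definition abs_index j : 'I_L.+1 * 'I_L.+1 := (j.1, inord `|order j|%N).

Lemma abs_indexP j (k : 'I_L.+1 * 'I_L.+1) :
  (0 < k.1)%N && (k.2 <= k.1)%N ->
  (valid_index j && (abs_index j == k))
  = (j == index_of k.1 (k.2 : nat)%:Z) || (j == index_of k.1 (- (k.2 : nat)%:Z)).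
Proof.
case: k => l m /= /andP[l0 ml].
have lL : (l <= L)%N by rewrite -ltnS.
have mL : (m <= L)%N by rewrite -ltnS.
apply/idP/idP.
  move=> /andP[/andP[_ oj] /eqP[jl]] /(congr1 val); rewrite /= inordK; last first.
    by have := ltn_ord j.1; rewrite -/(spin j); lia.
  move=> jm; apply/orP.
  have [h0|h0] := leP 0 (order j); [left|right]; apply/eqP; apply: order_inj.
  - by rewrite spin_index_of// /spin jl.
  - by rewrite order_index_of; lia.
  - by rewrite spin_index_of// /spin jl.
  - by rewrite order_index_of; lia.
have val n : `|n| = m%:Z -> valid_index (index_of l n) && (abs_index (index_of l n) == (l, m)).
  move=> nm; rewrite /valid_index /abs_index spin_index_of// order_index_of; last by lia.
  rewrite l0 /=; apply/andP; split; first by lia.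
  by apply/eqP; congr pair; apply/val_inj; rewrite /= inordK//; lia.
by move=> /orP[/eqP->|/eqP->]; apply: val; lia.
Qed.

Lemma prod_coord (A : comPzRingType) (F : J -> A) :
  \prod_(j | valid_index j) F j
  = \prod_(lm <- [seq (k.1 : nat, k.2 : nat) |
       k : 'I_L.+1 * 'I_L.+1 in [pred k : 'I_L.+1 * 'I_L.+1 | (0 < k.1)%N && (k.2 <= k.1)%N]])
     (if lm.2 == 0%N then F (index_of lm.1 0)
      else F (index_of lm.1 lm.2%:Z) * F (index_of lm.1 (- lm.2%:Z))).
Proof.
rewrite (partition_big abs_index [pred k : 'I_L.+1 * 'I_L.+1 | (0 < k.1)%N && (k.2 <= k.1)%N]) /=; last first.
  move=> j /andP[j0 oj]; rewrite -/(spin j) j0 /= inordK; first by rewrite -/(spin j); lia.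
  by have := ltn_ord j.1; rewrite -/(spin j); lia.
rewrite big_map big_enum_cond /=; apply: eq_big => [k|k kP]; first by rewrite inE andbT.
rewrite (eq_bigl _ _ (fun j => abs_indexP j kP)).
case: eqP => [k0|/eqP k0].
  by rewrite k0 oppr0 (eq_bigl _ _ (fun j => orbb _)) big_pred1_eq.
rewrite (bigD1 (index_of k.1 (k.2 : nat)%:Z)) ?eqxx//=; congr (_ * _).
have kL : (k.2 <= L)%N by rewrite -ltnS.
rewrite (big_pred1 (index_of k.1 (- (k.2 : nat)%:Z)))// => j /=.
case: (j =P index_of _ (- _)) => [->|]; last by rewrite orbF andbN.
rewrite orbT; apply/eqP => /(congr1 (@order _)).
by rewrite !order_index_of; lia.
Qed.

Lemma coord_monomial_moment (m : J -> nat) :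
  P.-integrable setT (fun w => (\prod_j coord j w ^+ m j)%:E) /\
  (\int[P]_w (\prod_j coord j w ^+ m j)%:E = (\prod_j coord_moment j (m j))%:E)%E.
Proof.
have [/existsP[j /andP[jv mj]]|] := boolP [exists j, ~~ valid_index j && (m j != 0%N)].
  have -> : (fun w => (\prod_j coord j w ^+ m j)%:E) = (fun=> 0%:E).
    apply/funext => w; rewrite (bigD1 j)//= /coord (negPf jv) expr0n.
    by rewrite (negPf mj) mul0r.
  rewrite integral0 (bigD1 j)//= /coord_moment (negPf jv) (negPf mj) mul0r.
  by split=> //; exact: integrable0.
rewrite negb_exists => /forallP inv0.
have prodE (F G : J -> R) : (forall j, valid_index j -> F j = G j) ->
    (forall j, ~~ valid_index j -> F j = 1) -> \prod_j F j = \prod_(j | valid_index j) G j.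
  move=> FG F1; rewrite (bigID (@valid_index L))/= [X in _ * X]big1 ?mulr1.
    by apply: eq_bigr => j; exact: FG.
  by move=> j; exact: F1.
have inv j : ~~ valid_index j -> m j = 0%N.
  by move=> jv; have := inv0 j; rewrite jv /= negbK => /eqP.
pose e l n := m (index_of l n).
pose s := [seq (k.1 : nat, k.2 : nat) |
  k : 'I_L.+1 * 'I_L.+1 in [pred k : 'I_L.+1 * 'I_L.+1 | (0 < k.1)%N && (k.2 <= k.1)%N]].
have us : uniq s.
  rewrite map_inj_uniq ?enum_uniq// => -[k1 k2] [k1' k2'] /= [h1 h2].
  by congr pair; apply: val_inj.
have sP lm : lm \in s -> [/\ (0 < lm.1)%N, (lm.2 <= lm.1)%N, (lm.1 <= L)%N & (lm.2 <= L)%N].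
  by move=> /mapP[k]; rewrite mem_enum inE => /andP[k1 k2] -> /=; rewrite -!(ltnS _ L); split.
have sD lm : lm \in s -> coef_index lm by move=> /sP[].
have [] := pair_monomials_moment e us sD.
have -> : (fun w => (\prod_j coord j w ^+ m j)%:E)
    = (fun w => (\prod_(lm <- s) pair_monomial e lm (coef_pair lm w))%:E).
  apply/funext => w; congr EFin.
  rewrite (prodE _ (fun j => gauss_coord (spin j) (order j) w ^+ m j)); first last.
  - by move=> j jv; rewrite inv.
  - by move=> j jv; rewrite /coord jv.
  rewrite prod_coord big_seq [RHS]big_seq; apply: eq_bigr => -[l n] /sP[/= l0 nl lL nL].
  rewrite !spin_index_of// !order_index_of ?normrN//.
  rewrite /gauss_coord eqxx /e /pair_monomial /coef_pair /=.
  have [->//|n0] := eqVneq n 0%N.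
  have -> : (n%:Z == 0) = false by apply/negP; lia.
  have -> : (- n%:Z == 0) = false by apply/negP; lia.
  have -> : (0 < n%:Z) by lia.
  have -> : (0 < - n%:Z) = false by apply/negP; lia.
  by rewrite abszN.
move=> int1 ->; split=> //; congr EFin.
rewrite (prodE _ (fun j => gaussian_moment (1 : R) (m j))); first last.
- by move=> j jv; rewrite inv// /coord_moment (negPf jv).
- by move=> j jv; rewrite /coord_moment jv.
by rewrite prod_coord; apply: eq_bigr => -[l n] _.
Qed.

End Coordinates.
End GaussianCoordinates.

(** * Gaussian expectation of polynomials *)

Section PolynomialExpectation.
Local Open Scope classical_set_scope.
Context d (Omega : measurableType d) (R : realType) (J : finType).
Variables (P : probability Omega R) (g : J -> Omega -> R) (mom : J -> nat -> R).
Variable valid : pred J.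
Hypothesis monomial_moment : forall m : J -> nat,
  P.-integrable setT (fun w => (\prod_j g j w ^+ m j)%:E) /\
  (\int[P]_w (\prod_j g j w ^+ m j)%:E = (\prod_j mom j (m j))%:E)%E.
Hypothesis mom_rec : forall j n, valid j -> mom j n.+1 = n%:R * mom j n.-1.

Local Notation A := (mpoly #|J| R).

Definition at_point (p : A) w : R := meval (fun k => g (enum_val k) w) p.
Definition var_of j : A := mpolyX R (mnm1 (enum_rank j)).
Definition partial j (p : A) : A := mderiv (enum_rank j) p.
Definition expectation (p : A) : R := fine (\int[P]_w (at_point p w)%:E).

Lemma at_monomial m w :
  at_point (mpolyX R m) w = \prod_j g j w ^+ m (enum_rank j).
Proof.
rewrite /at_point mevalX [RHS](reindex_onto enum_val enum_rank) /=; last first.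
  by move=> j _; exact: enum_rankK.
by apply: eq_big => [k|k _]; rewrite enum_valK ?eqxx.
Qed.

Lemma integrable_at_point p : P.-integrable setT (fun w => (at_point p w)%:E).
Proof.
elim/mpolyind: p => [|c m p _ _ IH].
  have -> : (fun w => (at_point 0 w)%:E) = (fun=> 0%E).
    by apply/funext => w; rewrite /at_point meval0.
  exact: integrable0.
have -> : (fun w => (at_point (c *: mpolyX R m + p) w)%:E)
    = (fun w => c%:E * (at_point (mpolyX R m) w)%:E + (at_point p w)%:E)%E.
  by apply/funext => w; rewrite /at_point mevalD mevalZ EFinD EFinM.
apply: integrableD => //; apply: integrableZl => //.
under eq_fun do rewrite at_monomial.
exact: (monomial_moment _).1.
Qed.

Lemma expectationE p : (\int[P]_w (at_point p w)%:E = (expectation p)%:E)%E.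
Proof. by rewrite fineK//; apply: integrable_fin_num => //; exact: integrable_at_point. Qed.

Lemma expectation_lin (a : R) p q :
  expectation (a *: p + q) = a * expectation p + expectation q.
Proof.
apply: EFin_inj; rewrite -expectationE EFinD EFinM -!expectationE.
rewrite -integralZl//; last exact: integrable_at_point.
rewrite -integralD//; last 2 first.
- by apply: integrableZl => //; exact: integrable_at_point.
- exact: integrable_at_point.
by apply: eq_integral => w _; rewrite /at_point mevalD mevalZ EFinD EFinM.
Qed.

Lemma expectation_1 : expectation 1 = 1.
Proof.
rewrite /expectation; under eq_integral do rewrite /at_point meval1.
by rewrite integral_cst//= mul1e probability_setT.
Qed.

Lemma expectation_monomial m :
  expectation (mpolyX R m) = \prod_j mom j (m (enum_rank j)).
Proof.
rewrite /expectation; under eq_integral do rewrite at_monomial.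
by rewrite (monomial_moment _).2.
Qed.

(** By linearity it is enough to treat monomials, for which it is the
    recurrence E(g^(n + 1)) = n E(g^(n - 1)). *)
Lemma expectation_stein i p : valid i ->
  expectation (var_of i * p) = expectation (partial i p).
Proof.
move=> vi; elim/mpolyind: p => [|c m p _ _ IH].
  by rewrite mulr0 /partial mderiv0.
rewrite mulrDr -scalerAr expectation_lin IH /partial mderivD mderivZ expectation_lin.
congr (c * _ + _).
rewrite /var_of -mpolyXD mderivX -[_ *: _]addr0 expectation_lin.
have -> : expectation 0 = 0.
  by have := expectation_lin (-1) 0 0; rewrite scaler0 addr0 mulN1r addNr.
rewrite addr0 !expectation_monomial (bigD1 i)//= [in RHS](bigD1 i)//=.
rewrite !mnmDE !mnmBE !mnm1E eqxx add1n subn1 mom_rec// mulrA; congr (_ * _).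
apply: eq_bigr => j ji; rewrite !mnmDE !mnmBE !mnm1E.
by rewrite (inj_eq enum_rank_inj) eq_sym (negPf ji) add0n subn0.
Qed.

Lemma partial_lin j (a : R) p q : partial j (a *: p + q) = a *: partial j p + partial j q.
Proof. by rewrite /partial mderivD mderivZ. Qed.

Lemma partial_mul j p q : partial j (p * q) = partial j p * q + p * partial j q.
Proof. by rewrite /partial mderivM. Qed.

Lemma partial_var i j : partial i (var_of j) = (i == j)%:R.
Proof.
rewrite /partial /var_of mderivX mnm1E (inj_eq enum_rank_inj) eq_sym.
case: eqP => [->|_]; last by rewrite scale0r.
by rewrite scale1r -mpolyX0; congr mpolyX; apply/mnmP => k; rewrite mnmBE mnm0E subnn.
Qed.

End PolynomialExpectation.

(** * The bispectrum as a cubic form *)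

Section HarmonicExpansion.
Local Open Scope complex_scope.
Context d (Omega : measurableType d) (R : realType).
Variables (P : probability Omega R) (C : nat -> R) (a : nat -> int -> Omega -> R[i]).
Hypothesis C_gt0 : forall l, (0 < l)%N -> 0 < C l.
Hypothesis gc : gaussian_coefficients P C a.
Local Notation gauss := (gauss_coord C a).

(** The factor 1 / sqrt 2 of the change of basis compensates the variance C / 2
    of the real and imaginary parts. *)
Lemma gauss_expansion_nneg l (m : nat) w : (0 < l)%N -> (m <= l)%N ->
  a l m%:Z w = (Num.sqrt (C l))%:C * msum l (fun n => basis_coef R m%:Z n * (gauss l n w)%:C).
Proof.
move=> l0 ml; have sC : Num.sqrt (C l) != 0 by rewrite gt_eqF// sqrtr_gt0 C_gt0.
have [->|m0] := eqVneq m 0%N.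
  rewrite (msum_single (m := 0))//; last first.
    by move=> n n0; rewrite /basis_coef eqxx (negPf n0) mul0r.
  rewrite /basis_coef /gauss_coord !eqxx mul1r -rmorphM /= mulrC divfK//.
  by case: (a l 0 w) (coef0_real gc w l0) => x y /= ->.
have mZ : m%:Z != 0 by lia.
rewrite (msum_two mZ); [|lia|]; last by move=> n nm; rewrite basis_coef_eq0 ?mul0r.
have N1 : (m%:Z == - m%:Z) = false by lia.
have N2 : (- m%:Z == m%:Z) = false by lia.
have N3 : (- m%:Z == 0) = false by lia.
have pos : 0 < m%:Z by lia.
have neg : (0 < - m%:Z) = false by lia.
rewrite /basis_coef /gauss_coord (negPf mZ) N1 N2 N3 pos neg !eqxx abszN /= !mul1r !mul0r.
have s2 : isqrt2 R != 0 by rewrite invr_eq0 gt_eqF// sqrtr_gt0.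
have -> : Num.sqrt (C l / 2) = Num.sqrt (C l) * isqrt2 R.
  by rewrite sqrtrM ?ltW ?C_gt0// sqrtrV.
rewrite [LHS]complex_split; apply/eqP; rewrite eq_complex /=.
by apply/andP; split; apply/eqP; field; rewrite s2.
Qed.

Lemma gauss_expansion l (m : int) w : (0 < l)%N -> `|m| <= l%:Z ->
  a l m w = (Num.sqrt (C l))%:C * msum l (fun n => basis_coef R m n * (gauss l n w)%:C).
Proof.
move=> l0 ml; have [m0|m0] := leP 0 m.
  by rewrite -(gez0_abs m0) gauss_expansion_nneg//; lia.
have -> : m = - (`|m|%N)%:Z by lia.
have ml' : (`|m| <= l)%N by lia.
rewrite (coef_conj gc)// gauss_expansion_nneg// conjcM conjc_real conjc_msum mulrCA.
congr (_ * _); rewrite /msum mulr_sumr; apply: eq_bigr => i _.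
by rewrite conjcM conjc_real basis_coef_conj mulrA mulrA sign_sqr mul1r.
Qed.

Lemma sum_triple (M : nmodType) (I1 I2 I3 : finType) (F : I1 -> I2 -> I3 -> M) :
  \sum_i1 \sum_i2 \sum_i3 F i1 i2 i3 = \sum_(i : I1 * I2 * I3) F i.1.1 i.1.2 i.2.
Proof. by rewrite !pair_bigA. Qed.

Lemma exchange_sum33 (M : nmodType) (I1 I2 I3 J1 J2 J3 : finType)
    (F : I1 -> I2 -> I3 -> J1 -> J2 -> J3 -> M) :
  \sum_i1 \sum_i2 \sum_i3 \sum_j1 \sum_j2 \sum_j3 F i1 i2 i3 j1 j2 j3
  = \sum_j1 \sum_j2 \sum_j3 \sum_i1 \sum_i2 \sum_i3 F i1 i2 i3 j1 j2 j3.
Proof.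
transitivity (\sum_(i : I1 * I2 * I3) \sum_(j : J1 * J2 * J3)
    F i.1.1 i.1.2 i.2 j.1.1 j.1.2 j.2).
  rewrite (sum_triple (fun i1 i2 i3 => \sum_j1 \sum_j2 \sum_j3 F i1 i2 i3 j1 j2 j3)).
  by apply: eq_bigr => i _; exact: sum_triple.
rewrite exchange_big (sum_triple (fun j1 j2 j3 => \sum_i1 \sum_i2 \sum_i3 F i1 i2 i3 j1 j2 j3)).
by apply: eq_bigr => j _; rewrite (sum_triple (fun i1 i2 i3 => F i1 i2 i3 _ _ _)).
Qed.

Lemma bispectrum_real_form l1 l2 l3 w :
  (0 < l1)%N -> (0 < l2)%N -> (0 < l3)%N ->
  unit_invariant l1 l2 l3 (wigner3j R l1 l2 l3) ->
  complex.Re (bispectrum a l1 l2 l3 w)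
  = Num.sqrt (C l1 * C l2 * C l3) * msum l1 (fun n1 => msum l2 (fun n2 => msum l3 (fun n3 =>
      complex.Re (real_tensor l1 l2 l3 (wigner3j R l1 l2 l3) n1 n2 n3)
      * (gauss l1 n1 w * (gauss l2 n2 w * gauss l3 n3 w))))).
Proof.
move=> h1 h2 h3.
have [W WE] : exists W, W = wigner3j R l1 l2 l3 by exists (wigner3j R l1 l2 l3).
rewrite -WE => uW.
set rhs := RHS; suff -> : bispectrum a l1 l2 l3 w = rhs%:C by [].
rewrite {}/rhs /bispectrum -WE !sqrtrM ?mulr_ge0 ?ltW ?C_gt0//.
set c1 := Num.sqrt _; set c2 := Num.sqrt _; set c3 := Num.sqrt _.
pose x l m n := basis_coef R m n * (gauss l n w)%:C.
have E l i : (0 < l)%N -> a l (@order_of l i) w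
    = (Num.sqrt (C l))%:C * \sum_(j < l.*2.+1) x l (order_of i) (order_of j).
  move=> l0; rewrite gauss_expansion//.
  by rewrite /order_of; have := ltn_ord i; lia.
transitivity ((c1 * c2 * c3)%:C * \sum_(i1 < l1.*2.+1) \sum_(i2 < l2.*2.+1) \sum_(i3 < l3.*2.+1)
   \sum_(j1 < l1.*2.+1) \sum_(j2 < l2.*2.+1) \sum_(j3 < l3.*2.+1)
   (W (order_of i1) (order_of i2) (order_of i3))%:C
     * x l1 (order_of i1) (order_of j1) * x l2 (order_of i2) (order_of j2)
     * x l3 (order_of i3) (order_of j3)).
  rewrite mulr_sumr; apply: eq_bigr => i1 _; rewrite mulr_sumr; apply: eq_bigr => i2 _.
  rewrite mulr_sumr; apply: eq_bigr => i3 _; rewrite !E// !rmorphM /= -/c1 -/c2 -/c3.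
  set s1 := \sum_j x l1 _ _; set s2 := \sum_j x l2 _ _; set s3 := \sum_j x l3 _ _.
  set u := (W _ _ _)%:C.
  transitivity (c1%:C * c2%:C * c3%:C * (u * s1 * s2 * s3)); first by ring.
  congr (_ * _); rewrite /s1 mulr_sumr mulr_suml mulr_suml; apply: eq_bigr => j1 _.
  by rewrite /s2 mulr_sumr mulr_suml; apply: eq_bigr => j2 _; rewrite mulr_sumr.
rewrite exchange_sum33 [RHS]rmorphM /=; congr (_ * _).
rewrite /msum rmorph_sum; apply: eq_bigr => j1 _ /=.
rewrite rmorph_sum; apply: eq_bigr => j2 _ /=.
rewrite rmorph_sum; apply: eq_bigr => j3 _ /=.
rewrite rmorphM /= -real_tensor_real// real_tensorE /msum mulr_suml.
apply: eq_bigr => i1 _; rewrite mulr_suml; apply: eq_bigr => i2 _.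
rewrite mulr_suml; apply: eq_bigr => i3 _; rewrite /x !rmorphM /=.
ring.
Qed.

Section Coordinates.
Variable L : nat.
Local Notation J := ('I_L.+1 * 'I_(L.*2.+1))%type.
Local Notation g := (@coord d Omega R C a L).

(** Expanding each coefficient in the real coordinates turns the 3j symbol into
    its real tensor, and the product of coordinates is symmetric, so the tensor
    can be symmetrized. *)
Lemma normalized_bispectrum_sum l1 l2 l3 w : ordered_admissible L l1 l2 l3 ->
  normalized_bispectrum a C l1 l2 l3 w
  = (-1) ^+ (l1 + l2 + l3)./2 *
    \sum_i \sum_j \sum_k @sym_tensor R L l1 l2 l3 i j k * (g i w * (g j w * g k w)).
Proof.
move=> oa; rewrite dot_symmetrize; first last.
- by move=> i j k; ring.
- by move=> i j k; ring.
have uW := wigner_unit R oa.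
case/and4P: (oa) => /and5P[h1 h2 h3 _ _] l12 l23 l3L.
have l2L : (l2 <= L)%N by exact: leq_trans l23 l3L.
have l1L : (l1 <= L)%N by exact: leq_trans l12 l2L.
rewrite /normalized_bispectrum -mulrA; congr (_ * _).
rewrite bispectrum_real_form// mulrAC mulfV ?mul1r; last first.
  by rewrite gt_eqF// sqrtr_gt0 !mulr_gt0 ?C_gt0.
rewrite -(sum_in_spin _ l1L); apply: eq_bigr => i _.
have [il1|il1] := boolP (in_spin l1 i); last first.
  rewrite big1// => j _; rewrite big1// => k _.
  by rewrite /wigner_tensor /spin_tensor (negPf il1) mul0r.
rewrite -(sum_in_spin _ l2L); apply: eq_bigr => j _.
have [jl2|jl2] := boolP (in_spin l2 j); last first.
  rewrite big1// => k _.
  by rewrite /wigner_tensor /spin_tensor (negPf jl2) andbF mul0r.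
rewrite -(sum_in_spin _ l3L); apply: eq_bigr => k _.
rewrite /wigner_tensor /spin_tensor il1 jl2 /=.
case: ifP => [kl3|]; last by rewrite mul0r.
rewrite /coord (in_spin_valid h1 il1) (in_spin_valid h2 jl2) (in_spin_valid h3 kl3).
by move: il1 jl2 kl3 => /andP[/eqP-> _] /andP[/eqP-> _] /andP[/eqP-> _].
Qed.

End Coordinates.
End HarmonicExpansion.

(** * Even moments of the bispectrum *)

Section EvenMoments.
Variables (I : finType) (p : I -> nat).

Definition even_copies : seq I := flatten [seq nseq (2 * p i) i | i <- enum I].

Lemma prod_even_copies (S : comPzRingType) (F : I -> S) :
  \prod_(i <- even_copies) F i = \prod_i F i ^+ (2 * p i).
Proof.
rewrite big_flatten big_map big_enum; apply: eq_bigr => i _.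
by rewrite big_nseq iter_mulr_1.
Qed.

Lemma count_even_copies i : count_mem i even_copies = (2 * p i)%N.
Proof.
rewrite count_flatten -map_comp sumnE big_map big_enum (bigD1 i)//= count_nseq /= eqxx mul1n.
by rewrite big1 ?addn0// => j ji; rewrite count_nseq /= (negPf ji).
Qed.

Lemma gaussian_moment_even (R : realFieldType) (x : R) n :
  gaussian_moment x (2 * n) = (odd_double_fact n)%:R * x ^+ n.
Proof.
elim: n => [|n IH]; first by rewrite /odd_double_fact big_ord0 mulr1.
rewrite mulnS /= -/(2 * n)%N IH /odd_double_fact big_ord_recr /= natrM exprS addn1.
by ring.
Qed.

Lemma limit_moment_even_copies (R : realFieldType) (Delta : I -> nat) :
  limit_moment (fun i => (Delta i)%:R : R) even_copies
    = (\prod_i (odd_double_fact (p i) * Delta i ^ p i)%N%:R).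
Proof.
apply: eq_bigr => i _.
by rewrite count_even_copies gaussian_moment_even natrM natrX.
Qed.

End EvenMoments.

Lemma bisp_Delta_le6 l1 l2 l3 : (bisp_Delta l1 l2 l3 <= 6)%N.
Proof. by rewrite /bisp_Delta; case: eqP; case: eqP; case: eqP. Qed.

Section GaussianBispectrum.
Context d (Omega : measurableType d) (R : realType).
Variables (P : probability Omega R) (C : nat -> R) (a : nat -> int -> Omega -> R[i]).
Hypothesis C_gt0 : forall l, (0 < l)%N -> 0 < C l.
Hypothesis gc : gaussian_coefficients P C a.
Variables (V : finType) (l1 l2 l3 : V -> nat) (L l0 : nat).
Hypothesis adm : forall v, ordered_admissible L (l1 v) (l2 v) (l3 v).
Hypothesis distinct : forall u v, u != v -> (l1 u, l2 u, l3 u) <> (l1 v, l2 v, l3 v).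
Hypothesis l0_le : forall v, (l0 <= l1 v)%N.

Local Notation J := ('I_L.+1 * 'I_(L.*2.+1))%type.
Local Notation g := (@coord d Omega R C a L).
Local Notation E := (expectation P g).
Let S v : J -> J -> J -> R := sym_tensor R (l1 v) (l2 v) (l3 v).
Let eps : R := (2 * l0 + 1)%N%:R^-1.
Let Delta v : R := (bisp_Delta (l1 v) (l2 v) (l3 v))%:R.

Lemma coord_moment_rec (j : J) n : valid_index j ->
  coord_moment R j n.+1 = n%:R * coord_moment R j n.-1.
Proof.
by rewrite /coord_moment => ->; case: n => [|n] /=; rewrite ?mul0r ?mulr1.
Qed.

Lemma sym_tensor_cross u v :
  6 * (\sum_i \sum_j \sum_k S u i j k * S v i j k) = (u == v)%:R * Delta u.
Proof.
have [<-|uv] := eqVneq u v; first by rewrite mul1r sym_tensor_dot.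
by rewrite sym_tensor_dot0 ?mulr0 ?mul0r//; exact: distinct.
Qed.

Lemma Delta_bounds v : 0 <= Delta v <= 6.
Proof. by rewrite ler0n ler_nat bisp_Delta_le6. Qed.

(** Its squared norm is Delta / 6, and Delta is at most 6. *)
Lemma sym_tensor_norm_le1 v : \sum_i \sum_j \sum_k S v i j k ^+ 2 <= 1.
Proof.
have := sym_tensor_cross v v; rewrite eqxx mul1r => h.
have /andP[_] := Delta_bounds v; rewrite -h.
by rewrite -[leRHS]mulr1 ler_pM2l.
Qed.

Lemma inv_dim_le v : [/\ ((l1 v).*2.+1)%:R^-1 <= eps, ((l2 v).*2.+1)%:R^-1 <= eps
  & ((l3 v).*2.+1)%:R^-1 <= eps].
Proof.
case/and4P: (adm v) => _ h12 h23 _; have h := l0_le v.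
by split; rewrite /eps lef_pV2 ?posrE ?ltr0n ?addn1// ler_nat; lia.
Qed.

Lemma E_prod_bound (N : seq V) :
  `|E (cube_prod (@var_of R J) S N) - limit_moment Delta N| <= chaos_const R (size N) * eps.
Proof.
have mm := @coord_monomial_moment _ _ _ _ _ _ C_gt0 gc L.
have oa v := adm v.
apply: (@chaos_product_bound R J _ (@var_of R J) (@partial R J) E (@valid_index L)).
- exact: partial_lin.
- exact: partial_mul.
- by move=> i j; rewrite partial_var eq_sym.
- exact: (expectation_lin mm).
- exact: expectation_1.
- by move=> i q; exact: (expectation_stein mm coord_moment_rec).
- by move=> v i j k; exact: symmetrize12.
- by move=> v i j k; exact: symmetrize23.
- move=> v i j k; case/and4P: (adm v) => /and5P[h1 h2 h3 _ _] _ _ _.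
  exact: symmetrize_valid.
- move=> v k; case/and4P: (adm v) => /and5P[h1 h2 h3 _ _] l12 l23 l3L.
  have l2L := leq_trans l23 l3L; have l1L := leq_trans l12 l2L.
  exact: (symmetrize_trace (wigner_unit R (adm v))).
- exact: sym_tensor_norm_le1.
- by rewrite invr_ge0 ler0n.
- move=> v; case/and4P: (adm v) => _ l12 l23 l3L; have [e1 e2 e3] := inv_dim_le v.
  have l2L := leq_trans l23 l3L; have l1L := leq_trans l12 l2L.
  exact: (symmetrize_gain (wigner_unit R (adm v))).
- exact: sym_tensor_cross.
- exact: Delta_bounds.
Qed.

Lemma at_point_cube_prod (N : seq V) w :
  at_point g (cube_prod (@var_of R J) S N) w
  = \prod_(v <- N) \sum_i \sum_j \sum_k S v i j k * (g i w * (g j w * g k w)).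
Proof.
rewrite /at_point /cube_prod rmorph_prod; apply: eq_bigr => v _.
rewrite /cube; do 3 (rewrite rmorph_sum; apply: eq_bigr => ? _).
by rewrite /= mevalZ !mevalM !mevalXU !enum_rankK.
Qed.

Theorem even_bispectrum_moment_bound (p : V -> nat) :
  (`| 'E_P[fun w => (\prod_v normalized_bispectrum a C (l1 v) (l2 v) (l3 v) w
         ^+ (2 * p v))%R]
      - (\prod_v (odd_double_fact (p v)
           * bisp_Delta (l1 v) (l2 v) (l3 v) ^ p v)%N%:R)%R%:E |
   <= (chaos_const R (size (even_copies p)) / (2 * l0 + 1)%N%:R)%:E)%E.
Proof.
have mm := @coord_monomial_moment _ _ _ _ _ _ C_gt0 gc L.
have -> : ('E_P[fun w => (\prod_v normalized_bispectrum a C (l1 v) (l2 v) (l3 v) w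
         ^+ (2 * p v))%R] = (E (cube_prod (@var_of R J) S (even_copies p)))%:E)%E.
  rewrite -(expectationE mm) unlock; apply: eq_integral => w _; congr EFin.
  rewrite at_point_cube_prod prod_even_copies; apply: eq_bigr => v _.
  rewrite (normalized_bispectrum_sum C_gt0 gc w (adm v)) exprMn.
  by rewrite -exprM mulnCA exprM sqrrN !expr1n mul1r.
rewrite -(limit_moment_even_copies p R (fun v => bisp_Delta (l1 v) (l2 v) (l3 v))).
rewrite -EFinB abse_EFin lee_fin.
exact: E_prod_bound.
Qed.

End GaussianBispectrum.

Theorem theorem3p1 (R : realType) (I : nat) (hI : (0 < I)%N)
    (p : 'I_I -> nat) (hp : forall i, (0 < p i)%N) :
  exists K : R,
  forall (d : measure_display) (Omega : measurableType d)
    (P : probability Omega R) (T : 'rV[R]_3 -> Omega -> R) (C : nat -> R),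
  gaussian_isotropic_field P T ->
  spectral_representation P T (harmonic_coef T) ->
  (forall l : nat, (0 < l)%N -> 0 < C l) ->
  gaussian_coefficients P C (harmonic_coef T) ->
  forall l1 l2 l3 : 'I_I -> nat,
  (forall i, admissible (l1 i) (l2 i) (l3 i)) ->
  (forall i, (l1 i <= l2 i)%N /\ (l2 i <= l3 i)%N) ->
  (forall i i' : 'I_I, i != i' -> (l1 i, l2 i, l3 i) <> (l1 i', l2 i', l3 i')) ->
  (forall i, (l1 (Ordinal hI) <= l1 i)%N) ->
  (`| 'E_P[fun w => (\prod_(i < I)
         normalized_bispectrum (harmonic_coef T) C (l1 i) (l2 i) (l3 i) w
           ^+ (2 * p i))%R]
      - (\prod_(i < I) (odd_double_fact (p i)
           * bisp_Delta (l1 i) (l2 i) (l3 i) ^ p i)%N%:R)%R%:E |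
   <= (K / (2 * l1 (Ordinal hI) + 1)%N%:R)%:E)%E.
Proof.
exists (chaos_const R (size (even_copies p))).
move=> d Omega P T C _ _ C_gt0 gc l1 l2 l3 adm sorted distinct l1_min.
apply: (even_bispectrum_moment_bound C_gt0 gc (L := \max_i l3 i)) => //.
move=> i; have [h12 h23] := sorted i.
by apply/and4P; split=> //; exact: leq_bigmax.
Qed.
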